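(* Let $\mu=(\mu_i)_{i\ge 0}$ and $\nu=(\nu_i)_{i\ge 0}$ be two probability distributions on the nonnegative integers with finite second moments and with means $\bar{\mu}>0$, $\bar{\nu}>0$. Let $M_n$ be a sequence of (finite) random matrices over $\mathbb{R}$ all of whose entries are from $\{-1,0,+1\}$, with columns indexed by $C_n$ and rows indexed by $R_n$, where $R_n$ and $C_n$ are disjoint. Assume that $M_n$ converges locally to a $\mathrm{GW}_*(\mu,\nu)$-tree in probability. Let $\alpha$ and $\alpha'$ be the smallest and the largest solution, respectively, of $$t=f(\mu',1-f(\nu',1-t))$$ in the interval $[0,1]$. Let $$\Lambda(t)=f(\mu,1-f(\nu',1-t))-\frac{\bar{\mu}}{\bar{\nu}}\left(1-f(\nu,1-t)-\bar{\nu}\,t\,f(\nu',1-t)\right),$$ and assume that $\max_{t\in[0,1]}\Lambda(t)=\max(\Lambda(\alpha),\Lambda(\alpha'))$. Then $$\lim_{n\to\infty}\frac{\mathrm{rank}(M_n)}{|C_n|}=1-\max_{t\in[0,1]}\Lambda(t)\quad\text{in probability}.$$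
   Context: For a probability measure $\nu=(\nu_i)_{i\ge 0}$ on the nonnegative integers with finite nonzero mean $\bar{\nu}$, let $\nu'=(\nu'_i)_{i\ge 0}$ be the probability measure $\nu'_i=\frac{1}{\bar{\nu}}(i+1)\nu_{i+1}$, and let $f(\nu,t)=\sum_{i\ge 0}\nu_i t^i$. A $\mathrm{GW}_*(\mu,\nu)$-tree is the random rooted (multi-type Galton–Watson) tree in which numbers of children are independent, the root's number of children has law $\mu$, every vertex at odd distance from the root has a number of children with law $\nu'$, and every vertex at positive even distance from the root has a number of children with law $\mu'$. The Tanner graph of a matrix $M$ with rows indexed by $R$ and columns indexed by $C$ ($R,C$ disjoint) is the bipartite graph with color classes $R$ and $C$ in which $r\in R$ and $c\in C$ are adjacent iff $M(r,c)\ne 0$. Local convergence: graphs are locally finite. A rooted graph $(H,q)$ is a connected graph $H$ with a distinguished vertex $q$; its depth is the maximal distance of a vertex from $q$. For a graph $G$, vertex $o$ and integer $r\ge 0$, $B_r(G,o)$ is the subgraph induced by the vertices at distance at most $r$ from $o$, rooted at $o$; $\cong$ denotes rooted isomorphism. A set-rooted graph $(G,U)$ is a finite graph $G$ with a nonempty set $U$ of vertices; for a rooted graph $(H,q)$ of depth at most $r$ put $t_r(G,U,(H,q))=|\{o\in U:B_r(G,o)\cong(H,q)\}|/|U|$. A sequence of random set-rooted graphs $(G_n,U_n)$ converges in probability to a random rooted graph $(G,o)$ if for all integers $r\ge 0$ and all rooted graphs $(H,q)$ of depth at most $r$, $\lim_{n\to\infty}t_r(G_n,U_n,(H,q))=\mathbb{P}(B_r(G,o)\cong(H,q))$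 in probability. With $G_n$ the Tanner graph of $M_n$, we say $M_n$ converges locally to $(G,o)$ in probability if $(G_n,C_n)$ converges to $(G,o)$ in probability. *)

(* Defs.v *)
From HB Require Import structures.
From mathcomp Require Import all_boot all_order all_algebra.
From mathcomp Require Import all_classical all_reals all_analysis.

Set Implicit Arguments.
Unset Strict Implicit.
Unset Printing Implicit Defensive.

Import Order.TTheory GRing.Theory Num.Theory.
Import numFieldNormedType.Exports.

Local Open Scope classical_set_scope.
Local Open Scope ring_scope.

Section Distributions.
Variable R : realType.
Implicit Type nu : nat -> R.

Definition is_distribution nu :=
  (forall i, 0 <= nu i) /\ series nu @ \oo --> (1 : R).

Definition finite_second_moment nu :=
  cvgn (series (fun i => i%:R ^+ 2 * nu i)).

Definition mean nu : R := limn (series (fun i => i%:R * nu i)).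

Definition size_biased nu : nat -> R :=
  fun i => (mean nu)^-1 * (i.+1)%:R * nu i.+1.

Definition pgf nu (t : R) : R := limn (series (fun i => nu i * t ^+ i)).

Definition fixed_points (mu nu : nat -> R) : set R :=
  [set t | 0 <= t <= 1 /\
    t = pgf (size_biased mu) (1 - pgf (size_biased nu) (1 - t))].

Definition Lambda (mu nu : nat -> R) (t : R) : R :=
  pgf mu (1 - pgf (size_biased nu) (1 - t))
  - mean mu / mean nu
    * (1 - pgf nu (1 - t) - mean nu * t * pgf (size_biased nu) (1 - t)).

Definition is_min (A : set R) (x : R) := A x /\ lbound A x.
Definition is_max (A : set R) (x : R) := A x /\ ubound A x.

End Distributions.

Record graph (V : Type) := Graph {
  adj : V -> V -> Prop;
  adj_sym : forall x y, adj x y -> adj y x;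
  adj_irrefl : forall x, ~ adj x x
}.

(* [dist_le G r x y]: the distance from x to y in G is at most r. *)
Fixpoint dist_le (V : Type) (G : graph V) (r : nat) (x y : V) : Prop :=
  if r is r'.+1
  then dist_le G r' x y \/ exists2 z, dist_le G r' x z & adj G z y
  else x = y.

Definition connected_graph (V : Type) (G : graph V) :=
  forall x y, exists r, dist_le G r x y.

Definition locally_finite_graph (V : Type) (G : graph V) :=
  forall x, finite_set [set y | adj G x y].

Section Induced.
Variables (V : Type) (G : graph V) (A : set V).

Definition induced_adj (x y : {v : V | A v}) := adj G (sval x) (sval y).

Lemma induced_adj_sym x y : induced_adj x y -> induced_adj y x.
Proof. exact: adj_sym. Qed.

Lemma induced_adj_irrefl x : ~ induced_adj x x.
Proof. exact: adj_irrefl. Qed.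

Definition induced : graph {v : V | A v} :=
  Graph induced_adj_sym induced_adj_irrefl.

End Induced.

(* A graph with a distinguished vertex; connectedness and local finiteness are
   imposed separately by [is_rooted_graph]. *)
Record pointed_graph := PointedGraph {
  pvertex : Type;
  pgraph : graph pvertex;
  proot : pvertex
}.

Definition is_rooted_graph (H : pointed_graph) :=
  connected_graph (pgraph H) /\ locally_finite_graph (pgraph H).

Definition depth_le (r : nat) (H : pointed_graph) :=
  forall x, dist_le (pgraph H) r (proot H) x.

Definition rooted_iso (G H : pointed_graph) :=
  exists f : pvertex G -> pvertex H,
    [/\ bijective f,
        forall x y, adj (pgraph G) x y <-> adj (pgraph H) (f x) (f y)
      & f (proot G) = proot H].

Lemma dist_le_refl (V : Type) (G : graph V) r x : dist_le G r x x.
Proof. by elim: r => [//|r IH]; left. Qed.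

Definition nbhd (V : Type) (G : graph V) (o : V) (r : nat) : pointed_graph :=
  PointedGraph (induced G [set v | dist_le G r o v])
               (exist _ o (dist_le_refl G r o)).

Record set_rooted_graph := SetRootedGraph {
  svertex : finType;
  sgraph : graph svertex;
  sroots : {set svertex};
  sroots_neq0 : sroots != finset.set0
}.

Definition nbhd_freq (R : realType) (r : nat) (S : set_rooted_graph)
    (H : pointed_graph) : R :=
  #|[pred o in sroots S | `[< rooted_iso (nbhd (sgraph S) o r) H >]]|%:R
  / #|sroots S|%:R.

Section ConvergenceInProbability.
Variables (R : realType) (d : nat -> measure_display).
Variable Omega : forall n, measurableType (d n).
Variable P : forall n, probability (Omega n) R.

(* The n-th random object lives on its own space [Omega n]; this makes sense
   because only deterministic limits are considered. *)
Definition cvg_in_prob (X : forall n, Omega n -> R) (l : R) :=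
  forall eps : R, 0 < eps ->
    (fun n => P n [set w | eps < `|X n w - l|]) @ \oo --> 0%E.

Definition local_cvg_in_prob (S : forall n, Omega n -> set_rooted_graph)
    (d0 : measure_display) (Omega0 : measurableType d0)
    (Q : probability Omega0 R) (T : Omega0 -> pointed_graph) :=
  forall (r : nat) (H : pointed_graph), is_rooted_graph H -> depth_le r H ->
    cvg_in_prob (fun n w => nbhd_freq R r (S n w) H)
      (fine (Q [set w | rooted_iso (nbhd (pgraph (T w)) (proot (T w)) r) H])).

End ConvergenceInProbability.

(* A finite matrix bundled with its dimensions. There is at least one column,
   as the set of roots of a set-rooted graph is nonempty. *)
Record fmatrix (R : Type) := FMatrix {
  nrows : nat;
  ncols : nat;
  ncols_gt0 : (0 < ncols)%N;
  mx : 'M[R]_(nrows, ncols)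
}.

Definition sign_entries (R : realType) (M : fmatrix R) :=
  forall i j, mx M i j \in [:: -1; 0; 1].

(* Measurability with respect to the discrete sigma-algebra on the (countable)
   set of finite matrices with entries in {-1, 0, 1}; the dimensions may be
   random as well. *)
Definition random_sign_matrix (R : realType) (d : measure_display)
    (Omega : measurableType d) (M : Omega -> fmatrix R) :=
  (forall w, sign_entries (M w)) /\
  (forall A : fmatrix R, measurable [set w | M w = A]).

Section Tanner.
Variables (R : realType) (M : fmatrix R).

Definition tanner_vertex : finType := ('I_(nrows M) + 'I_(ncols M))%type.

Definition tanner_adj (x y : tanner_vertex) : Prop :=
  match x, y with
  | inl i, inr j | inr j, inl i => mx M i j <> 0
  | _, _ => False
  end.

Lemma tanner_adj_sym x y : tanner_adj x y -> tanner_adj y x.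
Proof. by case: x; case: y. Qed.

Lemma tanner_adj_irrefl x : ~ tanner_adj x x.
Proof. by case: x => i []. Qed.

Definition tanner_graph : graph tanner_vertex :=
  Graph tanner_adj_sym tanner_adj_irrefl.

Definition column_vertices : {set tanner_vertex} :=
  [set inr j | j : 'I_(ncols M)]%SET.

Lemma column_vertices_neq0 : column_vertices != finset.set0.
Proof.
apply/finset.set0Pn; exists (inr (Ordinal (ncols_gt0 M))).
by apply/imsetP; exists (Ordinal (ncols_gt0 M)).
Qed.

Definition tanner_set_rooted : set_rooted_graph :=
  SetRootedGraph tanner_graph column_vertices_neq0.

End Tanner.

(* The plane tree determined by offspring numbers [x]: its vertices are the
   words i1...ik over nat (the root being the empty word) such that each letter
   is smaller than the offspring number of the prefix preceding it. *)
Section UlamHarris.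
Variable x : seq nat -> nat.

Definition in_tree (u : seq nat) : Prop :=
  forall k, (k < size u)%N -> (nth 0%N u k < x (take k u))%N.

Definition child_of (u v : seq nat) : Prop := exists i, v = rcons u i.

Definition word_adj (u v : seq nat) : Prop := child_of u v \/ child_of v u.

Lemma word_adj_sym u v : word_adj u v -> word_adj v u.
Proof. by case; [right | left]. Qed.

Lemma word_adj_irrefl u : ~ word_adj u u.
Proof.
by case=> -[i /(congr1 size)]; rewrite size_rcons => /n_Sn.
Qed.

Definition word_graph : graph (seq nat) := Graph word_adj_sym word_adj_irrefl.

Lemma in_tree_nil : in_tree [::].
Proof. by []. Qed.

Definition plane_tree : pointed_graph :=
  PointedGraph (induced word_graph in_tree) (exist _ [::] in_tree_nil).

End UlamHarris.

Section GaltonWatson.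
Variables (R : realType) (d : measure_display) (Omega : measurableType d).
Variable Q : probability Omega R.

Definition mutually_independent (I : eqType) (X : I -> {RV Q >-> nat}) :=
  forall (s : seq I) (B : I -> set nat), uniq s ->
    Q [set w | forall i, i \in s -> B i (X i w)] =
    (\prod_(i <- s) Q [set w | B i (X i w)])%E.

(* The law of the number of children of a vertex at distance k from the root. *)
Definition gw_star_law (mu nu : nat -> R) (k : nat) : nat -> R :=
  if k == 0%N then mu
  else if odd k then size_biased nu else size_biased mu.

(* [X u] is the number of children of the word u, which lies at distance
   [size u] from the root. *)
Definition gw_star_offspring (mu nu : nat -> R) (X : seq nat -> {RV Q >-> nat}) :=
  mutually_independent X /\
  forall u k, Q [set w | X u w = k] = (gw_star_law mu nu (size u) k)%:E.

Definition gw_tree (X : seq nat -> {RV Q >-> nat}) (w : Omega) : pointed_graph :=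
  plane_tree (fun u => X u w).

End GaltonWatson.

(* Main.v *)
(* Lower bound on the rank. If v is in the kernel of M and the ball of radius
   2k around the column c is a tree, then v(c)^2 <= Y |v|^2, where Y depends
   on the tree only: by Cauchy-Schwarz along the rows, Y = 1 at the leaves and
   Y = 1 / (1 + sum_i 1 / S_i) at a column whose i-th child row has children
   with values summing to S_i. As the corank is the trace of the orthogonal
   projection on the kernel, it is at most the sum over the columns of the
   value of their ball, so it remains to bound the expectation of Y at the root
   of the Galton-Watson tree. Were the law of Y at a non-root column invariant
   under the recursion, then, with t = P(Y > 0), size-biasing (exchangeability
   of the children of a row, resp. of a column) would turn this expectation
   into exactly Lambda(t). Invariance holds only in the limit k -> oo; at finite
   depth the identity is applied to Z = Y 1_{Y > eps}, where eps is a scale near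
   which Y has little mass and k is such that Y hardly changes from k to k + 1.

   Upper bound on the rank. The rank is at most the number of columns outside
   a set B plus the number of rows adjacent to B. Let a column send a positive
   message to a row when each of its other rows receives a positive message
   from another column, starting from constant messages b at depth 0, and let B
   consist of the columns all of whose rows receive a positive message from
   another column. The probability of a positive message tends to the smallest
   fixed point alpha for b = 0 and to the largest one alpha' for b = 1, and the
   rows adjacent to B receive two positive messages, which makes the density of
   this cover tend to 1 - Lambda(alpha), resp. 1 - Lambda(alpha'). *)

Require Import Defs.
From Stdlib Require List.
From HB Require Import structures.
From mathcomp Require Import all_boot all_order all_algebra.
From mathcomp Require Import all_classical all_reals all_analysis.
From mathcomp Require Import ring lra.

Set Implicit Arguments.
Unset Strict Implicit.
Unset Printing Implicit Defensive.

Import Order.TTheory GRing.Theory Num.Theory.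
Import numFieldNormedType.Exports.

(** * Plane trees of bounded depth and balls of a graph *)

(** All expectations are finite sums over plane trees with at most [D] children per vertex, and two
    weights live on these trees. The identities behind Lambda need total mass 1, so they are proved
    for laws whose mass beyond [D] is moved to 0; local convergence controls only the original
    weights, whose deficit is the probability of a large degree. For nonnegative functions the
    original expectation is at most the truncated one, and both bounds on the rank need only upper
    bounds for averages over columns: of the diagonal of the projection, and of a local cost of the
    cover. This also allows a column whose ball is not listed to count with a crude constant. The
    order of choices matters in the lower bound on the rank: the accuracy [kappa], the number [J] of
    scales and the number [N] of depths are fixed before [D]; only then do a scale, a depth below
    [N] and the parameter p appear. This p need not solve the fixed point equation, which is why the
    maximum of Lambda over all of [0,1] enters there, while the cover produces the two extreme fixed
    points. *)

Fixpoint ptree (K : nat) : countType :=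
  if K is K'.+1 then (seq (ptree K') : countType) else (unit : countType).

Section PlaneTreeBalls.
Variable x : seq nat -> nat.

Lemma in_tree_rcons u i : in_tree x (rcons u i) <-> in_tree x u /\ (i < x u)%N.
Proof.
split=> [h|[h1 h2] k].
  split.
    move=> k ku; have := h k; rewrite size_rcons (ltn_trans ku) // => /(_ isT).
    by rewrite nth_rcons ku -cats1 takel_cat // ltnW.
  have := h (size u); rewrite size_rcons => /(_ (leqnn _)).
  by rewrite nth_rcons ltnn eqxx -cats1 take_size_cat.
rewrite size_rcons ltnS leq_eqVlt => /predU1P[->|ku].
  by rewrite nth_rcons ltnn eqxx -cats1 take_size_cat.
by rewrite nth_rcons ku -cats1 takel_cat ?(ltnW ku) //; exact: h1.
Qed.

Let T := plane_tree x.

Lemma sig_inj (A : Type) (P : A -> Prop) (a b : {v : A | P v}) :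
  sval a = sval b -> a = b.
Proof. by case: a b => [a pa] [b pb] /= e; subst b; congr exist; exact: Prop_irrelevance. Qed.

Lemma dist_le_mono (V : Type) (G : graph V) r s a b : (r <= s)%N ->
  dist_le G r a b -> dist_le G s a b.
Proof.
by move=> /subnKC <-; elim: (s - r)%N => [|k IH]; rewrite ?addn0 // addnS => /IH; left.
Qed.

Lemma plane_tree_dist r v : dist_le (pgraph T) r (proot T) v <-> (size (sval v) <= r)%N.
Proof.
split.
  elim: r v => [|r IH] v /=; first by move=> <-.
  case=> [/IH|[z /IH h]]; first exact: leqW.
  rewrite /induced_adj /= => -[] [i e].
    by rewrite e size_rcons ltnS.
  by move: h; rewrite e size_rcons => /ltnW/leqW.
case: v => u; elim/last_ind: u r => [|u i IH] r hu /= sz.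
  apply: (@dist_le_mono _ _ 0) => //=; exact: sig_inj.
have [h1 h2] := (in_tree_rcons u i).1 hu.
case: r sz => [|r]; rewrite size_rcons // ltnS => sz.
right; exists (exist _ u h1); first exact: IH.
by left; exists i.
Qed.

Variable K : nat.

Definition tree_ball := nbhd (pgraph T) (proot T) K.

Definition valid u := in_tree x u /\ (size u <= K)%N.

Lemma validP u : valid u -> exists v : pvertex tree_ball, sval (sval v) = u.
Proof.
move=> [h s]; have d : dist_le (pgraph T) K (proot T) (exist _ u h) by apply/plane_tree_dist.
by exists (exist _ (exist _ u h) d).
Qed.

Lemma vertex_valid (v : pvertex tree_ball) : valid (sval (sval v)).
Proof. by split; [exact: (svalP (sval v)) | apply/(plane_tree_dist K (sval v))/(svalP v)]. Qed.

(** Distances are taken inside the ball, where paths may not leave it; the path through the prefixes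
    of a word stays there. *)
Lemma tree_ball_depth : depth_le K tree_ball.
Proof.
move=> v.
suff : forall r (w : pvertex tree_ball), (size (sval (sval w)) <= r)%N ->
    dist_le (pgraph tree_ball) r (proot tree_ball) w.
  by apply; case: (vertex_valid v).
elim=> [|r IH] w sw.
  by apply: sig_inj; apply: sig_inj; move: sw; rewrite leqn0 => /nilP.
have [uv us] := vertex_valid w.
case/lastP E : (sval (sval w)) => [|u i].
  by left; apply: IH; rewrite E.
have [h1 h2] := (in_tree_rcons u i).1 (eq_ind _ _ uv _ E).
have [w' ew'] : exists w' : pvertex tree_ball, sval (sval w') = u.
  apply: validP; split => //; move: us; rewrite E size_rcons; exact: ltnW.
right; exists w'.
  by apply: IH; move: sw; rewrite ew' E size_rcons.
by left; exists i; rewrite E ew'.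
Qed.

Lemma dist_le_sym_root (V : Type) (G : graph V) o : (forall v, exists r, dist_le G r o v) ->
  connected_graph G.
Proof.
move=> h.
have tr r s a b c : dist_le G r a b -> dist_le G s b c -> dist_le G (r + s) a c.
  elim: s c => [|s IH] c /= h1; first by move=> <-; rewrite addn0.
  case=> [/(IH _ h1)|[z /(IH _ h1) h2 h3]]; rewrite addnS /=; first by left.
  by right; exists z.
have sy r a b : dist_le G r a b -> dist_le G r b a.
  elim: r b => [|r IH] b /=; first by move=> ->.
  case=> [/IH|[z /IH h1 h2]]; first by left.
  have : dist_le G 1 b z by right; exists b => //; exact: adj_sym.
  by move=> /tr/(_ h1); rewrite add1n.
move=> a b; have [r hr] := h a; have [s hs] := h b.
by exists (r + s)%N; apply: tr hs; exact: sy.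
Qed.

(** Local convergence only speaks of connected, locally finite test graphs. The neighbours of a word
    are its parent and its finitely many children. *)
Lemma tree_ball_rooted : is_rooted_graph tree_ball.
Proof.
split.
  apply: (@dist_le_sym_root _ _ (proot tree_ball)) => v; exists K; exact: tree_ball_depth.
move=> v; set u := sval (sval v).
(* At the root, [take] returns the root itself, a harmless extra element. *)
pose s := take (size u).-1 u :: [seq rcons u i | i <- iota 0 (x u)].
apply: (@sub_finite_set _ _ [set y : pvertex tree_ball | sval (sval y) \in s]).
  move=> y /= [] [i e]; rewrite inE; apply/orP.
    right; apply/mapP; exists i => //; rewrite mem_iota add0n /=.
    have [hy _] := vertex_valid y; rewrite e in hy.
    by case: ((in_tree_rcons _ _).1 hy).
  by left; rewrite /u e size_rcons /= -cats1 take_size_cat.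
apply: (@finite_preimage _ _ [set` s] (fun y => sval (sval y))).
  by move=> a b _ _ e; do 2 apply: sig_inj.
exact: finite_seq.
Qed.

End PlaneTreeBalls.

(** * Encoding of the first K generations *)

Fixpoint tree_of K (x : seq nat -> nat) : ptree K :=
  match K return ptree K with
  | 0 => tt
  | K'.+1 => [seq tree_of K' (fun s => x (i :: s)) | i <- iota 0 (x [::])]
  end.

Fixpoint default_tree K : ptree K :=
  match K return ptree K with 0 => tt | _ => [::] end.

(** Words at depth [K] or outside the tree get 0, so that the plane tree of these numbers is the
    encoded tree and nothing more. *)
Fixpoint offspring K : ptree K -> seq nat -> nat :=
  match K return ptree K -> seq nat -> nat with
  | 0 => fun _ _ => 0
  | K'.+1 => fun ts u =>
     if u is i :: u' then offspring (nth (default_tree K') (ts : seq (ptree K')) i) u'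
     else size (ts : seq (ptree K'))
  end.

Lemma tree_of_offspring K (t : ptree K) : tree_of K (offspring t) = t.
Proof.
elim: K t => [|K IH] t /=; first by case: t.
apply: (@eq_from_nth _ (default_tree K)); first by rewrite size_map size_iota.
move=> i; rewrite size_map size_iota => it.
rewrite (nth_map 0) ?size_iota // nth_iota // add0n.
Qed.

Definition tree_graph K (t : ptree K) := tree_ball (offspring t) K.

(* The neighbours of [v] outside [ex] (its parent) are in bijection with the
   children of the tree, recursively; [A] lists the vertices met. It is the
   uniqueness of the list [A] at the root that makes the subtrees disjoint. *)
Fixpoint embeds (V : eqType) (G : graph V) K :
    ptree K -> pred V -> V -> seq V -> Prop :=
  match K return ptree K -> pred V -> V -> seq V -> Prop with
  | 0 => fun _ _ v A => A = [:: v]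
  | K'.+1 => fun ts ex v A => exists cs : seq (V * seq V),
      [/\ A = v :: flatten (unzip2 cs),
          uniq (unzip1 cs),
          forall y, y \in unzip1 cs <-> adj G v y /\ ~~ ex y
        & List.Forall2 (fun t c => embeds G t (pred1 v) c.1 c.2)
            (ts : seq (ptree K')) cs]
  end.

(** * Exploration of a ball that is a tree *)

Section Explore.
Variables (V : eqType) (G : graph V) (o : V) (K : nat) (x : seq nat -> nat).
Hypothesis iso : rooted_iso (nbhd G o K) (tree_ball x K).

Let valid := valid x K.

Lemma ball_labelling : exists g : seq nat -> V,
  [/\ g [::] = o,
      forall u u', valid u -> valid u' -> g u = g u' -> u = u'
    & forall u, valid u -> (size u < K)%N -> forall y,
        adj G (g u) y <-> exists u', [/\ valid u', word_adj u u' & y = g u']].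
Proof.
have [f [[h hK Kh] fadj froot]] := iso.
(* Words outside the ball get the junk label [o], which makes [g] a total function. *)
have mkP u : exists v : V, valid u -> exists w : pvertex (tree_ball x K),
    sval (sval w) = u /\ v = sval (h w).
  have [hu|nu] := pselect (valid u); last by exists o => /nu.
  by have [w hw] := validP hu; exists (sval (h w)) => _; exists w.
have [g gP] := choice mkP.
have gE w : g (sval (sval w)) = sval (h w).
  have [w' [e ->]] := gP _ (vertex_valid w); congr (sval (h _)).
  by do 2 apply: sig_inj.
have vnil : valid [::] by split.
have g0 : g [::] = o.
  have -> : [::] = sval (sval (proot (tree_ball x K))) by [].
  by rewrite gE -froot hK.
have ginj u u' : valid u -> valid u' -> g u = g u' -> u = u'.
  move=> /gP[w [<- ->]] /gP[w' [<- ->]] e.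
  have /(congr1 f) : h w = h w' by exact: sig_inj.
  by rewrite !Kh => ->.
have gadj u u' : valid u -> valid u' -> adj G (g u) (g u') <-> word_adj u u'.
  move=> /gP[w [<- ->]] /gP[w' [<- ->]].
  have := fadj (h w) (h w'); rewrite !Kh.
  by [].
have gdist u : valid u -> dist_le G (size u) o (g u).
  elim/last_ind: u => [|u i IH] hu; first by rewrite g0.
  have vu : valid u.
    have [a b] := hu; split; first by case: ((in_tree_rcons x u i).1 a).
    by move: b; rewrite size_rcons => /ltnW.
  rewrite size_rcons; right; exists (g u); first exact: IH.
  by apply/gadj => //; left; exists i.
exists g; split => // u vu su y; split=> [a|[u' [vu' w ->]]]; last exact/gadj.
have dy : dist_le G K o y.
  apply: (@dist_le_mono _ _ (size u).+1) => //; right; exists (g u) => //; exact: gdist.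
pose yb : pvertex (nbhd G o K) := exist _ y dy.
have e : y = g (sval (sval (f yb))) by rewrite gE hK.
exists (sval (sval (f yb))); split => //; first exact: vertex_valid.
by apply/gadj => //; [exact: vertex_valid | rewrite -e].
Qed.

Fixpoint descendants k u : seq (seq nat) :=
  match k with
  | 0 => [:: u]
  | k'.+1 => u :: flatten [seq descendants k' (rcons u i) | i <- iota 0 (x u)]
  end.

Lemma descendants_prefix k u v : v \in descendants k u -> prefix u v.
Proof.
elim: k u => [|k IH] u /=; first by rewrite mem_seq1 => /eqP->; exact: prefix_refl.
rewrite inE => /predU1P[->|]; first exact: prefix_refl.
move=> /flatten_mapP[i _ /IH]; apply: prefix_trans.
by rewrite -cats1 prefix_prefix.
Qed.

Lemma descendants_valid k u v : valid u -> (size u + k <= K)%N ->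
  v \in descendants k u -> valid v.
Proof.
elim: k u => [|k IH] u vu su /=; first by rewrite mem_seq1 => /eqP->.
rewrite inE => /predU1P[->//|].
move=> /flatten_mapP[i]; rewrite mem_iota add0n => /= iu.
apply: IH; rewrite ?size_rcons ?addSnnS //.
split; first by apply/in_tree_rcons; case: vu.
by rewrite size_rcons; apply: leq_trans su; rewrite addnS ltnS leq_addr.
Qed.

Lemma descendants_uniq k u : uniq (descendants k u).
Proof.
elim: k u => [//|k IH] u /=; apply/andP; split.
  apply/negP => /flatten_mapP[i _ /descendants_prefix].
  move=> /prefixP[s /(congr1 size)]; rewrite size_cat size_rcons => e.
  by have := leq_addr (size s) (size u).+1; rewrite -e ltnn.
elim: (x u) 0 => [//|n IHn] m /=; rewrite cat_uniq IH IHn andbT /=.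
apply/hasPn => v /flatten_mapP[j]; rewrite mem_iota => /andP[mj _].
move=> /descendants_prefix/prefixP[s ->]; apply/negP => /descendants_prefix/prefixP[s'].
rewrite !cat_rcons => /eqP; rewrite eqseq_cat // eqxx /= eqseq_cons => /andP[/eqP e _].
by move: mj; rewrite e ltnn.
Qed.

Lemma ball_embeds : exists2 A, uniq A & embeds G (tree_of K x) pred0 o A.
Proof.
have [g [g0 ginj gadj]] := ball_labelling.
exists (map g (descendants K [::])).
  rewrite map_inj_in_uniq ?descendants_uniq // => u v uK vK.
  have vnil : valid [::] by split.
  by apply: ginj; [exact: descendants_valid uK | exact: descendants_valid vK].
(* The parent is the only neighbour of [u] that is not a child; the root has none. *)
pose ex u : pred V := if u is _ :: _ then pred1 (g (take (size u).-1 u)) else pred0.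
have exr u i : ex (rcons u i) = pred1 (g u).
  rewrite /ex; case E: (rcons u i) => [|a s']; first by case: (u) E.
  by rewrite -E size_rcons /= -cats1 take_size_cat.
(* The remaining depth is tied to the length of the word, so whenever children are listed the word
   is shorter than [K] and its neighbourhood is known. *)
suff H : forall k u, valid u -> (size u + k = K)%N ->
    embeds G (tree_of k (fun s => x (u ++ s))) (ex u) (g u) (map g (descendants k u)).
  by rewrite -{1}g0; exact: (H K [::]).
elim=> [//|k IH] u vu su.
have sK : (size u < K)%N by rewrite -su addnS ltnS leq_addr.
have vr i : (i < x u)%N -> valid (rcons u i).
  by move=> iu; split; [apply/in_tree_rcons; case: vu | rewrite size_rcons].
exists [seq (g (rcons u i), map g (descendants k (rcons u i))) | i <- iota 0 (x u)].
have e1 : unzip1 [seq (g (rcons u i), map g (descendants k (rcons u i))) | i <- iota 0 (x u)]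
    = [seq g (rcons u i) | i <- iota 0 (x u)].
  by rewrite /unzip1 -map_comp.
split.
- by rewrite /= map_flatten /unzip2 -!map_comp.
- rewrite e1 map_inj_in_uniq ?iota_uniq // => i j.
  rewrite !mem_iota !add0n /= => iu ju /ginj.
  by move=> /(_ (vr _ iu) (vr _ ju)) /rcons_inj[].
- move=> y; rewrite e1; split.
    move=> /mapP[i]; rewrite mem_iota add0n /= => iu ->; split.
      by apply/gadj => //; exists (rcons u i); split; [exact: vr | left; exists i |].
    case/lastP E : u => [//|p j]; rewrite exr /=.
    have vp : valid p.
      move: vu; rewrite E => -[/in_tree_rcons[a1 _]]; rewrite size_rcons => a2.
      by split=> //; exact: ltnW.
    have := vr _ iu; rewrite E => vr'; apply/eqP => e.
    have /(congr1 size)/eqP := ginj _ _ vr' vp e.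
    by rewrite !size_rcons gtn_eqF // ltnS leqnSn.
  move=> [/gadj] /(_ vu sK)[u' [vu' w ->]] nex.
  case: w => -[i e].
    apply/mapP; exists i; last by rewrite e.
    by rewrite mem_iota add0n /=; case: vu'; rewrite e => /in_tree_rcons[].
  by move: nex; rewrite e exr /= eqxx.
- rewrite /= cats0.
  have : all (fun i => i < x u)%N (iota 0 (x u)).
    by apply/allP => i; rewrite mem_iota.
  elim: (iota 0 (x u)) => [|i s IHs] /=; first by constructor.
  move=> /andP[iu hs]; constructor; last exact: IHs.
  have -> : (fun s0 => x (u ++ i :: s0)) = (fun s0 => x (rcons u i ++ s0)).
    by apply/funext => s0; rewrite cat_rcons.
  rewrite -(exr _ i).
  by apply: IH; [exact: vr | rewrite size_rcons addSnnS].
Qed.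

End Explore.

Lemma tree_graph_embeds (V : eqType) (G : graph V) o K (t : ptree K) :
  rooted_iso (nbhd G o K) (tree_graph t) ->
  exists2 A, uniq A & embeds G t pred0 o A.
Proof. by move=> /ball_embeds; rewrite tree_of_offspring. Qed.

Local Open Scope ring_scope.

(** * Weighted finite sums over lists of lists *)

Section WeightedSums.
Variables (R : realFieldType) (T : Type) (L : seq T).
Implicit Type w : T -> R.

(** The weight is not normalised: total mass 1 is assumed only where needed, since the untruncated
    Galton-Watson weight of the bounded trees may have smaller mass. *)
Definition expect w (F : T -> R) : R := \sum_(t <- L) w t * F t.

Fixpoint lists n : seq (seq T) :=
  if n is n'.+1 then [seq t :: ts | t <- L, ts <- lists n'] else [:: [::]].

Definition wprod w (ts : seq T) : R := \prod_(t <- ts) w t.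

Definition expectn w n (F : seq T -> R) : R :=
  \sum_(ts <- lists n) wprod w ts * F ts.

Lemma expectn0 w F : expectn w 0 F = F [::].
Proof. by rewrite /expectn big_seq1 /wprod big_nil mul1r. Qed.

Lemma expectnS w n F :
  expectn w n.+1 F = expect w (fun t => expectn w n (fun ts => F (t :: ts))).
Proof.
rewrite /expectn /expect big_allpairs_dep; apply: eq_bigr => t _.
rewrite mulr_sumr; apply: eq_bigr => ts _.
by rewrite /wprod big_cons mulrA.
Qed.

Lemma eq_expect w F G : F =1 G -> expect w F = expect w G.
Proof. by move=> FG; apply: eq_bigr => t _; rewrite FG. Qed.

Lemma eq_expectn w n F G : F =1 G -> expectn w n F = expectn w n G.
Proof. by move=> FG; apply: eq_bigr => t _; rewrite FG. Qed.

Lemma expectD w F G :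
  expect w (fun t => F t + G t) = expect w F + expect w G.
Proof. by rewrite -big_split; apply: eq_bigr => t _; rewrite mulrDr. Qed.

Lemma expectZ w (c : R) F : expect w (fun t => c * F t) = c * expect w F.
Proof. by rewrite mulr_sumr; apply: eq_bigr => t _; rewrite mulrCA. Qed.

Lemma expectB w F G :
  expect w (fun t => F t - G t) = expect w F - expect w G.
Proof. by rewrite -sumrB; apply: eq_bigr => t _; rewrite mulrBr. Qed.

Lemma expectnD w n F G :
  expectn w n (fun t => F t + G t) = expectn w n F + expectn w n G.
Proof. by rewrite -big_split; apply: eq_bigr => t _; rewrite mulrDr. Qed.

Lemma expectnZ w n (c : R) F :
  expectn w n (fun t => c * F t) = c * expectn w n F.
Proof. by rewrite mulr_sumr; apply: eq_bigr => t _; rewrite mulrCA. Qed.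

Lemma expectnB w n F G :
  expectn w n (fun t => F t - G t) = expectn w n F - expectn w n G.
Proof. by rewrite -sumrB; apply: eq_bigr => t _; rewrite mulrBr. Qed.

Lemma expectn_cst w n c : expectn w n (fun=> c) = expect w (fun=> 1) ^+ n * c.
Proof.
elim: n => [|n IH]; first by rewrite expectn0 expr0 mul1r.
rewrite expectnS (eq_expect _ (G := fun=> (expect w (fun=> 1) ^+ n * c) * 1)).
  by rewrite expectZ exprS; ring.
by move=> t; rewrite IH mulr1.
Qed.

Lemma expectn_all w n (a : pred T) :
  expectn w n (fun ts => (all a ts)%:R) = expect w (fun t => (a t)%:R) ^+ n.
Proof.
elim: n => [|n IH]; first by rewrite expectn0 expr0.
rewrite expectnS exprS -IH mulrC -expectZ; apply: eq_expect => t /=.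
by rewrite mulrC -expectnZ; apply: eq_expectn => ts; rewrite -mulnb natrM.
Qed.

Section Nonneg.
Variable w : T -> R.
Hypothesis w0 : forall t, 0 <= w t.

Lemma ler_expect F G : (forall t, F t <= G t) -> expect w F <= expect w G.
Proof. by move=> FG; apply: ler_sum => t _; rewrite ler_wpM2l. Qed.

Lemma wprod_ge0 ts : 0 <= wprod w ts.
Proof. by apply: prodr_ge0 => t _. Qed.

Lemma ler_expectn n F G :
  (forall ts, F ts <= G ts) -> expectn w n F <= expectn w n G.
Proof. by move=> FG; apply: ler_sum => t _; rewrite ler_wpM2l ?wprod_ge0. Qed.

Lemma expect_ge0 F : (forall t, 0 <= F t) -> 0 <= expect w F.
Proof. by move=> F0; apply: sumr_ge0 => t _; rewrite mulr_ge0. Qed.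

Lemma expectn_ge0 n F : (forall t, 0 <= F t) -> 0 <= expectn w n F.
Proof. by move=> F0; apply: sumr_ge0 => t _; rewrite mulr_ge0 ?wprod_ge0. Qed.

End Nonneg.

Fixpoint picks (ts : seq T) : seq (T * seq T) :=
  if ts is t :: ts' then (t, ts') :: [seq (p.1, t :: p.2) | p <- picks ts']
  else [::].

Lemma sum_picks (F : T -> R) ts :
  \sum_(p <- picks ts) F p.1 = \sum_(t <- ts) F t.
Proof.
by elim: ts => [|t ts IH]; rewrite ?big_nil //= !big_cons big_map IH.
Qed.

(* Choosing a uniformly marked item of an i.i.d. list is the same as drawing it
   apart from the others. *)
Lemma expectn_picks w n (F : T -> seq T -> R) :
  expectn w n (fun ts => \sum_(p <- picks ts) F p.1 p.2) =
  n%:R * expect w (fun t => expectn w n.-1 (F t)).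
Proof.
elim: n F => [|n IH] F; first by rewrite expectn0 big_nil mul0r.
rewrite expectnS /=.
rewrite (eq_expect _ (G := fun t => expectn w n (F t) +
    n%:R * expect w (fun s => expectn w n.-1 (fun ts => F s (t :: ts))))); last first.
  move=> t; rewrite -IH -expectnD; apply: eq_expectn => ts.
  by rewrite big_cons big_map.
rewrite expectD expectZ -natr1 mulrDl mul1r addrC; congr (_ + _).
case: n {IH} => [|n]; first by rewrite !mul0r.
congr (_ * _); rewrite /expect /=.
under eq_bigr do rewrite mulr_sumr.
rewrite exchange_big; apply: eq_bigr => s _ /=.
rewrite expectnS /expect mulr_sumr.
by apply: eq_bigr => t _; rewrite !mulrA [w t * _]mulrC.
Qed.

Lemma expectn_sum w n (F : T -> R) : expect w (fun=> 1) = 1 ->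
  expectn w n (fun ts => \sum_(t <- ts) F t) = n%:R * expect w F.
Proof.
move=> w1; transitivity (expectn w n (fun ts => \sum_(p <- picks ts) F p.1)).
  by apply: eq_expectn => ts; rewrite sum_picks.
rewrite (expectn_picks w n (fun t _ => F t)); congr (_ * _).
by apply: eq_expect => t; rewrite expectn_cst w1 expr1n mul1r.
Qed.

End WeightedSums.

Section Levels.
Variables (R : realFieldType) (T : Type) (D : nat).
Implicit Types (m : nat -> R) (w : T -> R) (L : seq T) (a : pred T).

Definition level (L : seq T) : seq (seq T) :=
  flatten [seq lists L n | n <- iota 0 D.+1].

(** The Galton-Watson weight of a family: its size has law [m], and its members are independent with
    weight [w]. *)
Definition levelw (m : nat -> R) (w : T -> R) (ts : seq T) : R :=
  m (size ts) * wprod w ts.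

Lemma size_lists (L : seq T) n : all (fun ts => size ts == n) (lists L n).
Proof.
elim: n => [//|n IH] /=; move: (lists L n) IH => l IH.
elim: (L) => [//|t s IH2] /=; rewrite all_cat IH2 andbT all_map.
by apply: sub_all IH => ts /= /eqP ->.
Qed.

Lemma expect_level L m w F :
  expect (level L) (levelw m w) F =
  \sum_(n < D.+1) m n * expectn L w n F.
Proof.
rewrite /expect /level big_flatten big_map -[iota 0 _]/(index_iota 0 D.+1).
rewrite big_mkord; apply: eq_bigr => n _.
rewrite /expectn mulr_sumr.
elim: (lists L n) (size_lists L n) => [|ts s IH] /=; first by rewrite !big_nil.
by move=> /andP[/eqP sz /IH IHs]; rewrite !big_cons IHs /levelw sz !mulrA.
Qed.

Lemma levelw_ge0 m w : (forall n, 0 <= m n) -> (forall t, 0 <= w t) ->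
  forall ts, 0 <= levelw m w ts.
Proof. by move=> m0 w0 ts; rewrite mulr_ge0 ?wprod_ge0. Qed.

Lemma expect_level1 L m w : \sum_(n < D.+1) m n = 1 ->
  expect L w (fun=> 1) = 1 -> expect (level L) (levelw m w) (fun=> 1) = 1.
Proof.
move=> m1 w1; rewrite expect_level -[RHS]m1; apply: eq_bigr => n _.
by rewrite expectn_cst w1 expr1n !mulr1.
Qed.

Lemma expect_level_sum L m w F : expect L w (fun=> 1) = 1 ->
  expect (level L) (levelw m w) (fun ts => \sum_(t <- ts) F t) =
  (\sum_(n < D.+1) m n * n%:R) * expect L w F.
Proof.
move=> w1; rewrite expect_level mulr_suml; apply: eq_bigr => n _.
by rewrite expectn_sum // mulrA.
Qed.

Lemma expect_level_all L m w a :
  expect (level L) (levelw m w) (fun ts => (all a ts)%:R) =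
  \sum_(n < D.+1) m n * expect L w (fun t => (a t)%:R) ^+ n.
Proof. by rewrite expect_level; apply: eq_bigr => n _; rewrite expectn_all. Qed.

Lemma expect_level_has L m w a : \sum_(n < D.+1) m n = 1 ->
  expect L w (fun=> 1) = 1 ->
  expect (level L) (levelw m w) (fun ts => (has a ts)%:R) =
  1 - \sum_(n < D.+1) m n * (1 - expect L w (fun t => (a t)%:R)) ^+ n.
Proof.
move=> m1 w1; have Ec : expect L w (fun t => (predC a t)%:R) =
    1 - expect L w (fun t => (a t)%:R).
  rewrite -[X in _ = X - _]w1 -expectB; apply: eq_expect => t /=.
  by case: (a t); rewrite ?subrr ?subr0.
rewrite -Ec -expect_level_all -[X in _ = X - _](expect_level1 m1 w1) -expectB.
apply: eq_expect => ts; rewrite all_predC.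
by case: (has a ts); rewrite ?subrr ?subr0.
Qed.

End Levels.

Lemma expectn_map (R : realFieldType) (T T' : Type) (L' : seq T') (L : seq T)
    (w' : T' -> R) (w : T -> R) (f : T' -> T) n (F : seq T -> R) :
  (forall G, expect L' w' (G \o f) = expect L w G) ->
  expectn L' w' n (F \o map f) = expectn L w n F.
Proof.
move=> H; elim: n F => [|n IH] F; first by rewrite !expectn0.
rewrite !expectnS -H; apply: eq_expect => t /=.
by rewrite -IH.
Qed.

Lemma expect_level_map (R : realFieldType) (T T' : Type) (L' : seq T')
    (L : seq T) (w' : T' -> R) (w : T -> R) (f : T' -> T) D (m : nat -> R) (F : seq T -> R) :
  (forall G, expect L' w' (G \o f) = expect L w G) ->
  expect (level D L') (levelw m w') (F \o map f)
  = expect (level D L) (levelw m w) F.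
Proof.
move=> H; rewrite !expect_level; apply: eq_bigr => n _.
by rewrite (expectn_map _ _ H).
Qed.

(** * Combination of the values of subtrees *)

Section Combination.
Variable R : realFieldType.
Implicit Types (r s x z : R) (ss zs : seq R).

(* The limit of 1 / (1 + sum_i 1 / s_i) as some s_i tend to 0; the boolean factor
   is needed since [0^-1 = 0]. *)
Definition comb ss : R :=
  (all (fun s => (0 < s)%R) ss)%:R / (1 + \sum_(s <- ss) s^-1).

(* The term of the child [s] in [comb_picks], where [x] combines the other
   children; it is [0], not x / (x + 0) = 1, at [s = 0]. *)
Definition share x s : R := (0 < s)%R%:R * (x / (x + s)).

Lemma sumV_ge0 ss : all (fun s => 0 <= s) ss -> 0 <= \sum_(s <- ss) s^-1.
Proof.
by move=> /allP h; rewrite big_seq sumr_ge0 // => s /h; rewrite invr_ge0.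
Qed.

Lemma all_gt0_ge0 ss : all (fun s => 0 < s) ss -> all (fun s => 0 <= s) ss.
Proof. by apply: sub_all => s /ltW. Qed.

Lemma comb_ge0 ss : all (fun s => 0 <= s) ss -> 0 <= comb ss.
Proof.
by move=> /sumV_ge0 h; rewrite divr_ge0 // addr_ge0.
Qed.

Lemma comb_le1 ss : all (fun s => 0 <= s) ss -> comb ss <= 1.
Proof.
move=> /sumV_ge0 h; rewrite ler_pdivrMr ?mul1r; last lra.
by case: all => /=; lra.
Qed.

(** Reciprocals add: 1/[comb] gains the term 1/s. When [s] or [comb ss] vanishes, both sides are 0
    whatever the denominator. *)
Lemma comb_cons s ss : 0 <= s -> all (fun s => 0 <= s) ss ->
  comb (s :: ss) = s * comb ss / (s + comb ss).
Proof.
move=> s0 ss0; rewrite /comb /= big_cons; have S0 := sumV_ge0 ss0.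
case: (boolP (all _ ss)) => /=; last by rewrite andbF !mul0r !(mulr0, mul0r).
move=> _; rewrite andbT; move: s0; rewrite le_eqVlt => /predU1P[<-|s0].
  by rewrite ltxx !mul0r.
rewrite s0 /=; set S := \sum_(_ <- _) _ in S0 *.
have h1 : 1 + S != 0 by lra.
have h2 : s != 0 by lra.
field; rewrite h1 h2 /=.
have h3 : 0 < s * S + s + 1 by have := mulr_ge0 (ltW s0) S0; lra.
by rewrite andbT; apply/eqP => e; lra.
Qed.

(** The partial derivatives of rs/(r+s) are (s/(r+s))^2 and (r/(r+s))^2, which lie in [0,1]: the map
    is monotone and 1-Lipschitz for the l1 distance. *)
Lemma par_lip r s r' s' : 0 <= r' <= r -> 0 <= s' <= s ->
  0 <= r * s / (r + s) - r' * s' / (r' + s') <= (r - r') + (s - s').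
Proof.
move=> /andP[r0 rr] /andP[s0 ss].
have [e|ne] := eqVneq (r + s) 0.
  have -> : r = 0 by lra.
  have -> : s = 0 by lra.
  have -> : r' = 0 by lra.
  have -> : s' = 0 by lra.
  by rewrite !mul0r; lra.
have p : 0 < r + s by rewrite lt0r ne addr_ge0 //; lra.
have [e'|ne'] := eqVneq (r' + s') 0.
  have -> : r' = 0 by lra.
  have -> : s' = 0 by lra.
  rewrite !mul0r !subr0 divr_ge0 ?mulr_ge0 //=; try lra.
  by rewrite ler_pdivrMr //; nra.
have p' : 0 < r' + s' by rewrite lt0r ne' addr_ge0 //; lra.
have -> : r * s / (r + s) - r' * s' / (r' + s') =
  ((r - r') * (s * s') + (s - s') * (r * r')) / ((r + s) * (r' + s')).
  by field; rewrite ne ne'.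
have pp := mulr_gt0 p p'.
have a0 : 0 <= r - r' by lra.
have b0 : 0 <= s - s' by lra.
apply/andP; split.
  by rewrite divr_ge0 ?(ltW pp) // addr_ge0 // !mulr_ge0 //; lra.
rewrite ler_pdivrMr // [leRHS]mulrDl lerD // ler_wpM2l //; nra.
Qed.

Lemma comb_lip T (F G : T -> R) ts : (forall t, 0 <= G t <= F t) ->
  0 <= comb (map F ts) - comb (map G ts) <= \sum_(t <- ts) (F t - G t).
Proof.
move=> FG; elim: ts => [|t ts IH]; first by rewrite /= big_nil subrr lexx.
have F0 u : 0 <= F u by have /andP[] := FG u; apply: le_trans.
have G0 u : 0 <= G u by have /andP[] := FG u.
have aF : all (fun s => 0 <= s) (map F ts) by elim: (ts) => //= u us ->; rewrite F0.
have aG : all (fun s => 0 <= s) (map G ts) by elim: (ts) => //= u us ->; rewrite G0.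
rewrite /= !comb_cons // big_cons.
have /par_lip/(_ (FG t)) := FG t.
have h : 0 <= comb (map G ts) <= comb (map F ts).
  by rewrite comb_ge0 //=; case/andP: IH; lra.
move=> _; have /andP[-> h2] := par_lip (FG t) h; rewrite /=.
by case/andP: IH; lra.
Qed.

Lemma picks_map T U (f : T -> U) ts :
  picks (map f ts) = [seq (f p.1, map f p.2) | p <- picks ts].
Proof.
elim: ts => //= t ts ->; congr (_ :: _).
by rewrite -!map_comp; apply: eq_map.
Qed.

Lemma all_picks (T : Type) (a : pred T) ts :
  all (fun p => all a ts == (a p.1 && all a p.2)) (picks ts).
Proof.
elim: ts => //= t ts IH; rewrite eqxx /= all_map.
by apply: sub_all IH => p /= /eqP->; rewrite andbCA.
Qed.

Lemma sum_picks_rest T (F : T -> R) ts :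
  all (fun p => \sum_(t <- ts) F t == F p.1 + \sum_(t <- p.2) F t) (picks ts).
Proof.
elim: ts => //= t ts IH; rewrite big_cons eqxx /= all_map.
by apply: sub_all IH => p /= /eqP->; rewrite big_cons addrCA.
Qed.

Lemma eq_big_all (T : Type) (a : pred T) (F G : T -> R) ts : all a ts ->
  (forall t, a t -> F t = G t) -> \sum_(t <- ts) F t = \sum_(t <- ts) G t.
Proof.
move=> + H; elim: ts => [|t ts IH]; first by rewrite !big_nil.
by move=> /= /andP[/H e /IH e2]; rewrite !big_cons e e2.
Qed.

(** Let S be the sum of the 1/s. If all children are positive, the child s has share s^-1/(1 + S),
    and 1 - S/(1 + S) = 1/(1 + S). If some child is 0, all shares vanish. A sum over marked children
    is what size-biasing can be applied to. *)
Lemma comb_picks ss : all (fun s => 0 <= s) ss ->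
  comb ss = (all (fun s => (0 < s)%R) ss)%:R
            - \sum_(p <- picks ss) share (comb p.2) p.1.
Proof.
move=> ss0.
set A := all (fun s => 0 < s) ss; set S := \sum_(s <- ss) s^-1.
have S0 : 0 <= S := sumV_ge0 ss0.
have -> : \sum_(p <- picks ss) share (comb p.2) p.1 =
          \sum_(p <- picks ss) A%:R / (1 + S) * p.1^-1.
  have H : all (fun p => [&& A == ((0 < p.1) && all (fun s => 0 < s) p.2) &
     S == p.1^-1 + \sum_(s <- p.2) s^-1]) (picks ss).
    have := all_picks (fun s => 0 < s) ss.
    have := sum_picks_rest (fun s => s^-1) ss.
    rewrite /A /S; elim: (picks ss) => //= p ps IH.
    by move=> /andP[-> h1] /andP[-> h2] /=; apply: IH.
  apply: (eq_big_all H) => p /andP[/eqP-> /eqP eS].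
  rewrite /share /comb; case: (ltP 0 p.1) => /= [p0|_]; last by rewrite !mul0r.
  case: (boolP (all _ p.2)) => h /=; last by rewrite !(mul0r, mulr0).
  have := sumV_ge0 (all_gt0_ge0 h).
  rewrite eS; set s := \sum_(_ <- _) _ => s0.
  have h1 : 1 + s != 0 by lra.
  have h2 : p.1 != 0 by lra.
  have h4 : p.1 * s + p.1 + 1 != 0 by have := mulr_ge0 (ltW p0) s0; lra.
  by field; rewrite h1 h2 /= andbT; apply/eqP => e; lra.
rewrite -mulr_sumr (sum_picks (fun s => s^-1)) -/S /comb -/A -/S.
by have h1 : 1 + S != 0; [lra | field].
Qed.

(** For i.i.d. values, exchangeability turns this into the expected fraction of the total held by a
    single one. *)
Lemma row_picks zs : all (fun z => 0 <= z) zs ->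
  \sum_(p <- picks zs) p.1 / (p.1 + \sum_(z <- p.2) z) =
  (has (fun z => (0 < z)%R) zs)%:R.
Proof.
move=> z0; set S := \sum_(z <- zs) z.
have -> : \sum_(p <- picks zs) p.1 / (p.1 + \sum_(z <- p.2) z) =
          \sum_(p <- picks zs) S^-1 * p.1.
  apply: (eq_big_all (sum_picks_rest id zs)) => p /eqP <-.
  by rewrite mulrC.
rewrite -mulr_sumr (sum_picks id) -/S.
have S0 : 0 <= S by rewrite /S big_seq sumr_ge0 // => z zi; exact: (allP z0).
suff -> : has (fun z => 0 < z) zs = (S != 0).
  by case: eqP => [->|/eqP h] /=; rewrite ?mulr0 // mulVf.
apply/hasP/idP => [[z zi zp]|].
  rewrite lt0r_neq0 // /S (big_rem z) //= ltr_pwDl // big_seq sumr_ge0 // => y.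
  by move=> /mem_rem yi; exact: (allP z0).
move=> S1; apply/hasP; apply: contraNT S1 => /hasPn h.
rewrite /S big_seq big1 // => z zi.
by have := h _ zi; have := allP z0 _ zi; rewrite -leNgt /=; lra.
Qed.

Lemma share_ge0 x s : 0 <= x -> 0 <= share x s.
Proof.
move=> x0; rewrite /share; case: ltP => s0 /=; last by rewrite mul0r.
by rewrite mul1r divr_ge0 // addr_ge0 // ltW.
Qed.

Lemma share_le1 x s : 0 <= x -> share x s <= 1.
Proof.
move=> x0; rewrite /share; case: ltP => s0 /=; last by rewrite mul0r.
by rewrite mul1r ler_pdivrMr; lra.
Qed.

(** Only this direction holds: for z = 0 a tiny x may have a share close to 1. For z >= e the
    difference is s/(x+s), at most 1, times (z-x)/(z+s), whose denominator is at least [e]. *)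
Lemma share_lip (e z x s : R) : 0 < e -> 0 <= x -> 0 <= s -> z = 0 \/ e <= z ->
  share z s - share x s <= `|x - z| / e.
Proof.
move=> e0 x0 s0 [->|ez].
  rewrite {1}/share mul0r mulr0.
  by have := share_ge0 s x0; have := divr_ge0 (normr_ge0 (x - 0)) (ltW e0); lra.
rewrite /share; case: ltP => sp /=; last first.
  by rewrite !mul0r subrr divr_ge0 // ltW.
rewrite !mul1r; have z0 : 0 < z by lra.
have h1 : z + s != 0 by lra.
have h2 : x + s != 0 by lra.
have -> : z / (z + s) - x / (x + s) = (s / (x + s)) * ((z - x) / (z + s)).
  by field; rewrite h1 h2.
have a1 : 0 <= s / (x + s) <= 1.
  by rewrite divr_ge0 ?ler_pdivrMr //=; lra.
have a2 : (z - x) / (z + s) <= `|x - z| / e.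
  apply: (@le_trans _ _ (`|x - z| / (z + s))).
    rewrite ler_pM2r ?invr_gt0; last lra.
    by rewrite distrC ler_norm.
  by rewrite ler_wpM2l // lef_pV2 ?posrE; lra.
have a3 : 0 <= `|x - z| / e by rewrite divr_ge0 // ltW.
case: (lerP 0 ((z - x) / (z + s))) => h; nra.
Qed.

End Combination.

(** * Truncated laws and size-biasing *)

Section Laws.
Variable R : realFieldType.
Implicit Types (l : nat -> R) (D : nat).

Definition tail l N : R := 1 - \sum_(n < N) l n.

(* The mass beyond [D] is moved to [0], so that the truncation of a probability
   distribution is again one. *)
Definition trunc_law D l n : R := if n is 0 then l 0%N + tail l D.+1 else l n.

Definition sublaw l := (forall n, 0 <= l n) /\ (forall N, 0 <= tail l N).

Lemma tailS l N : tail l N = tail l N.+1 + l N.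
Proof. by rewrite /tail big_ord_recr /=; ring. Qed.

Lemma trunc_law_ge0 l D n : sublaw l -> 0 <= trunc_law D l n.
Proof. by case=> l0 t0; case: n => //=; rewrite addr_ge0. Qed.

Lemma le_trunc_law l D n : sublaw l -> l n <= trunc_law D l n.
Proof. by case=> l0 t0; case: n => //=; rewrite lerDl. Qed.

Lemma sum_trunc_law l D : \sum_(n < D.+1) trunc_law D l n = 1.
Proof. by rewrite big_ord_recl /= /tail big_ord_recl /=; ring. Qed.

Lemma mean_trunc_law l D :
  \sum_(n < D.+1) trunc_law D l n * n%:R = \sum_(n < D.+1) l n * n%:R.
Proof. by rewrite !big_ord_recl /= !mulr0. Qed.

Lemma sum_trunc_lawE l D (B : nat -> R) :
  \sum_(n < D.+1) trunc_law D l n * B n =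
  \sum_(n < D.+1) l n * B n + tail l D.+1 * B 0%N.
Proof. by rewrite !big_ord_recl /=; ring. Qed.

(** The second sum has one term less because size-biasing turns a sum over n <= D into one over n <
    D. The difference consists of the mass at [D] and of the mass moved to 0. *)
Lemma sum_trunc_law_cmp l D (B : nat -> R) : sublaw l ->
  (forall n, 0 <= B n <= 1) ->
  0 <= \sum_(n < D.+1) trunc_law D l n * B n - \sum_(n < D) l n * B n
    <= tail l D.
Proof.
move=> [l0 t0] B01; rewrite sum_trunc_lawE big_ord_recr /= (tailS l D).
have /andP[b0 b1] := B01 0%N; have /andP[c0 c1] := B01 D.
by have := l0 D; have := t0 D.+1; set s := \sum_(_ < _) _; nra.
Qed.

Lemma size_biased_sum (l l' : nat -> R) lbar D (B : nat -> R) :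
  (forall n, n.+1%:R * l n.+1 = lbar * l' n) ->
  \sum_(n < D.+1) l n * (n%:R * B n.-1) = lbar * \sum_(n < D) l' n * B n.
Proof.
move=> H; rewrite big_ord_recl /= mul0r mulr0 add0r mulr_sumr.
by apply: eq_bigr => n _; rewrite /bump add1n /= mulrA [l _ * _]mulrC H mulrA.
Qed.

Section Space.
Variables (T : Type) (L : seq T) (w : T -> R) (D : nat).
Hypothesis w0 : forall t, 0 <= w t.
Hypothesis w1 : expect L w (fun=> 1) = 1.

Let expectn1 n : expectn L w n (fun=> 1) = 1.
Proof. by rewrite expectn_cst w1 expr1n mul1r. Qed.

Lemma expectn_01 n F : (forall ts, 0 <= F ts <= 1) -> 0 <= expectn L w n F <= 1.
Proof.
move=> F01; rewrite expectn_ge0 //=; last by move=> ts; case/andP: (F01 ts).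
by rewrite -[leRHS](expectn1 n) ler_expectn // => ts; case/andP: (F01 ts).
Qed.

Lemma expect_01 F : (forall ts, 0 <= F ts <= 1) -> 0 <= expect L w F <= 1.
Proof.
move=> F01; rewrite expect_ge0 //=; last by move=> ts; case/andP: (F01 ts).
by rewrite -[leRHS]w1 ler_expect // => ts; case/andP: (F01 ts).
Qed.

Lemma exchange_expect_level (m : nat -> R) (F : T -> seq T -> R) :
  expect L w (fun t => expect (level D L) (levelw m w) (F t)) =
  expect (level D L) (levelw m w) (fun ts => expect L w (F^~ ts)).
Proof.
rewrite /expect; under eq_bigr do rewrite mulr_sumr.
rewrite exchange_big; apply: eq_bigr => ts _ /=; rewrite mulr_sumr.
by apply: eq_bigr => t _; rewrite mulrCA.
Qed.

Lemma expect_level_expect (m : nat -> R) (F : T -> seq T -> R) :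
  expect L w (fun t => expect (level D L) (levelw m w) (F t)) =
  \sum_(n < D.+1) m n * expect L w (fun t => expectn L w n (F t)).
Proof.
rewrite exchange_expect_level expect_level; apply: eq_bigr => n _; congr (_ * _).
rewrite /expectn /expect; under eq_bigr do rewrite mulr_sumr.
rewrite exchange_big; apply: eq_bigr => ts _ /=; rewrite mulr_sumr.
by apply: eq_bigr => t _; rewrite mulrCA.
Qed.

Section Row.
Variables (nu nu' : nat -> R) (nbar : R) (Z : T -> R).
Hypothesis nu'_law : sublaw nu'.
Hypothesis nbar0 : 0 < nbar.
Hypothesis nu_biased : forall n, n.+1%:R * nu n.+1 = nbar * nu' n.
Hypothesis Z0 : forall t, 0 <= Z t.

Let p := expect L w (fun t => (0 < Z t)%R%:R).

(** The contribution of a marked pair of a row and a column below it: the share of a column against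
    an independent size-biased family of siblings. *)
Definition row_share :=
  expect L w (fun t => expect (level D L) (levelw (trunc_law D nu') w)
    (fun ts => share (Z t) (\sum_(s <- ts) Z s))).

(** The two expressions differ only at s = 0 < z, where the fraction is 1 and the share 0. *)
Lemma shareE (z s : R) : 0 <= z -> 0 <= s ->
  share z s = z / (z + s) - (0 < z)%R%:R * (~~ (0 < s)%R)%:R.
Proof.
move=> z0; rewrite /share le_eqVlt => /predU1P[<-|s0]; last first.
  by rewrite s0 /= mulr0 mul1r subr0.
rewrite ltxx mul0r /= mulr1 addr0.
by move: z0; rewrite le_eqVlt => /predU1P[<-|z0]; rewrite ?ltxx ?mul0r ?subrr // z0 divff ?subrr // gt_eqF.
Qed.

Lemma sum_gt0 ts : (0 < \sum_(s <- ts) Z s) = has (fun s => 0 < Z s) ts.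
Proof.
elim: ts => [|t ts IH]; first by rewrite big_nil ltxx.
rewrite big_cons /= -IH; have : 0 <= \sum_(s <- ts) Z s by rewrite sumr_ge0.
have := Z0 t; set s := \sum_(_ <- _) _ => a b.
by apply/idP/orP => [h|[]]; [have [] := ltP 0 (Z t); [left|right]|..]; lra.
Qed.

(** Let B n be the expected fraction z/(z + sum) held by one of n + 1 independent columns. By
    exchangeability (n + 1) B n is the probability 1 - (1 - p)^(n+1) that some column is positive,
    and undoing the bias of [nu'] gives the [nu] term. The last term is the probability that a
    column is positive while all its siblings vanish, the case in which fraction and share
    differ. *)
Lemma row_share_bounds :
  0 <= row_share
       - ((\sum_(n < D.+1) nu n * (1 - (1 - p) ^+ n)) / nbar
          - p * \sum_(n < D.+1) trunc_law D nu' n * (1 - p) ^+ n)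
    <= tail nu' D.
Proof.
pose B n := expect L w (fun t => expectn L w n
   (fun ts => Z t / (Z t + \sum_(s <- ts) Z s))).
have Zs0 ts : 0 <= \sum_(s <- ts) Z s by rewrite sumr_ge0.
have B01 n : 0 <= B n <= 1.
  apply: expect_01 => t; apply: expectn_01 => ts.
  have a := Z0 t; have b := Zs0 ts.
  rewrite divr_ge0 ?addr_ge0 //=.
  have [e|ne] := eqVneq (Z t + \sum_(s <- ts) Z s) 0.
    by rewrite e invr0 mulr0.
  rewrite ler_pdivrMr ?mul1r ?lerDl //.
  by rewrite lt0r ne addr_ge0.
have pC : expect L w (fun t => (~~ (0 < Z t)%R)%:R) = 1 - p.
  rewrite -[X in _ = X - _]w1 -expectB; apply: eq_expect => t.
  by case: (0 < Z t); rewrite /= ?subrr ?subr0.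
have BE n : n.+1%:R * B n = 1 - (1 - p) ^+ n.+1.
  rewrite -(expectn_picks _ w n.+1 (fun t ts => Z t / (Z t + \sum_(s <- ts) Z s))).
  rewrite -pC -expectn_all -[X in _ = X - _](expectn1 n.+1) -expectnB.
  apply: eq_expectn => ts.
  have /row_picks : all (fun z => 0 <= z) (map Z ts) by elim: (ts) => //= ? ? ->; rewrite Z0.
  rewrite picks_map big_map; under eq_bigr do rewrite /= big_map.
  move=> ->; rewrite has_map.
  have -> : all (fun t => ~~ (0 < Z t)) ts = ~~ has (fun t => 0 < Z t) ts.
    by rewrite -all_predC.
  by rewrite /preim /=; case: has; rewrite /= ?subrr ?subr0.
have -> : row_share = \sum_(n < D.+1) trunc_law D nu' n * B n -
     p * \sum_(n < D.+1) trunc_law D nu' n * (1 - p) ^+ n.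
  rewrite /row_share.
  have E t : expect (level D L) (levelw (trunc_law D nu') w)
      (fun ts => share (Z t) (\sum_(s <- ts) Z s)) =
    expect (level D L) (levelw (trunc_law D nu') w)
      (fun ts => Z t / (Z t + \sum_(s <- ts) Z s)) -
    (0 < Z t)%R%:R * \sum_(n < D.+1) trunc_law D nu' n * (1 - p) ^+ n.
    rewrite -pC -expect_level_all -expectZ -expectB; apply: eq_expect => ts.
    by rewrite shareE // sum_gt0 -all_predC.
  rewrite (eq_expect _ _ E).
  rewrite expectB expect_level_expect; congr (_ - _).
  by rewrite mulrC -expectZ; apply: eq_expect => t; rewrite mulrC.
have -> : (\sum_(n < D.+1) nu n * (1 - (1 - p) ^+ n)) / nbar =
   \sum_(n < D) nu' n * B n.
  rewrite -[RHS](mulKf (lt0r_neq0 nbar0)) -(size_biased_sum _ _ nu_biased) mulrC.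
  congr (_ * _); apply: eq_bigr => -[[|n] ln] _ /=.
    by rewrite expr0 subrr mul0r.
  by rewrite BE.
have := sum_trunc_law_cmp D nu'_law B01.
set a := \sum_(_ < _) _; set b := \sum_(_ < _) _; set c := p * _; lra.
Qed.

End Row.

Section Column.
Variables (mu mu' : nat -> R) (mbar : R) (f : T -> R).
Hypothesis mu'_law : sublaw mu'.
Hypothesis mbar0 : 0 < mbar.
Hypothesis mu_biased : forall n, n.+1%:R * mu n.+1 = mbar * mu' n.
Hypothesis f0 : forall t, 0 <= f t.

Lemma all_map_ge0 ts : all (fun s => 0 <= s) (map f ts).
Proof. by elim: ts => //= t ts ->; rewrite f0. Qed.

(** This is [comb_picks] in expectation: marking one row makes it independent of the others, whose
    number becomes size-biased. The biased sum only runs over n < D, which costs the tail. *)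
Lemma column_bound :
  expect (level D L) (levelw (trunc_law D mu) w) (fun ts => comb (map f ts)) <=
  \sum_(n < D.+1) trunc_law D mu n * expect L w (fun t => (0 < f t)%R%:R) ^+ n
  - mbar * (expect (level D L) (levelw (trunc_law D mu') w) (fun ts =>
              expect L w (fun t => share (comb (map f ts)) (f t)))
            - tail mu' D).
Proof.
pose A n := expect L w (fun t => expectn L w n
   (fun ts => share (comb (map f ts)) (f t))).
have c0 ts : 0 <= comb (map f ts) by rewrite comb_ge0 ?all_map_ge0.
have A01 n : 0 <= A n <= 1.
  apply: expect_01 => t; apply: expectn_01 => ts.
  by rewrite share_ge0 // share_le1.
rewrite -exchange_expect_level expect_level_expect -/A.
have -> : expect (level D L) (levelw (trunc_law D mu) w)
             (fun ts => comb (map f ts)) =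
  \sum_(n < D.+1) trunc_law D mu n * expect L w (fun t => (0 < f t)%R%:R) ^+ n
  - mbar * \sum_(n < D) mu' n * A n.
  rewrite -(size_biased_sum _ _ mu_biased) expect_level.
  (* The factor n kills the term n = 0, the only place where truncation changes the law on this
     range. *)
  have -> : \sum_(n < D.+1) mu n * (n%:R * A n.-1) =
            \sum_(n < D.+1) trunc_law D mu n * (n%:R * A n.-1).
    by rewrite !big_ord_recl /= !mul0r !mulr0.
  rewrite -sumrB; apply: eq_bigr => n _; rewrite -mulrBr; congr (_ * _).
  rewrite -(expectn_picks _ _ _ (fun t ts => share (comb (map f ts)) (f t))).
  rewrite -expectn_all -expectnB; apply: eq_expectn => ts.
  rewrite comb_picks ?all_map_ge0 // all_map picks_map big_map.
  by [].
rewrite lerD2l lerN2 ler_pM2l //.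
have := sum_trunc_law_cmp D mu'_law A01.
set a := \sum_(_ < _) _; set b := \sum_(_ < _) _; lra.
Qed.

End Column.
End Space.
End Laws.

(** * The expected value at the root, without an invariant law *)

Section RootBound.
Variables (R : realFieldType) (T : Type) (L : seq T) (w : T -> R) (D : nat).
Hypothesis w0 : forall t, 0 <= w t.
Hypothesis w1 : expect L w (fun=> 1) = 1.
Variables (mu mu' nu nu' : nat -> R) (mbar nbar : R).
Hypotheses (mu_law : sublaw mu) (mu'_law : sublaw mu') (nu'_law : sublaw nu').
Hypotheses (mbar0 : 0 < mbar) (nbar0 : 0 < nbar).
Hypothesis mu_biased : forall n, n.+1%:R * mu n.+1 = mbar * mu' n.
Hypothesis nu_biased : forall n, n.+1%:R * nu n.+1 = nbar * nu' n.
Variables (mbar' nbar' : R).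
Hypothesis mu_mean : \sum_(n < D.+1) mu n * n%:R <= mbar.
Hypothesis mu'_mean : \sum_(n < D.+1) mu' n * n%:R <= mbar'.
Hypothesis nu'_mean : \sum_(n < D.+1) nu' n * n%:R <= nbar'.

Let Lr := level D L.
Let wr := levelw (trunc_law D nu') w.
Let Lc := level D Lr.
Let wc := levelw (trunc_law D mu') wr.

(** [Lambda] before the limit in [D]. The law [nu] is left as it is: mass moved to n = 0 would meet
    the factor 1 - (1 - p)^0 = 0. *)
Definition trunc_Lambda p :=
  \sum_(n < D.+1) trunc_law D mu n *
     (1 - \sum_(i < D.+1) trunc_law D nu' i * (1 - p) ^+ i) ^+ n
  - mbar * ((\sum_(n < D.+1) nu n * (1 - (1 - p) ^+ n)) / nbar
          - p * \sum_(n < D.+1) trunc_law D nu' n * (1 - p) ^+ n).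

Let wr0 t : 0 <= wr t.
Proof. by apply: levelw_ge0 => // n; exact: trunc_law_ge0. Qed.

Let wc0 t : 0 <= wc t.
Proof. by apply: levelw_ge0 => // n; exact: trunc_law_ge0. Qed.

Let wr1 : expect Lr wr (fun=> 1) = 1.
Proof. by rewrite expect_level1 // sum_trunc_law. Qed.

Lemma expect_sum_sum (l : nat -> R) lbar F : sublaw l ->
  \sum_(n < D.+1) l n * n%:R <= lbar -> (forall t, 0 <= F t) ->
  expect (level D Lr) (levelw (trunc_law D l) wr)
    (fun t' => \sum_(ts <- t') \sum_(t <- ts) F t)
  <= lbar * nbar' * expect L w F.
Proof.
move=> l_law l_mean F0; rewrite expect_level_sum // expect_level_sum //.
rewrite !mean_trunc_law mulrA ler_wpM2r ?expect_ge0 //.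
have h (m : nat -> R) : sublaw m -> 0 <= \sum_(n < D.+1) m n * n%:R.
  by case=> m0 _; rewrite sumr_ge0 // => n _; rewrite mulr_ge0.
by rewrite ler_pM // h.
Qed.

(** In the application [T] consists of the trees of depth 2k, [trc] deletes the last two generations
    of a tree of depth 2k + 2, [Y] is the value of a column at depth 2k, and [X] its value at depth
    2k + 2. *)
Variables (Y : T -> R) (trc : seq (seq T) -> T) (eps kappa delta : R).
Hypothesis Y01 : forall t, 0 <= Y t <= 1.
Hypothesis trcE : forall F, expect Lc wc (F \o trc) = expect L w F.
Let X t' := comb [seq \sum_(t <- ts) Y t | ts <- t'].
Hypothesis XY : forall t', X t' <= Y (trc t').
Hypothesis eps0 : 0 < eps.
Hypothesis kappa_small :
  expect L w (fun t => if eps < Y t then 0 else Y t) <= kappa * eps.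
Hypothesis delta_small : expect Lc wc (fun t' => Y (trc t') - X t') <= delta.

(* [Y] does not have an invariant law, but [Z] is either [0] or at least [eps],
   where [share] is Lipschitz, so that replacing [Z] by its image under the
   recursion costs at most their L1-distance divided by [eps]. *)
Let Z t := if eps < Y t then Y t else 0.

(** Passing from [Y] to [Z] at the root costs mbar nbar' kappa eps, as [comb] is 1-Lipschitz and the
    expected number of grandchildren is at most mbar nbar'; [tail mu' D] comes from size-biasing a
    truncated law. In place of invariance, [comb] over the [Z] below is compared with the [Z] of the
    pruned tree: their distance is at most mbar' nbar' kappa eps from [comb], [delta] from pruning
    and kappa eps from the cut at [eps], all divided by [eps]. *)
Lemma root_bound : exists2 p, 0 <= p <= 1 &
  expect (level D Lr) (levelw (trunc_law D mu) wr)
     (fun t' => comb [seq \sum_(t <- ts) Y t | ts <- t'])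
  <= trunc_Lambda p + mbar * nbar' * (kappa * eps) + mbar * tail mu' D
     + mbar * ((mbar' * nbar' + 1) * kappa + delta / eps).
Proof.
have Y0 t : 0 <= Y t by case/andP: (Y01 t).
have ZY t : 0 <= Z t <= Y t by rewrite /Z; case: ifP; rewrite ?lexx ?Y0.
have Z0 t : 0 <= Z t by case/andP: (ZY t).
pose p := expect L w (fun t => (0 < Z t)%R%:R).
exists p; first by apply: expect_01 => // t; case: (0 < Z t); rewrite ?lexx ?ler01.
pose fY ts := \sum_(t <- ts) Y t; pose fZ ts := \sum_(t <- ts) Z t.
have fZY ts : 0 <= fZ ts <= fY ts.
  rewrite sumr_ge0 //= ler_sum // => t _; by case/andP: (ZY t).
have fZ0 ts : 0 <= fZ ts by case/andP: (fZY ts).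
pose G t := Y t - Z t.
have GE t : G t = if eps < Y t then 0 else Y t.
  by rewrite /G /Z; case: ifP; rewrite ?subrr ?subr0.
have G0 t : 0 <= G t by rewrite GE; case: ifP.
have EG : expect L w G <= kappa * eps by rewrite (eq_expect _ _ GE).
have lip t' : 0 <= comb (map fY t') - comb (map fZ t') <=
    \sum_(ts <- t') \sum_(t <- ts) G t.
  have -> : \sum_(ts <- t') \sum_(t <- ts) G t = \sum_(ts <- t') (fY ts - fZ ts).
    by apply: eq_bigr => ts _; rewrite -sumrB.
  exact: comb_lip.
have mbar'0 : 0 <= mbar'.
  apply: le_trans mu'_mean; case: mu'_law => m0 _.
  by rewrite sumr_ge0 // => n _; rewrite mulr_ge0.
have nbar'0 : 0 <= nbar'.
  apply: le_trans nu'_mean; case: nu'_law => m0 _.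
  by rewrite sumr_ge0 // => n _; rewrite mulr_ge0.
have EG0 : 0 <= expect L w G by apply: expect_ge0.
have Elip (l : nat -> R) lbar : sublaw l -> 0 <= lbar ->
    \sum_(n < D.+1) l n * n%:R <= lbar ->
    expect (level D Lr) (levelw (trunc_law D l) wr) (fun t' => comb (map fY t')
       - comb (map fZ t')) <= lbar * nbar' * (kappa * eps).
  move=> l_law lb0 l_mean.
  apply: (@le_trans _ _ (lbar * nbar' * expect L w G)); last first.
    by rewrite ler_wpM2l // mulr_ge0.
  apply: le_trans (expect_sum_sum l_law l_mean G0); apply: ler_expect.
    by move=> t'; apply: levelw_ge0 => // n; exact: trunc_law_ge0.
  by move=> t'; case/andP: (lip t').
have := Elip _ _ mu_law (ltW mbar0) mu_mean; rewrite expectB => EmuYZ.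
have EmuZ := column_bound D wr0 wr1 mu'_law mbar0 mu_biased fZ0.
have qE : expect Lr wr (fun ts => (0 < fZ ts)%R%:R) =
    1 - \sum_(n < D.+1) trunc_law D nu' n * (1 - p) ^+ n.
  rewrite -expect_level_has ?sum_trunc_law //.
  by apply: eq_expect => ts; rewrite sum_gt0.
rewrite qE in EmuZ.
have /andP[rowS _] := row_share_bounds D w0 w1 nu'_law nbar0 nu_biased Z0.
have key : row_share L w D nu' Z - ((mbar' * nbar' + 1) * kappa + delta / eps) <=
    expect Lc wc (fun t' => expect Lr wr (fun ts => share (comb (map fZ t')) (fZ ts))).
  have -> : row_share L w D nu' Z =
     expect Lc wc (fun t' => expect Lr wr (fun ts => share (Z (trc t')) (fZ ts))).
    by apply: esym; exact: (trcE (fun t => expect Lr wr (fun ts => share (Z t) (fZ ts)))).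
  rewrite lerBlDl -lerBlDr -expectB.
  apply: (@le_trans _ _ (expect Lc wc (fun t' => eps^-1 *
     ((comb (map fY t') - comb (map fZ t')) + ((Y (trc t') - X t') + G (trc t')))))).
    apply: ler_expect => // t'; rewrite -expectB.
    have c0 : 0 <= comb (map fZ t') by apply: comb_ge0; apply: all_map_ge0.
    apply: (@le_trans _ _ (expect Lr wr (fun ts =>
          `|comb (map fZ t') - Z (trc t')| / eps * 1))).
      apply: ler_expect => // ts; rewrite mulr1; apply: share_lip => //.
      by rewrite /Z; case: ifP => [/ltW|]; [right|left].
    rewrite expectZ wr1 mulr1 mulrC ler_pM2l ?invr_gt0 //.
    have [l1 l2] := andP (lip t'); have := XY t'; rewrite /X -/fY.
    have := G0 (trc t'); rewrite /G => g1 g2.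
    by rewrite ler_norml; apply/andP; split; lra.
  rewrite expectZ expectD [X in _ + X]expectD.
  have -> : expect Lc wc (fun t' => G (trc t')) = expect L w G by exact: (trcE G).
  rewrite mulrC ler_pdivrMr // mulrDl mulfVK ?gt_eqF //.
  have := Elip _ _ mu'_law mbar'0 mu'_mean; rewrite -/Lc -/wc => e1.
  move: e1 delta_small EG; set a := expect _ _ _; set b := expect _ _ _.
  set c := expect _ _ _ => e1 e2 e3. lra.
rewrite /trunc_Lambda.
move: EmuYZ EmuZ rowS key; rewrite -/Lr -/wr -/Lc -/wc -/p /fY.
set A := expect _ _ _; set B := expect _ _ _; set C := expect _ _ _.
set S1 := \sum_(_ < _) _; set S2 := (_ / nbar); set S3 := \sum_(_ < _) _.
move=> h1 h2 h3 h4.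
have h5 : mbar * (S2 - p * S3) <= mbar * (C + ((mbar' * nbar' + 1) * kappa + delta / eps)).
  by rewrite ler_pM2l //; lra.
move: h5; rewrite mulrDr => h5; rewrite mulrBr in h2; lra.
Qed.

End RootBound.

(** * Expectations over random trees *)

Section Scale.
Variables (R : realFieldType) (T : Type) (L : seq T) (w : T -> R).
Hypothesis w0 : forall t, 0 <= w t.
Hypothesis w1 : expect L w (fun=> 1) = 1.
Variables (Y : T -> R) (kappa : R) (J : nat).
Hypothesis Y0 : forall t, 0 <= Y t.
Hypothesis kappa01 : 0 < kappa <= 1.
Hypothesis J_large : 2 <= J%:R * kappa.

(* Otherwise each of the [J] disjoint ranges between consecutive scales would
   have probability more than [kappa / 2]. *)
Lemma exists_scale : exists2 j, (j < J)%N &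
  expect L w (fun t => if (kappa / 2) ^+ j < Y t then 0 else Y t)
  <= kappa * (kappa / 2) ^+ j.
Proof.
have [k0 k1] := andP kappa01.
pose e j := (kappa / 2) ^+ j.
have e0 j : 0 < e j by rewrite exprn_gt0 // divr_gt0.
have eS j : e j.+1 = kappa / 2 * e j by rewrite /e exprS.
pose P j := expect L w (fun t => (e j < Y t)%R%:R).
have P01 j : 0 <= P j <= 1.
  by apply: expect_01 => // t; case: (e j < Y t); rewrite ?lexx ?ler01.
case: (boolP [exists j : 'I_J, expect L w (fun t => if e j < Y t then 0 else Y t)
    <= kappa * e j]) => [/existsP[j h]|].
  by exists j.
rewrite negb_exists => /forallP h.
have step (j : 'I_J) : kappa / 2 < P j.+1 - P j.
  have := h j; rewrite -ltNge => hj.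
  rewrite -(ltr_pM2l (e0 j)).
  (* Values up to e_(j+1) = (kappa/2) e_j contribute at most e_(j+1) to the mean below e_j, so more
     than (kappa/2) e_j comes from values between the two scales, each at most e_j. *)
  apply: (@lt_le_trans _ _ (expect L w (fun t => if e j < Y t then 0 else Y t) - e j.+1)).
    by rewrite eS; lra.
  rewrite /P -expectB -expectZ.
  have Ec : expect L w (fun=> e j.+1) = e j.+1.
    rewrite -[RHS]mulr1 -[X in _ = _ * X]w1 -expectZ.
    by apply: eq_expect => t; rewrite mulr1.
  rewrite -[X in _ - X <= _]Ec -expectB.
  apply: ler_expect => // t.
  have ej : e j.+1 <= e j by rewrite eS ler_piMl ?(ltW (e0 j)) //; lra.
  have := e0 j.+1; have := e0 j; have := Y0 t.
  case: (ltP (e j) (Y t)); case: (ltP (e j.+1) (Y t)); rewrite ?mulr1n ?mulr0n; lra.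
have : J%:R * (kappa / 2) <= \sum_(j < J) (P j.+1 - P j).
  have -> : J%:R * (kappa / 2) = \sum_(j < J) (kappa / 2).
    by rewrite sumr_const card_ord mulr_natl.
  by apply: ler_sum => j _; exact/ltW.
have J0 : (0 < J)%N by case: (J) J_large => //; rewrite mul0r; lra.
have : J%:R * (kappa / 2) < \sum_(j < J) (P j.+1 - P j).
  have -> : J%:R * (kappa / 2) = \sum_(j < J) (kappa / 2).
    by rewrite sumr_const card_ord mulr_natl.
  rewrite (bigD1 (Ordinal J0)) // [ltRHS](bigD1 (Ordinal J0)) //= ltr_leD //; first exact: (step (Ordinal J0)).
  by apply: ler_sum => j _; exact/ltW.
rewrite -(big_mkord xpredT (fun j => P j.+1 - P j)) telescope_sumr //.
move=> a _; exfalso; have /andP[_ b] := P01 J; have /andP[c _] := P01 0%N.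
by move: a J_large b c; rewrite mulrA; set x := _ * kappa; set u := P J; set v := P 0%N; lra.
Qed.

End Scale.

Fixpoint trees (D K : nat) : seq (ptree K) :=
  match K with 0 => [:: tt] | K'.+1 => level D (trees D K') end.

Fixpoint wt (R : realFieldType) (law : nat -> nat -> R) (K : nat) : ptree K -> R :=
  match K with
  | 0 => fun=> 1
  | K'.+1 => levelw (law 0) (wt (fun l => law l.+1) (K := K'))
  end.

Fixpoint prune (K : nat) : ptree K.+1 -> ptree K :=
  match K with 0 => fun=> tt | K'.+1 => map (@prune K') end.

Section Trees.
Variables (R : realFieldType) (D : nat).
Implicit Type law : nat -> nat -> R.

Definition tree_expect law K (F : ptree K -> R) := expect (trees D K) (wt law (K := K)) F.

Lemma wt_ge0 law K (t : ptree K) : (forall l n, 0 <= law l n) -> 0 <= wt law t.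
Proof.
elim: K law t => [//|K IH] law t law0 /=.
by apply: levelw_ge0 => // s; apply: IH.
Qed.

Lemma tree_expect1 law K : (forall l, \sum_(n < D.+1) law l n = 1) ->
  tree_expect law (fun=> 1 : R) (K := K) = 1.
Proof.
elim: K law => [|K IH] law law1.
  by rewrite /tree_expect /expect big_seq1 /= mulr1.
by apply: expect_level1 => //; apply: (IH (fun l => law l.+1)) => l.
Qed.

(** Summing out the last generation costs the factor 1 because the laws have total mass 1; this is
    why the truncation keeps the mass. *)
Lemma tree_expect_prune law K (F : ptree K -> R) :
  (forall l, \sum_(n < D.+1) law l n = 1) ->
  tree_expect law (F \o @prune K) = tree_expect law F.
Proof.
elim: K law F => [|K IH] law F law1.
  transitivity (F tt * tree_expect law (fun=> 1 : R) (K := 1)).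
    by rewrite -expectZ; apply: eq_expect => t /=; rewrite mulr1.
  by rewrite tree_expect1 // mulr1 /tree_expect /expect big_seq1 /= mul1r.
apply: expect_level_map => G; apply: (IH (fun l => law l.+1)) => l; exact: law1.
Qed.

End Trees.

(** A doubling that computes, so that [ptree (dbl k.+1)] unfolds to lists of lists over
    [ptree (dbl k)]: one list level for rows, one for columns. *)
Fixpoint dbl k := if k is k'.+1 then (dbl k').+2 else 0%N.

Definition prune2 k : ptree (dbl k.+1) -> ptree (dbl k) :=
  fun t => prune (prune t : ptree (dbl k).+1).

Lemma prune2S k (t : ptree (dbl k.+2)) :
  prune2 t = map (map (@prune2 k)) t :> seq (seq (ptree (dbl k))).
Proof.
rewrite /prune2 /= -map_comp; apply: eq_map => ts /=.
by rewrite -map_comp.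
Qed.

Section ColumnValue.
Variable R : realFieldType.

(** The [Y] of the overview for a ball of radius 2k. *)
Fixpoint colval k : ptree (dbl k) -> R :=
  match k with
  | 0 => fun=> 1
  | k'.+1 => fun t => comb [seq \sum_(s <- ts) colval s | ts <- (t : seq (seq (ptree (dbl k'))))]
  end.

Lemma colval_01 k (t : ptree (dbl k)) : 0 <= colval t <= 1.
Proof.
elim: k t => [|k IH] t /=; first by rewrite ler01 lexx.
have h : all (fun s => 0 <= s) [seq \sum_(s <- ts) colval s | ts <- t].
  elim: t => //= ts t ->; rewrite andbT sumr_ge0 // => s _.
  by case/andP: (IH s).
by rewrite comb_ge0 ?comb_le1.
Qed.

(** The leaves have the largest possible value 1 and [comb] is monotone, so revealing two more
    generations can only lower the value. *)
Lemma colval_prune2 k (t : ptree (dbl k.+1)) : colval t <= colval (prune2 t).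
Proof.
elim: k t => [|k IH] t; first by case/andP: (colval_01 t).
have e : colval (prune2 t) =
  comb [seq \sum_(s <- ts) colval (prune2 s) | ts <- (t : seq (seq (ptree (dbl k.+1))))].
  rewrite prune2S /= -map_comp; congr comb; apply: eq_map => ts /=.
  by rewrite big_map.
rewrite e -subr_ge0.
have := @comb_lip R _ (fun ts => \sum_(s <- ts) colval (prune2 s))
   (fun ts : seq (ptree (dbl k.+1)) => \sum_(s <- ts) colval s) t.
case/(_ _)/andP => // ts.
rewrite ler_sum ?andbT ?sumr_ge0 //.
by move=> s _; case/andP: (colval_01 s).
Qed.

End ColumnValue.

Section LevelRootBound.
Variables (R : realFieldType).
Variables (mu mu' nu nu' : nat -> R) (mbar nbar mbar' nbar' : R) (D : nat).
Hypotheses (mu_law : sublaw mu) (mu'_law : sublaw mu') (nu'_law : sublaw nu').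
Hypotheses (mbar0 : 0 < mbar) (nbar0 : 0 < nbar).
Hypothesis mu_biased : forall n, n.+1%:R * mu n.+1 = mbar * mu' n.
Hypothesis nu_biased : forall n, n.+1%:R * nu n.+1 = nbar * nu' n.
Hypothesis mu_mean : \sum_(n < D.+1) mu n * n%:R <= mbar.
Hypothesis mu'_mean : \sum_(n < D.+1) mu' n * n%:R <= mbar'.
Hypothesis nu'_mean : \sum_(n < D.+1) nu' n * n%:R <= nbar'.

Definition col_law l := if odd l then nu' else mu'.
Definition root_law l := if l is 0 then mu else if odd l then nu' else mu'.

Lemma col_lawSS : (fun l => trunc_law D (col_law l.+2)) = (fun l => trunc_law D (col_law l)).
Proof. by apply/funext => l; rewrite /col_law /= negbK. Qed.

Lemma root_lawSS : (fun l => trunc_law D (root_law l.+2)) = (fun l => trunc_law D (col_law l)).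
Proof. by apply/funext => l; rewrite /root_law /col_law /= negbK. Qed.

Lemma col_law_sublaw l : sublaw (col_law l).
Proof. by rewrite /col_law; case: ifP. Qed.

Variables (kappa : R) (J N : nat).
Hypothesis kappa01 : 0 < kappa <= 1.
Hypothesis J_large : 2 <= J%:R * kappa.
Hypothesis N_gt0 : (0 < N)%N.

(** The depth and p depend on [D], but the range [N] of the depth does not; this allows [D] to be
    chosen afterwards, good for all depths below [N]. *)
Lemma root_value_bound : exists k p, [/\ (k < N)%N, 0 <= p <= 1 &
  tree_expect D (fun l => trunc_law D (root_law l)) (@colval R k.+1)
  <= trunc_Lambda D mu nu nu' mbar nbar p + mbar * nbar' * kappa
     + mbar * tail mu' D
     + mbar * ((mbar' * nbar' + 1) * kappa + (N%:R * (kappa / 2) ^+ J)^-1)].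
Proof.
have [k0 k1] := andP kappa01.
pose law l := trunc_law D (col_law l).
have law1 l : \sum_(n < D.+1) law l n = 1 by rewrite sum_trunc_law.
have law0 l n : 0 <= law l n by apply/trunc_law_ge0/col_law_sublaw.
pose E k := tree_expect D law (@colval R k).
have E01 k : 0 <= E k <= 1.
  apply: expect_01; last exact: colval_01.
    by move=> t; exact: wt_ge0.
  exact: tree_expect1.
(* The [N] decrements add up to E 0 - E N, at most 1, so one of them is at most 1/N. *)
have [k kN dk] : exists2 k, (k < N)%N & E k - E k.+1 <= N%:R^-1.
  case: (boolP [exists k : 'I_N, E k - E k.+1 <= N%:R^-1]) => [/existsP[k h]|].
    by exists k.
  rewrite negb_exists => /forallP h.
  have : \sum_(k < N) N%:R^-1 < \sum_(k < N) (E k - E k.+1).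
    rewrite (bigD1 (Ordinal N_gt0)) // [ltRHS](bigD1 (Ordinal N_gt0)) //= ltr_leD //.
      by have := h (Ordinal N_gt0); rewrite -ltNge.
    by apply: ler_sum => i _; have := h i; rewrite -ltNge => /ltW.
  rewrite sumr_const card_ord -[X in X < _]mulr_natl mulfV; last by rewrite pnatr_eq0 -lt0n.
  have -> : \sum_(k < N) (E k - E k.+1) = E 0%N - E N.
    rewrite -opprB -telescope_sumr // big_mkord -sumrN.
    by apply: eq_bigr => i _; rewrite opprB.
  by have /andP[_ b] := E01 0%N; have /andP[c _] := E01 N; move=> a; exfalso; lra.
have w1 : expect (trees D (dbl k)) (wt law (K := dbl k)) (fun=> 1) = 1 by exact: tree_expect1.
have w0 t : 0 <= wt law (K := dbl k) t by exact: wt_ge0.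
have [j jJ hj] := exists_scale w0 w1 (fun t => proj1 (andP (colval_01 R t))) kappa01 J_large.
pose e := (kappa / 2) ^+ j.
have e0 : 0 < e by rewrite exprn_gt0 // divr_gt0.
have e1 : e <= 1 by rewrite exprn_ile1 //; lra.
have trcE F : expect (trees D (dbl k.+1)) (levelw (trunc_law D mu') (levelw (trunc_law D nu')
    (wt law (K := dbl k)))) (F \o @prune2 k) = expect (trees D (dbl k)) (wt law (K := dbl k)) F.
  rewrite -[RHS](tree_expect_prune F law1).
  rewrite -[RHS](tree_expect_prune (F \o @prune (dbl k)) law1).
  by rewrite /tree_expect /= /law col_lawSS.
have nbar'0 : 0 <= nbar'.
  apply: le_trans nu'_mean; case: nu'_law => m0 _.
  by rewrite sumr_ge0 // => n _; rewrite mulr_ge0.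
have dk' : expect (trees D (dbl k.+1)) (levelw (trunc_law D mu') (levelw (trunc_law D nu')
    (wt law (K := dbl k)))) (fun t' => colval R (prune2 t') - @colval R k.+1 t') <= N%:R^-1.
  apply: le_trans dk; rewrite expectB (trcE (@colval R k)) /E lerD2l lerN2.
  by rewrite /tree_expect /= /law col_lawSS.
have [p p01 hp] := root_bound w0 w1 mu_law mu'_law nu'_law mbar0 nbar0 mu_biased
   nu_biased mu_mean mu'_mean nu'_mean (@colval_01 R k) trcE
   (@colval_prune2 R k) e0 hj dk'.
exists k, p; split => //.
have -> : tree_expect D (fun l => trunc_law D (root_law l)) (@colval R k.+1) =
   expect (level D (level D (trees D (dbl k)))) (levelw (trunc_law D mu)
      (levelw (trunc_law D nu') (wt law (K := dbl k))))
      (fun t' => comb [seq \sum_(t <- ts) colval R t | ts <- t']).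
  by rewrite /tree_expect /= root_lawSS.
apply: le_trans hp _.
have h1 : mbar * nbar' * (kappa * e) <= mbar * nbar' * kappa.
  by rewrite ler_wpM2l ?mulr_ge0 ?(ltW mbar0) //; nra.
(* The scale is not known in advance, but j < J makes (kappa/2)^J a lower bound for it. *)
have h2 : N%:R^-1 / e <= (N%:R * (kappa / 2) ^+ J)^-1.
  rewrite invfM ler_pM2l ?invr_gt0 ?ltr0n //.
  rewrite lef_pV2 ?posrE // ?exprn_gt0 ?divr_gt0 //.
  rewrite /e ler_wiXn2l //; try lra; exact: ltnW.
have h3 : mbar * ((mbar' * nbar' + 1) * kappa + N%:R^-1 / e) <=
   mbar * ((mbar' * nbar' + 1) * kappa + (N%:R * (kappa / 2) ^+ J)^-1).
  by rewrite ler_pM2l // lerD2l.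
by lra.
Qed.

End LevelRootBound.

(** * Messages on random trees *)

Fixpoint colmsg (b : bool) k : ptree (dbl k) -> bool :=
  match k with
  | 0 => fun=> b
  | k'.+1 => fun t => all (has (@colmsg b k')) (t : seq (seq (ptree (dbl k'))))
  end.

Section CoverCost.
Variables (R : realFieldType) (b : bool) (k : nat).

Let old (t : ptree (dbl k.+1)) := colmsg b (prune2 t).
Let new (t : ptree (dbl k.+1)) := colmsg b t.

(* The level whose messages decide whether a column is left out of the cover:
   the smaller one, as messages decrease in the level if [b] and increase
   otherwise. *)
Definition kept_msg (t : ptree (dbl k.+1)) := if b then new t else old t.

(** A row receiving at least two positive messages costs 1, split evenly among the senders. This is
    the part of the parent column, assumed to be a sender: the 1 in the denominator stands for
    it. *)
Definition row_cost (ts : seq (ptree (dbl k.+1))) : R :=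
  (has new ts)%:R / (1 + (count new ts)%:R).

(** The condition on [p.2] is the message of level k + 1 from the root to the row [p.1]; it is
    computed from messages of level k of the columns below the other rows, hence [old]. *)
Definition cover_cost (t : ptree (dbl k.+2)) : R :=
  1 - (all (has kept_msg) (t : seq (seq (ptree (dbl k.+1)))))%:R
  + \sum_(p <- picks (t : seq (seq (ptree (dbl k.+1)))))
      (all (has old) p.2)%:R * row_cost p.1.

Lemma row_cost_01 ts : 0 <= row_cost ts <= 1.
Proof.
have h : 0 < 1 + (count new ts)%:R :> R by rewrite ltr_wpDr // ltr01.
rewrite divr_ge0 ?(ltW h) //= ler_pdivrMr // mul1r.
have : (count new ts)%:R >= 0 :> R by [].
by case: has; rewrite ?mulr1n ?mulr0n; lra.
Qed.

Lemma size_picks T (s : seq T) : size (picks s) = size s.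
Proof. by elim: s => //= t s IH; rewrite size_map IH. Qed.

Lemma cover_cost_ge0 t : 0 <= cover_cost t.
Proof.
rewrite addr_ge0 //; first by case: all; rewrite ?subrr ?subr0.
apply: sumr_ge0 => p _; rewrite mulr_ge0 //.
by case/andP: (row_cost_01 p.1).
Qed.

Lemma cover_cost_le t : cover_cost t <= (size t).+1%:R.
Proof.
have h : \sum_(p <- picks (t : seq (seq (ptree (dbl k.+1)))))
      (all (has old) p.2)%:R * row_cost p.1 <= (size t)%:R.
  rewrite -size_picks.
  elim: (picks t) => [|p s IH]; first by rewrite big_nil.
  rewrite big_cons /= -natr1 [leRHS]addrC lerD //.
  by have := row_cost_01 p.1; case: all; rewrite ?mul1r ?mul0r // => /andP[].
by rewrite -natr1 [leRHS]addrC lerD // lerBlDr lerDl; case: all.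
Qed.

End CoverCost.

Section MessageProbability.
Variables (R : realFieldType).
Variables (mu mu' nu nu' : nat -> R) (mbar nbar : R) (D : nat).
Hypotheses (mu_law : sublaw mu) (mu'_law : sublaw mu') (nu'_law : sublaw nu').
Hypotheses (mbar0 : 0 < mbar) (nbar0 : 0 < nbar).
Hypothesis mu_biased : forall n, n.+1%:R * mu n.+1 = mbar * mu' n.
Hypothesis nu_biased : forall n, n.+1%:R * nu n.+1 = nbar * nu' n.
Variable b : bool.

Definition row_prob p := 1 - \sum_(i < D.+1) trunc_law D nu' i * (1 - p) ^+ i.

Fixpoint msg_prob k : R :=
  if k is k'.+1 then
    \sum_(n < D.+1) trunc_law D mu' n * row_prob (msg_prob k') ^+ n
  else b%:R.

Let law l := trunc_law D (col_law mu' nu' l).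
Let law1 l : \sum_(n < D.+1) law l n = 1. Proof. exact: sum_trunc_law. Qed.
Let law0 l n : 0 <= law l n.
Proof. by apply: trunc_law_ge0; rewrite /col_law; case: ifP. Qed.

Lemma tree_expect_colmsg k :
  tree_expect D law (fun t => (@colmsg b k t)%:R) = msg_prob k.
Proof.
elim: k => [|k IH].
  by rewrite /tree_expect /expect big_seq1 /= mul1r.
rewrite /= /tree_expect /= expect_level_all; apply: eq_bigr => n _.
congr (_ * _ ^+ _); rewrite expect_level_has.
- by rewrite -IH /law -col_lawSS.
- exact: sum_trunc_law.
- exact: (@tree_expect1 _ D (fun l => law l.+2)).
Qed.

Lemma tree_expect_colmsg_prune2 k :
  tree_expect D law (fun t : ptree (dbl k.+1) => (colmsg b (prune2 t))%:R) =
  msg_prob k.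
Proof.
rewrite -tree_expect_colmsg.
rewrite -[RHS](tree_expect_prune (fun t => (@colmsg b k t)%:R) law1).
rewrite -[RHS](tree_expect_prune _ law1).
by [].
Qed.

(** After marking a row the number of other rows is size-biased, so the root sends it a positive
    message with probability at most [msg_prob k.+1], independently of that row. The [share] of a
    value 1 among 0/1 values is exactly [row_cost], so the estimate of [row_share] from the lower
    bound on the rank applies. *)
Lemma cover_cost_expect k :
  tree_expect D (fun l => trunc_law D (root_law mu mu' nu' l))
    (@cover_cost R b k) <=
  1 - \sum_(n < D.+1) trunc_law D mu n *
        row_prob (msg_prob (if b then k.+1 else k)) ^+ n
  + mbar * ((\sum_(n < D.+1) nu n * (1 - (1 - msg_prob k.+1) ^+ n)) / nbar
     - msg_prob k.+1 * \sum_(n < D.+1) trunc_law D nu' n * (1 - msg_prob k.+1) ^+ n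
     + tail nu' D).
Proof.
pose old (t : ptree (dbl k.+1)) := colmsg b (prune2 t).
pose new (t : ptree (dbl k.+1)) := colmsg b t.
pose w := wt law (K := dbl k.+1).
have w1 : expect (trees D (dbl k.+1)) w (fun=> 1) = 1 by exact: tree_expect1.
have w0 t : 0 <= w t by exact: wt_ge0.
pose Lr := level D (trees D (dbl k.+1)).
pose wr := levelw (trunc_law D nu') w.
have wr0 t : 0 <= wr t by apply: levelw_ge0 => // n; exact: trunc_law_ge0.
have wr1 : expect Lr wr (fun=> 1) = 1.
  by apply: expect_level1 => //; exact: sum_trunc_law.
have -> : tree_expect D (fun l => trunc_law D (root_law mu mu' nu' l)) (@cover_cost R b k) =
   expect (level D Lr) (levelw (trunc_law D mu) wr) (@cover_cost R b k).
  by rewrite /wr /w /law -(root_lawSS mu).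
have Eh a : expect Lr wr (fun ts => (has a ts)%:R) =
    row_prob (expect (trees D (dbl k.+1)) w (fun t => (a t)%:R)).
  by rewrite expect_level_has // sum_trunc_law.
have Eold : expect (trees D (dbl k.+1)) w (fun t => (old t)%:R) = msg_prob k.
  exact: tree_expect_colmsg_prune2.
have Enew : expect (trees D (dbl k.+1)) w (fun t => (new t)%:R) = msg_prob k.+1.
  exact: tree_expect_colmsg.
have Ekept : expect (trees D (dbl k.+1)) w (fun t => (@kept_msg b k t)%:R) =
    msg_prob (if b then k.+1 else k).
  by move: Enew Eold; rewrite /kept_msg /new /old; case: (b).
rewrite /cover_cost expectD expectB.
rewrite -[X in _ <= 1 - X + _]/(\sum_(n < D.+1) trunc_law D mu n * _).
rewrite expect_level_all Eh Ekept expect_level1 ?sum_trunc_law // lerD2l.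
rewrite expect_level.
have -> : \sum_(n < D.+1) trunc_law D mu n * expectn Lr wr n
   (fun t => \sum_(p <- picks t) (all (has old) p.2)%:R * @row_cost R b k p.1) =
  mbar * ((\sum_(n < D) mu' n * row_prob (msg_prob k) ^+ n) * expect Lr wr (@row_cost R b k)).
  have H n : trunc_law D mu n * expectn Lr wr n (fun t => \sum_(p <- picks t)
     (all (has old) p.2)%:R * @row_cost R b k p.1) =
     mu n * (n%:R * (row_prob (msg_prob k) ^+ n.-1 * expect Lr wr (@row_cost R b k))).
    rewrite (expectn_picks _ _ _ (fun t ts => (all (has old) ts)%:R * @row_cost R b k t)).
    case: n => [|n]; first by rewrite !mul0r !mulr0.
    congr (_ * (_ * _)); rewrite -expectZ; apply: eq_expect => t.
    by rewrite -Eold -Eh -expectn_all [RHS]mulrC -expectnZ; apply: eq_expectn => ts; rewrite mulrC.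
  rewrite (eq_bigr _ (fun (n : 'I_D.+1) _ => H n)).
  rewrite (size_biased_sum _ (fun n => row_prob (msg_prob k) ^+ n * expect Lr wr (@row_cost R b k)) mu_biased).
  by rewrite mulr_suml; congr (_ * _); apply: eq_bigr => n _; rewrite mulrA.
rewrite ler_pM2l //.
have rp01 : 0 <= row_prob (msg_prob k) <= 1.
  rewrite -Eold -Eh; apply: expect_01 => // ts.
  by case: has; rewrite ?ler01 ?lexx.
have /(_ (fun n => row_prob (msg_prob k) ^+ n)) := sum_trunc_law_cmp D mu'_law.
case/(_ _)/andP => [n|h1 _].
  by case/andP: rp01 => a c; rewrite exprn_ge0 ?exprn_ile1.
have rc0 : 0 <= expect Lr wr (@row_cost R b k).
  by apply: expect_ge0 => // ts; case/andP: (row_cost_01 R b ts).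
apply: (@le_trans _ _ (msg_prob k.+1 * expect Lr wr (@row_cost R b k))).
  by rewrite ler_wpM2r //= -subr_ge0.
have Z0 (t : ptree (dbl k.+1)) : 0 <= (new t)%:R :> R by [].
have /andP[_] := row_share_bounds D w0 w1 nu'_law nbar0 nu_biased Z0.
have -> : expect (trees D (dbl k.+1)) w (fun t => (0 < (new t)%:R :> R)%R%:R) = msg_prob k.+1.
  by rewrite -Enew; apply: eq_expect => t; case: (new t); rewrite ?ltr01 ?ltxx.
have -> : row_share (trees D (dbl k.+1)) w D nu' (fun t => (new t)%:R) =
   msg_prob k.+1 * expect Lr wr (@row_cost R b k).
  rewrite -Enew mulrC -expectZ; apply: eq_expect => t; rewrite mulrC -expectZ.
  apply: eq_expect => ts; rewrite /share /row_cost.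
  have -> : \sum_(s <- ts) (new s)%:R = (count new ts)%:R :> R.
    by rewrite -sum1_count natr_sum [RHS]big_mkcond; apply: eq_bigr => s _; case: (new s).
  rewrite has_count ltr0n; case: (new t); last by rewrite !mul0r mulr0.
  by rewrite mulr1n !mul1r.
by lra.
Qed.

End MessageProbability.

(** * Rank and corank *)

Section CoverRank.
Variables (F : fieldType) (m n : nat) (M : 'M[F]_(m, n)).

Lemma rank_sum_delta k (S : {set 'I_k}) :
  (\rank (\sum_(i in S) delta_mx i i : 'M[F]_k)%R <= #|S|)%N.
Proof.
rewrite -sum1_card.
apply: (big_ind2 (fun (A : 'M[F]_k) a => (\rank A <= a)%N)) => [|A a B b hA hB|i _].
- by rewrite mxrank0.
- exact: leq_trans (mxrank_add _ _) (leq_add hA hB).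
- by rewrite mxrank_delta.
Qed.

Lemma sum_deltaE k (S : {set 'I_k}) i j :
  (\sum_(l in S) delta_mx l l : 'M[F]_k) i j = ((i == j) && (i \in S))%:R.
Proof.
rewrite summxE; under eq_bigr do rewrite mxE.
have [<-|ij] := eqVneq i j; last first.
  by rewrite big1 // => l _; case: eqP => //= <-; rewrite eq_sym (negbTE ij).
have [iS|iS] := boolP (i \in S).
  rewrite (bigD1 i) //= eqxx big1 ?addr0 // => l /andP[_ li].
  by rewrite eq_sym (negbTE li).
rewrite big1 // => l lS; case: eqP => //= e.
by move: iS; rewrite e lS.
Qed.

(** Split the matrix into its columns outside [B] and those in [B]; the second part vanishes off the
    rows adjacent to [B]. *)
Lemma rank_le_cover (B : {set 'I_n}) :
  (\rank M <= #|~: B| + #|[set i | [exists j in B, M i j != 0%R]]|)%N.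
Proof.
set N := [set i | _].
pose DB : 'M[F]_n := \sum_(l in ~: B) delta_mx l l.
pose DN : 'M[F]_m := \sum_(l in N) delta_mx l l.
have E : M = M *m DB + DN *m (M - M *m DB).
  have MDB i j : (M *m DB) i j = M i j * (j \notin B)%:R.
    rewrite mxE (bigD1 j) //= big1 ?addr0 => [|l lj].
      by rewrite sum_deltaE eqxx inE.
    by rewrite sum_deltaE (negbTE lj) mulr0.
  have MR i j : (M - M *m DB) i j = M i j * (j \in B)%:R.
    have -> : (M - M *m DB) i j = M i j - (M *m DB) i j by rewrite mxE [X in _ + X]mxE.
    rewrite MDB.
    by case: (j \in B); rewrite /= ?mulr1 ?mulr0 ?subrr ?subr0.
  apply/matrixP => i j; rewrite mxE MDB mxE (bigD1 i) //= big1 ?addr0 => [|l li].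
    rewrite sum_deltaE eqxx MR /=.
    case: (boolP (j \in B)) => jB /=; last by rewrite mulr1 !mulr0 addr0.
    rewrite mulr0 mulr1 add0r inE.
    have [->|Mij] := eqVneq (M i j) 0; first by rewrite mulr0.
    suff -> : [exists j0 in B, M i j0 != 0] by rewrite mul1r.
    by apply/existsP; exists j; rewrite jB.
  by rewrite sum_deltaE eq_sym (negbTE li) mul0r.
rewrite {1}E; apply: leq_trans (mxrank_add _ _) _; apply: leq_add.
  exact: leq_trans (mxrankM_maxr _ _) (rank_sum_delta _).
exact: leq_trans (mxrankM_maxl _ _) (rank_sum_delta _).
Qed.

End CoverRank.

Section Corank.
Variables (R : realFieldType) (m n : nat) (M : 'M[R]_(m, n)).

Lemma row_sqnorm_eq0 k (v : 'rV[R]_k) : v *m v^T = 0 -> v = 0.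
Proof.
move=> /matrixP/(_ 0 0); rewrite !mxE => /eqP.
rewrite psumr_eq0 => [/allP h|i _]; last by rewrite mxE -expr2 sqr_ge0.
apply/rowP => i; have := h i (mem_index_enum i).
by rewrite !mxE mulf_eq0 orbb => /eqP.
Qed.

(* The corank is the trace of the orthogonal projection on the kernel. *)
Lemma corank_trace : exists p : 'I_n -> R,
  (n - \rank M)%:R = \sum_j p j /\
  forall j c, 0 <= c ->
    (forall v : 'rV[R]_n, v *m M^T = 0 -> v 0 j ^+ 2 <= c * \sum_i v 0 i ^+ 2) ->
    p j <= c.
Proof.
pose K := row_base (kermx M^T).
have rK : \rank (kermx M^T) = (n - \rank M)%N by rewrite mxrank_ker mxrank_tr.
have KM : K *m M^T = 0.
  by apply/eqP; rewrite -sub_kermx eq_row_base.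
have K_free : row_free K by exact: row_base_free.
clearbody K.
have Gu : K *m K^T \in unitmx.
  rewrite -row_free_unit -kermx_eq0 -submx0; apply/rV_subP => v.
  rewrite sub_kermx mulmxA => /eqP h.
  have : (v *m K) *m (v *m K)^T = 0 by rewrite trmx_mul mulmxA h mul0mx.
  move=> /row_sqnorm_eq0/eqP; rewrite -sub_kermx.
  by move: K_free; rewrite -kermx_eq0 => /eqP->.
pose P := K^T *m invmx (K *m K^T) *m K.
have trP : \tr P = (n - \rank M)%:R.
  by rewrite /P -mulmxA mxtrace_mulC -mulmxA mulVmx // mxtrace1 rK.
have PT : P^T = P.
  by rewrite /P !trmx_mul trmx_inv trmx_mul !trmxK mulmxA.
have PP : P *m P^T = P.
  rewrite PT /P -!mulmxA (mulmxA K K^T) (mulmxA (K *m K^T)) mulmxV //.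
  by rewrite mul1mx.
have PM : P *m M^T = 0 by rewrite /P -mulmxA KM mulmx0.
clearbody P; exists (fun j => P j j); split=> [|j c c0 kernel_bound]; first exact: esym.
(* Row [j] of the projection lies in the kernel; its j-th coordinate and its squared norm are both
   the diagonal entry, which can be cancelled once. *)
have h := @kernel_bound (row j P) _.
rewrite -row_mul PM row0 in h; have {h} := h erefl.
have -> : \sum_i row j P 0 i ^+ 2 = P j j.
  rewrite -{2}PP mxE; apply: eq_bigr => i _.
  by rewrite [P^T _ _]mxE mxE expr2.
rewrite mxE => h.
have Pjj : 0 <= P j j.
  by rewrite -PP mxE sumr_ge0 // => i _; rewrite [P^T _ _]mxE -expr2 sqr_ge0.
move: Pjj; rewrite le_eqVlt => /predU1P[<-//|p].
by rewrite expr2 ler_pM2r in h.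
Qed.

End Corank.

(** * Balls of the Tanner graph *)

Section Inequalities.
Variable R : realFieldType.

(** Cauchy-Schwarz for the square roots of xu and yv, one summand at a time; the cross term is
    bounded by 2ab <= xv + yu, the arithmetic-geometric mean inequality. *)
Lemma cauchy_schwarz_step (a b x y u v : R) : 0 <= a -> 0 <= b -> 0 <= x -> 0 <= y ->
  0 <= u -> 0 <= v -> a ^+ 2 <= x * u -> b ^+ 2 <= y * v ->
  (a + b) ^+ 2 <= (x + y) * (u + v).
Proof.
move=> a0 b0 x0 y0 u0 v0 h1 h2.
have h : 2 * (a * b) <= x * v + y * u.
  have p1 : 0 <= x * v by rewrite mulr_ge0.
  have p2 : 0 <= y * u by rewrite mulr_ge0.
  rewrite -(@ler_pXn2r _ 2) ?nnegrE ?mulr_ge0 ?addr_ge0 //.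
  have : a ^+ 2 * b ^+ 2 <= (x * u) * (y * v) by rewrite ler_pM ?sqr_ge0.
  have : 0 <= (x * v - y * u) ^+ 2 by rewrite sqr_ge0.
  nra.
nra.
Qed.

(** Here q stands for v(c)^2, and the i-th pair for S_i and the squared norm N_i below the i-th row.
    Adding the bounds q/S_i <= N_i to q <= q produces the factor 1 + sum_i 1/S_i; if some S_i = 0,
    then q = 0. *)
Lemma comb_absorbs (q : R) (ps : seq (R * R)) : 0 <= q ->
  all (fun p => [&& 0 <= p.1, 0 <= p.2 & q <= p.1 * p.2]) ps ->
  q <= comb [seq p.1 | p <- ps] * (q + \sum_(p <- ps) p.2).
Proof.
move=> q0 h.
have h1 : all (fun s => 0 <= s) [seq p.1 | p <- ps].
  by rewrite all_map; apply: sub_all h => p /and3P[].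
have h2 : 0 <= \sum_(p <- ps) p.2.
  by rewrite big_seq sumr_ge0 // => p /(allP h)/and3P[].
rewrite /comb; case: (boolP (all _ _)) => [pos|npos]; last first.
  rewrite all_map -has_predC in npos; have /hasP[p pin] := npos.
  have /and3P[a b c] := allP h p pin; rewrite /= -leNgt => d.
  have e : p.1 = 0 by apply/eqP; rewrite eq_le d a.
  by rewrite mul0r mul0r; move: c; rewrite e mul0r.
have S0 := sumV_ge0 h1.
rewrite mulr1n mulrAC mul1r ler_pdivlMr; last by lra.
rewrite mulrDr mulr1 lerD2l big_map mulr_sumr !big_seq; apply: ler_sum => p pin.
have /and3P[a b c] := allP h p pin.
have p0 : 0 < p.1 by apply: (allP pos); exact: map_f.
by rewrite ler_pdivrMr // mulrC.
Qed.

End Inequalities.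

(** * Kernel vectors on balls that are trees *)

Section KernelBound.
Variables (R : realType) (M : fmatrix R).
Hypothesis M_sign : sign_entries M.
Variable v : 'rV[R]_(ncols M).
Hypothesis v_ker : v *m (mx M)^T = 0.

Let G := tanner_graph M.

Definition vertex_abs (y : tanner_vertex M) : R := if y is inr j then `|v 0 j| else 0.

Let sq y := vertex_abs y ^+ 2.

(** The row equation expresses v(c) by the other columns of the row, and all nonzero coefficients
    have absolute value 1. *)
Lemma kernel_row (r : 'I_(nrows M)) (c : 'I_(ncols M)) (s : seq (tanner_vertex M)) :
  uniq s -> (forall y, y \in s <-> adj G (inl r) y /\ ~~ pred1 (inr c) y) ->
  mx M r c != 0 -> `|v 0 c| <= \sum_(y <- s) vertex_abs y.
Proof.
move=> us sP Mrc.
have norm1 j : mx M r j != 0 -> `|mx M r j| = 1.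
  have := M_sign r j; rewrite !inE => /or3P[] /eqP ->; rewrite ?eqxx //.
    by rewrite normrN normr1.
  by rewrite normr1.
have E : \sum_j mx M r j * v 0 j = 0.
  have /matrixP/(_ 0 r) := v_ker; rewrite !mxE => e; rewrite -[RHS]e.
  by apply: eq_bigr => j _; rewrite mxE mulrC.
have -> : `|v 0 c| = `|\sum_(j | j != c) mx M r j * v 0 j|.
  move: E; rewrite (bigD1 c) //= => /eqP; rewrite addr_eq0 => /eqP e.
  by rewrite -[RHS]normrN -e normrM norm1 // mul1r.
apply: le_trans (ler_norm_sum _ _ _) _.
rewrite big_uniq //= big_sumType /= [X in _ <= X + _]big1 ?add0r //.
rewrite big_mkcond [leRHS]big_mkcond /=; apply: ler_sum => j _.
case: (boolP (inr j \in s)) => js.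
  case: ifP => // jc; rewrite normrM.
  have [->|n0] := eqVneq (mx M r j) 0; first by rewrite normr0 mul0r.
  by rewrite norm1 // mul1r.
case: ifP => // jc; have [->|n0] := eqVneq (mx M r j) 0; first by rewrite mul0r normr0.
case/negP: js; apply/sP; split; first exact/eqP.
by apply/eqP => -[] e; rewrite e eqxx in jc.
Qed.

Lemma embeds_kernel_bound k (t : ptree (dbl k)) ex c A :
  embeds G t ex (inr c) A ->
  sq (inr c) <= colval R t * \sum_(y <- A) sq y.
Proof.
elim: k t ex c A => [|k IH] t ex c A /=.
  by move=> ->; rewrite big_seq1 mul1r.
move=> [cs [-> _ csP F2]]; rewrite big_cons.
(* The pairs for [comb_absorbs]: the sum of the values below a row, and the squared norm over the
   vertices met below it. *)
have [ps [e1 e2 hp]] : exists ps : seq (R * R),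
  [/\ [seq p.1 | p <- ps] = [seq \sum_(s <- ts) colval R s | ts <- (t : seq (seq (ptree (dbl k))))],
      \sum_(p <- ps) p.2 = \sum_(y <- flatten (unzip2 cs)) sq y
    & all (fun p => [&& 0 <= p.1, 0 <= p.2 & sq (inr c) <= p.1 * p.2]) ps].
  have {csP} : all (fun y => if y is inl r then mx M r c != 0 else false) (unzip1 cs).
    by apply/allP => -[r|j] /csP[] //= /eqP.
  elim: F2 => [|ts [y B] t' cs' h F2 IH2] /=.
    by exists [::]; rewrite !big_nil.
  case: y h => // r [ds []] /= -> ud dP F3 /andP[Mrc /IH2[ps [e1 e2 hp]]].
  exists ((\sum_(s <- ts) colval R s, \sum_(y <- inl r :: flatten (unzip2 ds)) sq y) :: ps).
  split; first by rewrite /= e1.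
    by rewrite big_cons e2 -big_cat.
  rewrite /= hp andbT.
  have c0 s : 0 <= colval R (s : ptree (dbl k)) by case/andP: (colval_01 R s).
  rewrite sumr_ge0 ?sumr_ge0 //= => [|y _]; last exact: sqr_ge0.
  have := kernel_row ud dP Mrc.
  have -> : \sum_(y <- inl r :: flatten (unzip2 ds)) sq y =
      \sum_(y <- flatten (unzip2 ds)) sq y.
    by rewrite big_cons [sq (inl r)]expr0n add0r.
  rewrite -[sq (inr c)]/(`|v 0 c| ^+ 2).
  have {dP ud} : all (fun y => if y is inr j then true else false) (unzip1 ds).
    by apply/allP => -[j|j] /dP[].
  have cs_bound : all (fun y => if y is inr j then true else false) (unzip1 ds) ->
    (\sum_(y <- unzip1 ds) vertex_abs y) ^+ 2 <=
      (\sum_(s <- ts) colval R s) * \sum_(y <- flatten (unzip2 ds)) sq y.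
    elim: F3 => [|s [y B'] ts' ds' /= hs _ IH3].
      by rewrite !big_nil expr0n mulr0.
    case: y hs => // j hs /= /IH3 h3; rewrite !big_cons big_cat /=.
    have := IH _ _ _ _ hs; rewrite {1}/sq => h4.
    apply: cauchy_schwarz_step => //; rewrite ?normr_ge0 ?c0 ?sumr_ge0 //.
      by move=> [] // i _; rewrite /vertex_abs.
    - by move=> y _; exact: sqr_ge0.
    - by move=> y _; exact: sqr_ge0.
  move=> /cs_bound h1 h2; apply: le_trans h1.
  by rewrite ler_pXn2r ?nnegrE ?sumr_ge0 // => -[] // i _; rewrite /vertex_abs.
have := comb_absorbs (sqr_ge0 _) hp; rewrite e1 e2.
by [].
Qed.

Lemma ball_kernel_bound k (t : ptree (dbl k)) c :
  rooted_iso (nbhd G (inr c) (dbl k)) (tree_graph t) ->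
  v 0 c ^+ 2 <= colval R t * \sum_j v 0 j ^+ 2.
Proof.
move=> /tree_graph_embeds[A uA /embeds_kernel_bound].
rewrite /sq /= -normrX ger0_norm ?sqr_ge0 // => /le_trans; apply.
have c0 : 0 <= colval R t by case/andP: (colval_01 R t).
rewrite ler_wpM2l // big_uniq //= big_sumType /= big1 ?add0r => [|r _]; last first.
  by rewrite expr0n.
rewrite big_mkcond; apply: ler_sum => j _; case: ifP => _; last exact: sqr_ge0.
by rewrite -normrX ger0_norm ?sqr_ge0.
Qed.

End KernelBound.

(** * Messages on a matrix and the cover they define *)

Section Messages.
Variables (R : realType) (m n : nat) (M : 'M[R]_(m, n)) (b : bool).
Implicit Types (r : 'I_m) (c : 'I_n).

(** Messages are defined on the matrix itself, so that the resulting inequality for the rank holds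
    for every matrix; trees matter only for the average cost. *)
Fixpoint msg k c r : bool :=
  if k is k'.+1 then
    [forall r', (M r' c != 0) && (r' != r) ==>
       [exists c', [&& M r' c' != 0, c' != c & msg k' c' r']]]
  else b.

Arguments msg : simpl never.

Definition row_msg k r c := [exists c', [&& M r c' != 0, c' != c & msg k c' r]].

Lemma msgS k c r :
  msg k.+1 c r = [forall r', (M r' c != 0) && (r' != r) ==> row_msg k r' c].
Proof. by []. Qed.

(** The recursion is monotone and starts from the largest or the smallest configuration. *)
Lemma msg_mono k c r : if b then msg k.+1 c r ==> msg k c r else msg k c r ==> msg k.+1 c r.
Proof.
have mono k' : (forall c r, msg k'.+1 c r ==> msg k' c r) ->
    forall c r, msg k'.+2 c r ==> msg k'.+1 c r.
  move=> H c' r'; apply/implyP; rewrite msgS (msgS k') => /forallP h.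
  apply/forallP => s; apply/implyP => hs.
  have := implyP (h s) hs => /existsP[d /and3P[d1 d2 d3]].
  by apply/existsP; exists d; rewrite d1 d2 (implyP (H d s) d3).
have mono' k' : (forall c r, msg k' c r ==> msg k'.+1 c r) ->
    forall c r, msg k'.+1 c r ==> msg k'.+2 c r.
  move=> H c' r'; apply/implyP; rewrite msgS (msgS k'.+1) => /forallP h.
  apply/forallP => s; apply/implyP => hs.
  have := implyP (h s) hs => /existsP[d /and3P[d1 d2 d3]].
  by apply/existsP; exists d; rewrite d1 d2 (implyP (H d s) d3).
case: (boolP b) => B.
  elim: k c r => [|k IH] c r; last exact: mono.
  by rewrite [msg 0 c r]B implybT.
elim: k c r => [|k IH] c r; last exact: mono'.
by rewrite [msg 0 c r](negbTE B).
Qed.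

Definition kept_level k := if b then k.+1 else k.
Definition kept k c := [forall r, (M r c != 0) ==> row_msg (kept_level k) r c].
Definition pos k r := [set c | (M r c != 0) && msg k.+1 c r].

(* A row adjacent to a kept column receives two positive messages: one from
   that column, and one certifying that the column is kept. *)
Lemma kept_pos k r c : M r c != 0 -> kept k c -> (1 < #|pos k r|)%N.
Proof.
move=> Mrc /forallP h.
have up : forall c' r', msg (kept_level k) c' r' -> msg k.+1 c' r'.
  rewrite /kept_level => c' r'; case: ifP => // B.
  by have := msg_mono k c' r'; rewrite B => /implyP.
have down : forall c' r', msg (kept_level k) c' r' -> msg k c' r'.
  rewrite /kept_level => c' r'; case: ifP => // B.
  by have := msg_mono k c' r'; rewrite B => /implyP.
have /existsP[c' /and3P[m1 m2 m3]] := implyP (h r) Mrc.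
have c'P : c' \in pos k r by rewrite inE m1 up.
have cP : c \in pos k r.
  rewrite inE Mrc msgS; apply/forallP => r'; apply/implyP => /andP[a1 a2].
  have /existsP[d /and3P[d1 d2 d3]] := implyP (h r') a1.
  by apply/existsP; exists d; rewrite d1 d2 down.
rewrite (cardsD1 c) cP (cardsD1 c') in_setD1 m2 c'P.
by [].
Qed.

Variables (k D : nat).

Definition col_deg c := #|[set r | M r c != 0]|.

(** The transfer from trees needs a cost bounded on all columns, also on those whose ball is not
    listed. So [bounded_cost] relieves columns of degree above D + 1 of their part of the rows, and
    to compensate no kept column may share a row with such a column. *)
Definition kept_bounded c := kept k c &&
  [forall r, forall c', (M r c != 0) && (M r c' != 0) ==> (col_deg c' <= D.+1)%N].

Definition col_cost c : R :=
  \sum_(r | M r c != 0) (msg k.+1 c r && (1 < #|pos k r|)%N)%:R / #|pos k r|%:R.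

Definition bounded_cost c : R := (col_deg c <= D.+1)%N%:R * col_cost c.

Definition local_cost c : R := 1 - (kept_bounded c)%:R + bounded_cost c.

Lemma col_cost_ge0 c : 0 <= col_cost c.
Proof. by apply: sumr_ge0 => r _; rewrite divr_ge0. Qed.

Lemma bounded_cost_le c : bounded_cost c <= D.+1%:R.
Proof.
rewrite /bounded_cost; case: leqP => h; last by rewrite mul0r.
rewrite mul1r; apply: (@le_trans _ _ (col_deg c)%:R); last by rewrite ler_nat.
rewrite /col_cost /col_deg -sum1dep_card natr_sum; apply: ler_sum => r _.
case: (ltnP 1 #|pos k r|) => h2; last by rewrite andbF mul0r.
have h3 : 0 < #|pos k r|%:R :> R by rewrite ltr0n; apply: ltn_trans h2.
by rewrite ler_pdivrMr // mul1r; case: msg; rewrite // ler_nat ltnW.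
Qed.

Lemma local_cost_le c : local_cost c <= D.+2%:R.
Proof.
rewrite -natr1 addrC lerD ?bounded_cost_le //.
Qed.

(** Each row adjacent to a kept column splits its unit cost evenly among the senders of its positive
    messages, of which there are at least two. By the choice of [kept_bounded] all these senders
    have bounded degree, so none of their parts was dropped. *)
Lemma rank_le_local_cost : (\rank M)%:R <= \sum_c local_cost c.
Proof.
pose B := [set c | kept_bounded c].
pose N := [set r | [exists c in B, M r c != 0]].
have h : (\rank M)%:R <= #|~: B|%:R + #|N|%:R :> R.
  by rewrite -natrD ler_nat; exact: rank_le_cover.
apply: le_trans h _; rewrite /local_cost big_split /= lerD //.
  rewrite -sum1_card natr_sum big_mkcond /=; apply: ler_sum => c _.
  by rewrite !inE; case: kept_bounded; rewrite ?subrr ?subr0.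
have term r c : r \in N -> M r c != 0 -> (col_deg c <= D.+1)%N /\ (1 < #|pos k r|)%N.
  rewrite inE => /existsP[c' /andP[]]; rewrite inE => /andP[kc /forallP bd] Mc' Mc.
  split; last exact: kept_pos Mc' kc.
  by have := implyP (forallP (bd r) c); rewrite Mc' Mc; apply.
have -> : #|N|%:R = \sum_(r in N) \sum_(c in pos k r) (#|pos k r|%:R)^-1 :> R.
  rewrite -sum1_card natr_sum; apply: eq_bigr => r rN.
  rewrite sumr_const -[RHS]mulr_natl mulfV //.
  have : [exists c in B, M r c != 0] by rewrite inE in rN.
  move=> /existsP[c /andP[_ Mc]].
  by have [_ p] := term _ _ rN Mc; rewrite pnatr_eq0 -lt0n; apply: ltn_trans p.
rewrite (exchange_big_dep predT) //=; apply: ler_sum => c _.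
rewrite /bounded_cost /col_cost mulr_sumr.
rewrite big_mkcond [leRHS]big_mkcond /=; apply: ler_sum => r _.
case: ifP => [/andP[rN]|_].
  rewrite inE => /andP[Mc mc]; rewrite Mc mc /=.
  by have [-> ->] := term _ _ rN Mc; rewrite mul1r mul1r.
by case: ifP => // _; rewrite mulr_ge0 // divr_ge0.
Qed.

End Messages.

(** * Messages on balls that are trees *)

Section TreeMessages.
Variables (R : realType) (M : fmatrix R) (b : bool).
Let G := tanner_graph M.
Let V := tanner_vertex M.

Lemma Forall2_map (A B C : Type) (f : A -> C) (g : B -> C) (P : A -> B -> Prop) s t :
  List.Forall2 P s t -> (forall a c, P a c -> f a = g c) -> map f s = map g t.
Proof. by move=> + H; elim=> //= a c s' t' /H -> _ ->. Qed.

Lemma Forall2_impl_in (A : Type) (B : eqType) (P Q : A -> B -> Prop) s t :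
  List.Forall2 P s t -> (forall a c, c \in t -> P a c -> Q a c) -> List.Forall2 Q s t.
Proof.
elim=> [|a c s' t' h F IH] H; constructor.
  by apply: H => //; rewrite inE eqxx.
by apply: IH => a' c' ct; apply: H; rewrite inE ct orbT.
Qed.

Definition vmsg k (y x : V) : bool :=
  match y, x with inr c, inl r => msg (mx M) b k c r | _, _ => false end.

Definition vrow_msg k (y x : V) : bool :=
  match y, x with inl r, inr c => row_msg (mx M) b k r c | _, _ => false end.

(** Stated for an arbitrary [f], as it serves the old, the new and the kept messages. The children
    of a row are all its columns except the parent. *)
Lemma embeds_row K (f : ptree K -> bool) k (ts : seq (ptree K)) r c A :
  (forall t B c', embeds G t (pred1 (inl r)) (inr c') B -> f t = msg (mx M) b k c' r) ->
  embeds G (ts : ptree K.+1) (pred1 (inr c)) (inl r) A ->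
  has f ts = row_msg (mx M) b k r c /\
  count f ts = #|[set c' | [&& mx M r c' != 0, c' != c & msg (mx M) b k c' r]]|.
Proof.
move=> H [cs [_ ucs csP F2]].
have mem y : y \in unzip1 cs = if y is inr c' then (mx M r c' != 0) && (c' != c) else false.
  apply/idP/idP => [/csP[]|].
    case: y => //= c' /eqP -> /=; apply: contra => /eqP ->; exact/eqP.
  by case: y => // c' /andP[/eqP h1 h2]; apply/csP; split => //=.
have E : map f ts = map (vmsg k ^~ (inl r)) (unzip1 cs).
  rewrite -map_comp.
  apply: (Forall2_map (Forall2_impl_in F2 _) (fun a c (h : f a = vmsg k c.1 (inl r)) => h)).
  move=> t [y B] yin /=; have : y \in unzip1 cs by exact: (map_f fst yin).
  by rewrite mem; case: y {yin} => // c' _ /H.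
have Ec : count f ts = #|[set c' | [&& mx M r c' != 0, c' != c & msg (mx M) b k c' r]]|.
  rewrite -[LHS](count_map f idfun) E count_map -size_filter.
  rewrite -(card_uniqP (filter_uniq _ ucs)) -(card_imset _ (@inr_inj 'I_(nrows M) 'I_(ncols M))).
  apply: eq_card => y; rewrite mem_filter mem; apply/idP/imsetP.
    by case: y => [r'|c'] /=; rewrite ?andbF // => /and3P[h1 h2 h3]; exists c'; rewrite // inE h2 h3.
  by move=> [c']; rewrite inE => /and3P[h1 h2 h3] -> /=; rewrite h1 h2 h3.
split => //; rewrite has_count Ec card_gt0; apply/set0Pn/existsP => -[c' h].
  by exists c'; rewrite inE in h.
by exists c'; rewrite inE.
Qed.

Lemma embeds_msg k (t : ptree (dbl k)) r c A :
  embeds G t (pred1 (inl r)) (inr c) A -> colmsg b t = msg (mx M) b k c r.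
Proof.
elim: k t r c A => [//|k IH] t r c A [cs [_ ucs csP F2]].
have mem y : y \in unzip1 cs = if y is inl r' then (mx M r' c != 0) && (r' != r) else false.
  apply/idP/idP => [/csP[]|].
    case: y => //= r' /eqP -> /=; apply: contra => /eqP ->; exact/eqP.
  case: y => // r' /andP[/eqP h1 h2]; apply/csP; split => //=.
have E : map (has (@colmsg b k)) (t : seq (seq (ptree (dbl k)))) =
    map (fun cy : V * seq V => vrow_msg k cy.1 (inr c)) cs.
  apply: (Forall2_map (Forall2_impl_in F2 _)
     (fun a cy (h : has (@colmsg b k) a = vrow_msg k cy.1 (inr c)) => h)).
  move=> ts [y B] yin /=; have : y \in unzip1 cs by exact: (map_f fst yin).
  rewrite mem; case: y {yin} => // r' _ h.
  by have [] := embeds_row (fun t A c' => IH t r' c' A) h.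
have -> : colmsg b t = all idfun (map (has (@colmsg b k)) (t : seq (seq (ptree (dbl k))))).
  by rewrite all_map.
rewrite E all_map msgS; apply/allP/forallP => [h r'|h [y B] yin] /=.
  apply/implyP => hr; have : inl r' \in unzip1 cs by rewrite mem.
  by move=> /mapP[[y B] yin /= e]; have := h _ yin; rewrite /= -e.
have : y \in unzip1 cs by exact: (map_f fst yin).
by rewrite mem; case: y {yin} => // r' /(implyP (h r')).
Qed.

Lemma embeds_prune K (t : ptree K.+1) ex v A :
  embeds G t ex v A -> exists A', embeds G (prune t) ex v A'.
Proof.
elim: K t ex v A => [|K IH] t ex v A; first by exists [:: v].
move=> [cs [_ ucs csP F2]].
have [cs' [e F2']] : exists cs' : seq (V * seq V), unzip1 cs' = unzip1 cs /\
    List.Forall2 (fun t c => embeds G t (pred1 v) c.1 c.2) (map (@prune K) t) cs'.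
  elim: F2 => [|s [y B] t' cs0 /= h F2 [cs' [e IH2]]]; first by exists [::]; split.
  have [B' hB'] := IH _ _ _ _ h.
  by exists ((y, B') :: cs'); split; [rewrite /= e | constructor].
by exists (v :: flatten (unzip2 cs')); exists cs'; split => //; rewrite e.
Qed.

Lemma embeds_old_msg k (t : ptree (dbl k.+1)) r c A :
  embeds G t (pred1 (inl r)) (inr c) A -> colmsg b (prune2 t) = msg (mx M) b k c r.
Proof. by move=> /embeds_prune[A1 /embeds_prune[A2 /embeds_msg]]. Qed.

Lemma picks_uniq (T : eqType) (P : pred T) (s : seq T) : uniq s ->
  all (fun p => all P p.2 == all (fun y => (y != p.1) ==> P y) s) (picks s).
Proof.
elim: s => //= x s IH /andP[xs us]; rewrite eqxx /=; apply/andP; split.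
  apply/eqP; apply: eq_in_all => y ys.
  by have -> : y != x by apply: contraNneq xs => <-.
rewrite all_map; have /allP h := IH us; apply/allP => p pin /=.
have p1s : p.1 \in s.
  have -> : s = map fst (picks s) by elim: (s) => //= y s' {1}->; rewrite -map_comp.
  exact: map_f.
rewrite (eqP (h _ pin)).
by have -> : x != p.1 by apply: contraNneq xs => ->.
Qed.

Lemma Forall2_mem (A B : eqType) (P : A -> B -> Prop) s t y : List.Forall2 P s t ->
  y \in t -> exists2 x, x \in s & P x y.
Proof.
elim=> // a c s' t' h F IH; rewrite inE => /predU1P[->|/IH[x xs hx]].
  by exists a; rewrite ?inE ?eqxx.
by exists x; rewrite // inE xs orbT.
Qed.

Lemma embeds_deg K (s : ptree K.+1) (ex : pred V) (x0 : V) c B :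
  (forall y, ex y -> y = x0) ->
  embeds G s ex (inr c) B -> (col_deg (mx M) c <= (size (s : seq (ptree K))).+1)%N.
Proof.
move=> exP [cs [_ ucs csP F2]].
have -> : size (s : seq (ptree K)) = size (unzip1 cs).
  by elim: F2 => //= t cy s' cs' _ _ ->.
rewrite -[_.+1]/(size (x0 :: unzip1 cs)) /col_deg -(card_imset _ (@inl_inj 'I_(nrows M) 'I_(ncols M))).
apply: leq_trans (card_size _); apply: subset_leq_card; apply/fintype.subsetP => y.
move=> /imsetP[r]; rewrite inE => Mr ->; rewrite inE.
case: (boolP (ex (inl r))) => [/exP ->|h]; first by rewrite eqxx.
by apply/orP; right; apply/csP; split => //; exact/eqP.
Qed.

Lemma embeds_deg0 K (s : ptree K.+1) c B :
  embeds G s pred0 (inr c) B -> (col_deg (mx M) c <= size (s : seq (ptree K)))%N.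
Proof.
move=> [cs [_ ucs csP F2]].
have -> : size (s : seq (ptree K)) = size (unzip1 cs).
  by elim: F2 => //= t cy s' cs' _ _ ->.
rewrite /col_deg -(card_imset _ (@inl_inj 'I_(nrows M) 'I_(ncols M))).
apply: leq_trans (card_size _); apply: subset_leq_card; apply/fintype.subsetP => y.
move=> /imsetP[r]; rewrite inE => Mr ->.
by apply/csP; split => //; exact/eqP.
Qed.

Lemma mem_lists (T : eqType) (L : seq T) k ts :
  ts \in lists L k = (size ts == k) && all (mem L) ts.
Proof.
elim: k ts => [|k IH] ts; first by rewrite mem_seq1; case: ts.
apply/allpairsPdep/idP => [[t [s [tL sL ->]]] /=|].
  by move: sL; rewrite IH eqSS => /andP[-> ->]; rewrite andbT.
case: ts => // t ts /andP[sz /= /andP[tL tsL]].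
by exists t, ts; split => //; rewrite IH -eqSS sz.
Qed.

Lemma mem_trees D K (t : ptree K.+1) :
  t \in trees D K.+1 = (size (t : seq (ptree K)) <= D)%N && all (mem (trees D K)) (t : seq (ptree K)).
Proof.
apply/flatten_mapP/idP => [[k]|/andP[sz h]].
  by rewrite mem_iota ltnS mem_lists => kD /andP[/eqP -> ->]; rewrite andbT.
by exists (size (t : seq (ptree K))); rewrite ?mem_iota ?ltnS // mem_lists eqxx.
Qed.

(** A message of level k + 1 sent by a column at distance 2 needs 2(k + 1) further generations,
    whence the radius 2(k + 2). With at most [D] children per vertex, the columns within distance 2
    have degree at most D + 1, the extra 1 being the parent row, so the degree condition in
    [kept_bounded] is automatic. *)
Lemma ball_local_cost k D (t : ptree (dbl k.+2)) c :
  t \in trees D (dbl k.+2) ->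
  rooted_iso (nbhd G (inr c) (dbl k.+2)) (tree_graph t) ->
  local_cost (mx M) b k D c <= cover_cost R b t.
Proof.
move=> tD /tree_graph_embeds[A _ emb].
have degc := embeds_deg0 emb.
case: emb => cs [_ ucs csP F2].
have mem y : y \in unzip1 cs = if y is inl r then mx M r c != 0 else false.
  apply/idP/idP => [/csP[]|]; first by case: y => //= r /eqP.
  by case: y => // r /eqP h; apply/csP.
pose cnt r := #|[set c' | [&& mx M r c' != 0, c' != c & msg (mx M) b k.+1 c' r]]|.
pose P0 (y : V) := vrow_msg (kept_level b k) y (inr c).
pose P1 (y : V) := vrow_msg k y (inr c).
pose P2 (y : V) : R := if y is inl r then (0 < cnt r)%N%:R / (1 + (cnt r)%:R) else 0.
pose old (s : ptree (dbl k.+1)) := colmsg b (prune2 s).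
pose new (s : ptree (dbl k.+1)) := colmsg b s.
(* A single equality of lists carries all three statistics of each row, so that [picks] can be
   transported along it. *)
have E : [seq (has (@kept_msg b k) ts, (has old ts, @row_cost R b k ts)) | ts <- (t : seq (seq (ptree (dbl k.+1))))]
   = [seq (P0 y, (P1 y, P2 y)) | y <- unzip1 cs].
  rewrite -map_comp.
  apply: (Forall2_map (Forall2_impl_in F2 _)
     (fun ts cy (h : (has (@kept_msg b k) ts, (has old ts, @row_cost R b k ts))
          = (P0 cy.1, (P1 cy.1, P2 cy.1))) => h)).
  move=> ts [y B] yin /=; have : y \in unzip1 cs by exact: (map_f fst yin).
  rewrite mem; case: y {yin} => // r _ h.
  have [h1 _] := embeds_row (f := old) (fun t A c' h => embeds_old_msg h) h.
  have [h2 h3] := embeds_row (f := new) (fun t A c' h => embeds_msg h) h.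
  have keptP s B' c' : embeds G s (pred1 (inl r)) (inr c') B' ->
      @kept_msg b k s = msg (mx M) b (kept_level b k) c' r.
    move=> hs; move: (embeds_msg hs) (embeds_old_msg hs).
    by rewrite /kept_msg /kept_level; case: (b).
  have [h4 _] := embeds_row keptP h.
  have ec : cnt r = count new ts by rewrite h3.
  by rewrite h4 h1 /P0 /P1 /P2 /= ec -has_count.
have keptE : all (has (@kept_msg b k)) (t : seq (seq (ptree (dbl k.+1)))) = kept (mx M) b k c.
  transitivity (all fst [seq (has (@kept_msg b k) ts, (has old ts, @row_cost R b k ts))
     | ts <- (t : seq (seq (ptree (dbl k.+1))))]); first by rewrite all_map.
  rewrite E all_map; apply/allP/forallP => [h r|h y].
    by apply/implyP => Mr; apply: (h (inl r)); rewrite mem.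
  by rewrite mem; case: y => // r /(implyP (h r)).
have degs : forall r c', mx M r c != 0 -> mx M r c' != 0 -> (col_deg (mx M) c' <= D.+1)%N.
  move=> r c' Mrc Mrc'; move: tD; rewrite mem_trees => /andP[sz tD].
  have [->|cc'] := eqVneq c' c; first by apply: leq_trans degc _; exact: leqW.
  have : inl r \in unzip1 cs by rewrite mem.
  move=> /mapP[[y B] /= yin ey]; rewrite -ey in yin.
  have [ts tsin /= hts] := Forall2_mem F2 yin.
  have : ts \in trees D (dbl k.+1).+1 := allP tD _ tsin.
  rewrite mem_trees => /andP[_ tsD].
  case: hts => ds [_ uds dsP F3].
  have : inr c' \in unzip1 ds by apply/dsP; split; [exact/eqP | apply: contra cc' => /eqP[->]].
  move=> /mapP[[z B'] /= zin ez]; rewrite -ez in zin.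
  have [s sin /= hs] := Forall2_mem F3 zin.
  have sD : (size (s : seq (ptree (dbl k).+1)) <= D)%N.
    by have := allP tsD _ sin; case/(etrans (esym (mem_trees D (s : ptree (dbl k).+2))))/andP.
  apply: (leq_trans (@embeds_deg (dbl k).+1 s (pred1 (inl r)) (inl r) c' B' _ hs)).
    by move=> z' /eqP.
  by rewrite ltnS.
have keptB : kept_bounded (mx M) b k D c = kept (mx M) b k c.
  rewrite /kept_bounded; suff -> : [forall r, forall c', (mx M r c != 0) &&
     (mx M r c' != 0) ==> (col_deg (mx M) c' <= D.+1)%N] by rewrite andbT.
  by apply/forallP => r; apply/forallP => c'; apply/implyP => /andP[]; exact: degs.
rewrite /local_cost keptB.
rewrite /cover_cost keptE lerD2l.
apply: (@le_trans _ _ (col_cost (mx M) b k c)).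
  rewrite /bounded_cost; case: leqP => _; rewrite ?mul1r ?mul0r //.
  exact: col_cost_ge0.
have msgE r : mx M r c != 0 -> msg (mx M) b k.+1 c r =
    all (fun y => (y != inl r) ==> P1 y) (unzip1 cs).
  move=> Mr; rewrite msgS; apply/forallP/allP => [h y|h r'].
    rewrite mem; case: y => // r' Mr'; apply/implyP => ne.
    by apply: (implyP (h r')); rewrite Mr'; apply: contra ne => /eqP->.
  apply/implyP => /andP[Mr' ne]; have := h (inl r'); rewrite mem => /(_ Mr')/implyP; apply.
  by apply: contra ne => /eqP[->].
have costE r : mx M r c != 0 ->
    (msg (mx M) b k.+1 c r && (1 < #|pos (mx M) b k r|)%N)%:R / #|pos (mx M) b k r|%:R =
    (msg (mx M) b k.+1 c r)%:R * P2 (inl r).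
  move=> Mr; case: (boolP (msg _ _ _ _ _)) => h /=; last by rewrite !mul0r.
  (* The column [c] is itself one of the senders, which is the 1 in the denominator of
     [row_cost]. *)
  have -> : #|pos (mx M) b k r| = (cnt r).+1.
    rewrite (cardsD1 c) inE Mr h add1n /cnt; congr _.+1; apply: eq_card => c'.
    by rewrite !inE; case: (c' == c); rewrite ?andbF.
  by rewrite ltnS mul1r -natr1 addrC.
rewrite /col_cost; under eq_bigr => r Mr do rewrite costE // msgE //.
rewrite le_eqVlt; apply/orP; left; apply/eqP.
transitivity (\sum_(y <- unzip1 cs)
   (all (fun z => (z != y) ==> P1 z) (unzip1 cs))%:R * P2 y).
  rewrite big_uniq //= big_sumType /= [X in _ = _ + X]big1 ?addr0 => [|i _]; last by rewrite mulr0.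
  by apply: eq_bigl => r; rewrite mem.
rewrite -(sum_picks (fun y => (all (fun z => (z != y) ==> P1 z) (unzip1 cs))%:R * P2 y)).
transitivity (\sum_(p <- picks (unzip1 cs)) (all P1 p.2)%:R * P2 p.1).
  by apply: esym; apply: (eq_big_all (picks_uniq P1 ucs)) => p /eqP ->.
move: E; set ys := unzip1 cs => E; clearbody ys.
have := congr1 (fun s => \sum_(p <- picks s) (all (fun q => q.2.1) p.2)%:R * p.1.2.2) E.
rewrite !picks_map !big_map /= => e.
transitivity (\sum_(p <- picks ys)
    (all (fun q => q.2.1) [seq (P0 y, (P1 y, P2 y)) | y <- p.2])%:R * P2 p.1).
  by apply: eq_bigr => p _; rewrite all_map.
by rewrite -e; apply: eq_bigr => p _; rewrite all_map.
Qed.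

End TreeMessages.

Local Open Scope classical_set_scope.
Local Open Scope ring_scope.

(** * Generating functions *)

Section SeriesAux.
Variable R : realType.
Implicit Type u : nat -> R.

Lemma seriesE u n : series u n = \sum_(i < n) u i.
Proof. by rewrite /series /= big_mkord. Qed.

Lemma sum_ord_split u D n : (D <= n)%N ->
  \sum_(i < n) u i = \sum_(i < D) u i + \sum_(i < n - D) u (D + i)%N.
Proof.
move=> Dn; rewrite -[in LHS](subnKC Dn); move: (n - D)%N => k.
by rewrite big_split_ord.
Qed.

Lemma nneg_series_le_lim u n : (forall i, 0 <= u i) -> cvgn (series u) ->
  \sum_(i < n) u i <= limn (series u).
Proof.
move=> u0 cu; rewrite -seriesE; apply: nondecreasing_cvgn_le => //.
by apply: nondecreasing_series => i _ _.
Qed.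

Lemma nneg_series_bounded u (M : R) : (forall i, 0 <= u i) ->
  (forall n, \sum_(i < n) u i <= M) ->
  cvgn (series u) /\ limn (series u) <= M.
Proof.
move=> u0 uM; have c : cvgn (series u).
  apply: nondecreasing_is_cvgn; first by apply: nondecreasing_series => i _ _.
  by exists M => _ [n _ <-]; rewrite seriesE.
by split=> //; apply: limr_le => //; apply: nearW => n; rewrite seriesE.
Qed.

End SeriesAux.

Section FiniteMean.
Variables (R : realType) (l : nat -> R).

Definition finite_mean_law :=
  is_distribution l /\ cvgn (series (fun i => i%:R * l i)).

Hypothesis l_law : finite_mean_law.

Let l0 i : 0 <= l i. Proof. by case: l_law => -[]. Qed.
Let il0 i : 0 <= i%:R * l i. Proof. by rewrite mulr_ge0. Qed.
Let c1 : cvgn (series l).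
Proof. by case: l_law => -[_ c] _; apply/cvg_ex; exists 1. Qed.
Let lim1 : limn (series l) = 1.
Proof. by case: l_law => -[_ c] _; apply/cvg_lim. Qed.
Let cm : cvgn (series (fun i => i%:R * l i)). Proof. by case: l_law. Qed.

Lemma tail_ge0 N : 0 <= tail l N.
Proof. by rewrite subr_ge0 -lim1; apply: nneg_series_le_lim. Qed.

Lemma finite_mean_sublaw : sublaw l.
Proof. by split => // N; exact: tail_ge0. Qed.

Lemma tail_cvg0 : tail l @ \oo --> (0 : R).
Proof.
have -> : tail l = (fun N => 1 - series l N).
  by apply/funext => n; rewrite seriesE.
rewrite -(subrr (1 : R)); case: l_law => -[_ c] _.
exact: (cvgB (cvg_cst _) c).
Qed.

Lemma mean_ge0 : 0 <= mean l.
Proof. by apply: le_trans (nneg_series_le_lim 0 il0 cm); rewrite big_ord0. Qed.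

Lemma partial_mean_le N : \sum_(n < N) l n * n%:R <= mean l.
Proof.
apply: le_trans (nneg_series_le_lim N il0 cm).
by apply: ler_sum => i _; rewrite mulrC.
Qed.

(** Markov's inequality on the event that the variable is at least [N]; the right-hand side is the
    tail of the mean, so [N] times the tail tends to 0. *)
Lemma tail_mul_le N : N%:R * tail l N <= mean l - \sum_(n < N) l n * n%:R.
Proof.
have h M : \sum_(n < M) l n * N%:R - \sum_(n < N) l n * N%:R <= mean l - \sum_(n < N) l n * n%:R.
  case: (leqP M N) => [MN|/ltnW NM].
    apply: (@le_trans _ _ 0); last by rewrite subr_ge0 partial_mean_le.
    rewrite subr_le0 -(subnKC MN) big_split_ord /= lerDl.
    by rewrite sumr_ge0 // => i _; rewrite mulr_ge0.
  apply: le_trans (_ : _ <= \sum_(n < M) l n * n%:R - \sum_(n < N) l n * n%:R) _.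
    rewrite -(subnKC NM) !big_split_ord /= addrAC subrr add0r [leRHS]addrAC subrr add0r.
    apply: ler_sum => i _; rewrite ler_wpM2l // ler_nat leq_addr //.
  by rewrite lerD2r partial_mean_le.
rewrite /tail mulrBr mulr1 mulr_sumr.
suff : N%:R <= mean l - \sum_(n < N) l n * n%:R + \sum_(n < N) l n * N%:R.
  rewrite -(eq_bigr _ (fun (i : 'I_N) _ => mulrC (l i) N%:R)); lra.
have c : (fun M => N%:R * series l M) @ \oo --> N%:R * (1 : R).
  by apply: cvgM; [exact: cvg_cst | case: l_law => -[]].
rewrite -[leLHS]mulr1; apply: (cvgr_to_le c); apply: nearW => M.
have := h M; rewrite seriesE mulr_sumr.
by rewrite -(eq_bigr _ (fun (i : 'I_M) _ => mulrC (l i) N%:R)); lra.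
Qed.

Lemma tail_mul_cvg0 : (fun N => N%:R * tail l N) @ \oo --> (0 : R).
Proof.
apply: (@squeeze_cvgr _ _ _ _ (fun=> 0) (fun N => mean l - \sum_(n < N) l n * n%:R)).
- by apply: nearW => N; rewrite mulr_ge0 ?tail_ge0 //= tail_mul_le.
- exact: cvg_cst.
have c : (fun N => \sum_(n < N) l n * n%:R) @ \oo --> mean l.
  suff -> : (fun N => \sum_(n < N) l n * n%:R) = series (fun i => i%:R * l i) by [].
  by apply/funext => n; rewrite seriesE; apply: eq_bigr => i _; rewrite mulrC.
by rewrite -[X in _ --> X](subrr (mean l)); exact: (cvgB (cvg_cst _) c).
Qed.

Definition trunc_pgf D t := \sum_(n < D.+1) trunc_law D l n * t ^+ n.

Section Pgf.
Variable t : R.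
Hypothesis t01 : 0 <= t <= 1.
Let lt0 i : 0 <= l i * t ^+ i.
Proof. by case/andP: t01 => a b; rewrite mulr_ge0 // exprn_ge0. Qed.
Let lt1 i : l i * t ^+ i <= l i.
Proof. by case/andP: t01 => a b; rewrite ler_piMr // exprn_ile1. Qed.

Let pgf_tail D n : \sum_(i < n) l i * t ^+ i <= \sum_(i < D) l i * t ^+ i + tail l D.
Proof.
case: (leqP n D) => [nD|/ltnW Dn].
  rewrite -(subnKC nD) big_split_ord /= -addrA lerDl addr_ge0 ?tail_ge0 //.
  by rewrite sumr_ge0.
rewrite (sum_ord_split (fun i => l i * t ^+ i) Dn) lerD2l.
have := tail_ge0 n; rewrite /tail (sum_ord_split l Dn) => h.
apply: (@le_trans _ _ (\sum_(i < n - D) l (D + i)%N)); last lra.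
exact: ler_sum.
Qed.

Lemma pgf_cvg : cvgn (series (fun i => l i * t ^+ i)).
Proof.
have [] // := @nneg_series_bounded _ _ (\sum_(i < 0) l i * t ^+ i + tail l 0) lt0.
Qed.

(** The moved mass sits at exponent 0, where the power is 1, so truncation can only raise the value,
    by at most the mass beyond [D]. *)
Lemma trunc_pgf_bounds D : 0 <= trunc_pgf D t - pgf l t <= tail l D.+1.
Proof.
rewrite /trunc_pgf sum_trunc_lawE expr0 mulr1.
have h1 := nneg_series_le_lim D.+1 lt0 pgf_cvg.
have [_ h2] := nneg_series_bounded lt0 (pgf_tail D.+1).
by rewrite /pgf; apply/andP; split; lra.
Qed.

Lemma pgf_01 : 0 <= pgf l t <= 1.
Proof.
have h1 := nneg_series_le_lim 0 lt0 pgf_cvg.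
have [_ h2] := nneg_series_bounded lt0 (pgf_tail 0).
by move: h1 h2; rewrite /tail !big_ord0 /pgf subr0 add0r => -> ->.
Qed.

Lemma trunc_pgf_01 D : 0 <= trunc_pgf D t <= 1.
Proof.
have [t0 t1] := andP t01.
have h n := trunc_law_ge0 D n finite_mean_sublaw.
rewrite sumr_ge0 => [|n _]; last by rewrite mulr_ge0 // exprn_ge0.
rewrite -(sum_trunc_law l D) ler_sum // => n _.
by rewrite ler_piMr // exprn_ile1.
Qed.

End Pgf.

Lemma exprB_le (a b : R) n : 0 <= b <= a -> a <= 1 -> a ^+ n - b ^+ n <= n%:R * (a - b).
Proof.
move=> /andP[b0 ba] a1; rewrite subrXX mulrC ler_wpM2r ?subr_ge0 //.
rewrite -[n in n%:R]card_ord -sumr_const ler_sum // => i _.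
by rewrite mulr_ile1 ?exprn_ge0 ?exprn_ile1 //; lra.
Qed.

Lemma pgf_homo (a b : R) : 0 <= b -> b <= a -> a <= 1 ->
  0 <= pgf l a - pgf l b <= mean l * (a - b).
Proof.
move=> b0 ba a1; have a01 : 0 <= a <= 1 by apply/andP; split; lra.
have b01 : 0 <= b <= 1 by apply/andP; split; lra.
have lb i : 0 <= l i * b ^+ i by rewrite mulr_ge0 ?exprn_ge0.
have la i : 0 <= l i * a ^+ i by rewrite mulr_ge0 ?exprn_ge0 //; lra.
apply/andP; split; first rewrite subr_ge0.
  apply: (proj2 (nneg_series_bounded lb _)) => n.
  apply: le_trans (nneg_series_le_lim n la (pgf_cvg a01)).
  by apply: ler_sum => i _; rewrite ler_wpM2l // lerXn2r // nnegrE; lra.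
rewrite lerBlDl; apply: (proj2 (nneg_series_bounded la _)) => n.
have h1 := nneg_series_le_lim n lb (pgf_cvg b01).
have h2 := partial_mean_le n.
apply: (@le_trans _ _ (\sum_(i < n) l i * b ^+ i + (a - b) * \sum_(i < n) l i * i%:R)).
  rewrite mulr_sumr -big_split; apply: ler_sum => i _ /=.
  have := @exprB_le a b i _ a1; rewrite b0 ba => /(_ isT) h.
  have : l i * (a ^+ i - b ^+ i) <= l i * (i%:R * (a - b)) by rewrite ler_wpM2l.
  by lra.
rewrite lerD // mulrC ler_wpM2r // subr_ge0 //.
Qed.

Lemma pgf_lip (a b : R) : 0 <= a <= 1 -> 0 <= b <= 1 ->
  `|pgf l a - pgf l b| <= mean l * `|a - b|.
Proof.
wlog ba : a b / b <= a => [H a01 b01|].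
  by case: (leP b a) => [|/ltW] ab; [|rewrite distrC [`|a - b|]distrC]; apply: H.
move=> /andP[a0 a1] /andP[b0 b1].
have /andP[h1 h2] := pgf_homo b0 ba a1.
by rewrite ger0_norm // ger0_norm // subr_ge0.
Qed.

Lemma trunc_pgf_cvg (x : nat -> R) (y : R) : (forall D, 0 <= x D <= 1) -> 0 <= y <= 1 ->
  x @ \oo --> y -> (fun D => trunc_pgf D (x D)) @ \oo --> pgf l y.
Proof.
move=> x01 y01 xy.
have h D : `|trunc_pgf D (x D) - pgf l y| <= tail l D.+1 + mean l * `|x D - y|.
  apply: le_trans (ler_distD (pgf l (x D)) _ _) _.
  have /andP[h1 h2] := trunc_pgf_bounds (x01 D) D.
  by rewrite lerD ?pgf_lip // ger0_norm.
apply/cvgrPdist_le => e e0.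
have : (fun D => tail l D.+1 + mean l * `|x D - y|) @ \oo --> 0 + mean l * `|y - y|.
  apply: cvgD; first by have := tail_cvg0; rewrite -cvg_shiftS.
  by apply: cvgM; [exact: cvg_cst | apply: cvg_norm; apply: cvgB => //; exact: cvg_cst].
rewrite subrr normr0 mulr0 addr0 => /cvgrPdist_le/(_ _ e0).
apply: filterS => D; rewrite sub0r normrN => hD.
by rewrite distrC (le_trans (h D)) // (le_trans _ hD) // ler_norm.
Qed.

End FiniteMean.

Section SizeBiased.
Variables (R : realType) (mu : nat -> R).
Hypothesis mu_distr : is_distribution mu.
Hypothesis mu_moment : finite_second_moment mu.

Let mu0 i : 0 <= mu i. Proof. by case: mu_distr. Qed.

Lemma second_moment_finite_mean : finite_mean_law mu.
Proof.
split=> //; apply: (series_le_cvg _ _ _ mu_moment) => n.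
- by rewrite mulr_ge0.
- by rewrite mulr_ge0 // exprn_ge0.
- by rewrite ler_wpM2r // expr2 -natrM ler_nat; case: n => // n; rewrite leq_pmulr.
Qed.

Hypothesis mu_mean : 0 < mean mu.

Lemma size_biasedE n : n.+1%:R * mu n.+1 = mean mu * size_biased mu n.
Proof. by rewrite /size_biased !mulrA mulfV ?mul1r // lt0r_neq0. Qed.

Lemma size_biased_ge0 n : 0 <= size_biased mu n.
Proof. by rewrite /size_biased !mulr_ge0 ?invr_ge0 // ltW. Qed.

(** The mean of the size-biased law is controlled by the second moment: the sum of i(i+1) mu_(i+1)
    is at most that of i^2 mu_i. *)
Lemma size_biased_law : finite_mean_law (size_biased mu).
Proof.
have [_ cm] := second_moment_finite_mean.
split; first split; first exact: size_biased_ge0.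
  have -> : series (size_biased mu) =
      (fun n => (mean mu)^-1 * series (fun i => i%:R * mu i) n.+1).
    apply/funext => n; rewrite !seriesE big_ord_recl mul0r add0r mulr_sumr.
    by apply: eq_bigr => i _; rewrite /size_biased mulrA.
  have c : (fun n => series (fun i => i%:R * mu i) n.+1) @ \oo --> mean mu.
    by rewrite (@cvg_shiftS _ (series (fun i => i%:R * mu i))).
  by rewrite -[X in _ --> X](mulVf (lt0r_neq0 mu_mean)); exact: (cvgM (cvg_cst _) c).
have sq0 i : 0 <= i%:R ^+ 2 * mu i by rewrite mulr_ge0 ?exprn_ge0.
have [] // := @nneg_series_bounded _ (fun i => i%:R * size_biased mu i)
   ((mean mu)^-1 * limn (series (fun i => i%:R ^+ 2 * mu i))) _ _.
  by move=> i; rewrite mulr_ge0 ?size_biased_ge0.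
move=> n; apply: (@le_trans _ _ ((mean mu)^-1 * \sum_(i < n.+1) i%:R ^+ 2 * mu i)); last first.
  rewrite ler_pM2l ?invr_gt0 //; exact: (nneg_series_le_lim _ sq0).
rewrite big_ord_recl expr0n mul0r add0r mulr_sumr; apply: ler_sum => i _.
rewrite lift0 /size_biased -mulrA mulrCA ler_pM2l ?invr_gt0 // mulrA.
by rewrite ler_wpM2r // expr2 ler_wpM2r // ler_nat.
Qed.

End SizeBiased.

(** * Limits in the truncation and in the level *)

Section Model.
Variables (R : realType) (mu nu : nat -> R).
Hypotheses (mu_distr : is_distribution mu) (nu_distr : is_distribution nu).
Hypotheses (mu_moment : finite_second_moment mu) (nu_moment : finite_second_moment nu).
Hypotheses (mu_mean : 0 < mean mu) (nu_mean : 0 < mean nu).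

Notation mu' := (size_biased mu).
Notation nu' := (size_biased nu).
Notation mbar := (mean mu).
Notation nbar := (mean nu).

Let mu_law := second_moment_finite_mean mu_distr mu_moment.
Let nu_law := second_moment_finite_mean nu_distr nu_moment.
Let mu'_law := size_biased_law mu_distr mu_moment mu_mean.
Let nu'_law := size_biased_law nu_distr nu_moment nu_mean.

Lemma sum_one_minus D (y : R) :
  \sum_(n < D.+1) nu n * (1 - y ^+ n) = 1 - trunc_pgf nu D y.
Proof.
rewrite -[X in _ = X - _](sum_trunc_law nu D) -sumrB !big_ord_recl.
congr (_ + _); first by rewrite /= !expr0; ring.
by apply: eq_bigr => i _; rewrite lift0 /=; ring.
Qed.

Lemma one_minus_01 (t : R) : 0 <= t <= 1 -> 0 <= 1 - t <= 1.
Proof. by move=> /andP[a b]; apply/andP; split; lra. Qed.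

(** The errors of truncating [mu], of truncating [nu'] inside the generating function of [mu] and
    again in the last term of [Lambda], and of truncating [nu]. *)
Definition Lambda_err D :=
  tail mu D.+1 + mbar * tail nu' D.+1 * 2 + mbar / nbar * tail nu D.+1.

(** The error is uniform in [p], which is found only after [D] is fixed. *)
Lemma trunc_Lambda_le D p : 0 <= p <= 1 ->
  trunc_Lambda D mu nu nu' mbar nbar p <= Lambda mu nu p + Lambda_err D.
Proof.
move=> p01; rewrite /trunc_Lambda /Lambda /Lambda_err sum_one_minus.
rewrite -!/(trunc_pgf _ _ _).
have q01 := one_minus_01 p01.
have /andP[a0 a1] := trunc_pgf_bounds nu'_law q01 D.
have /andP[b0 b1] := trunc_pgf_bounds nu_law q01 D.
have r01 := one_minus_01 (trunc_pgf_01 nu'_law q01 D).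
have s01 := one_minus_01 (pgf_01 nu'_law q01).
have /andP[c0 c1] := trunc_pgf_bounds mu_law r01 D.
have d := pgf_lip mu_law r01 s01.
set A := trunc_pgf nu' D (1 - p) in a0 a1 r01 c0 c1 d *.
set B := pgf nu' (1 - p) in a0 a1 s01 c0 c1 d *.
have eAB : `|1 - A - (1 - B)| <= tail nu' D.+1.
  by rewrite ler_norml; apply/andP; split; lra.
have {}d : pgf mu (1 - A) - pgf mu (1 - B) <= mbar * tail nu' D.+1.
  apply: le_trans (ler_norm _) _; apply: le_trans d _.
  by rewrite ler_wpM2l // ltW.
have e1 : mbar / nbar * (trunc_pgf nu D (1 - p) - pgf nu (1 - p)) <= mbar / nbar * tail nu D.+1.
  by rewrite ler_wpM2l // divr_ge0 // ltW.
have e2 : mbar * (p * (A - B)) <= mbar * tail nu' D.+1.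
  rewrite ler_pM2l //; case/andP: p01 => p0 p1.
  by apply: le_trans a1; rewrite ler_piMl.
have -> : mbar / nbar * (1 - pgf nu (1 - p) - nbar * p * B) =
   mbar / nbar - mbar / nbar * pgf nu (1 - p) - mbar * (p * B).
  by field; rewrite lt0r_neq0.
have -> : mbar * ((1 - trunc_pgf nu D (1 - p)) / nbar - p * A) =
   mbar / nbar - mbar / nbar * trunc_pgf nu D (1 - p) - mbar * (p * A).
  by field; rewrite lt0r_neq0.
lra.
Qed.

Lemma Lambda_err_cvg : Lambda_err @ \oo --> (0 : R).
Proof.
have s (l : nat -> R) : finite_mean_law l -> (fun D => tail l D.+1) @ \oo --> (0 : R).
  by move=> /tail_cvg0; rewrite -cvg_shiftS.
have -> : (0 : R) = 0 + mbar * 0 * 2 + mbar / nbar * 0 by rewrite !(mulr0, mul0r, addr0).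
apply: cvgD; last by apply: cvgM; [exact: cvg_cst | exact: s].
apply: cvgD; first exact: s.
apply: cvgM; last exact: cvg_cst.
by apply: cvgM; [exact: cvg_cst | exact: s].
Qed.

Definition fixed_map (t : R) := pgf mu' (1 - pgf nu' (1 - t)).

Lemma fixed_map_01 t : 0 <= t <= 1 -> 0 <= fixed_map t <= 1.
Proof. by move=> t01; apply/(pgf_01 mu'_law)/one_minus_01/(pgf_01 nu'_law)/one_minus_01. Qed.

Lemma fixed_map_le a b : 0 <= a -> a <= b -> b <= 1 -> fixed_map a <= fixed_map b.
Proof.
move=> a0 ab b1; have a01 : 0 <= a <= 1 by apply/andP; split; lra.
have b01 : 0 <= b <= 1 by apply/andP; split; lra.
have /andP[x0 x1] := pgf_01 nu'_law (one_minus_01 a01).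
have /andP[y0 y1] := pgf_01 nu'_law (one_minus_01 b01).
have h : pgf nu' (1 - b) <= pgf nu' (1 - a).
  by rewrite -subr_ge0; have /andP[] := @pgf_homo _ _ nu'_law (1 - a) (1 - b) ltac:(lra) ltac:(lra) ltac:(lra).
rewrite -subr_ge0 /fixed_map.
by have /andP[] := @pgf_homo _ _ mu'_law (1 - pgf nu' (1 - b)) (1 - pgf nu' (1 - a)) ltac:(lra) ltac:(lra) ltac:(lra).
Qed.

Lemma fixed_map_lip a b : 0 <= a <= 1 -> 0 <= b <= 1 ->
  `|fixed_map a - fixed_map b| <= mean mu' * mean nu' * `|a - b|.
Proof.
move=> a01 b01; have a01' := one_minus_01 a01; have b01' := one_minus_01 b01.
have := pgf_lip mu'_law (one_minus_01 (pgf_01 nu'_law a01')) (one_minus_01 (pgf_01 nu'_law b01')).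
have := pgf_lip nu'_law b01' a01'.
have e x y : `|1 - x - (1 - y)| = `|y - x| :> R by congr `|_|; ring.
rewrite !e => h1 h2; apply: le_trans h2 _.
by rewrite -mulrA ler_wpM2l // mean_ge0.
Qed.

Variable b : bool.

Fixpoint msg_lim k : R := if k is k'.+1 then fixed_map (msg_lim k') else b%:R.

Lemma msg_lim_01 k : 0 <= msg_lim k <= 1.
Proof. by elim: k => [|k IH] /=; [case: b; rewrite ?lexx ?ler01 | exact: fixed_map_01]. Qed.

Lemma msg_prob_01 D k : 0 <= msg_prob mu' nu' D b k <= 1.
Proof.
elim: k => [|k IH] /=; first by case: b; rewrite ?lexx ?ler01.
apply: (trunc_pgf_01 mu'_law); apply: one_minus_01.
by apply: (trunc_pgf_01 nu'_law); apply: one_minus_01.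
Qed.

Lemma row_prob_cvg (x : nat -> R) (y : R) : (forall D, 0 <= x D <= 1) -> 0 <= y <= 1 ->
  x @ \oo --> y -> (fun D => row_prob nu' D (x D)) @ \oo --> 1 - pgf nu' (1 - y).
Proof.
move=> x01 y01 xy; apply: cvgB; first exact: cvg_cst.
apply: (trunc_pgf_cvg nu'_law (x := fun D => 1 - x D)).
- by move=> D; exact: one_minus_01.
- exact: one_minus_01.
- by apply: cvgB => //; exact: cvg_cst.
Qed.

Lemma row_prob_01 D y : 0 <= y <= 1 -> 0 <= row_prob nu' D y <= 1.
Proof. by move=> y01; apply/one_minus_01/(trunc_pgf_01 nu'_law)/one_minus_01. Qed.

Lemma msg_prob_cvg k : (fun D => msg_prob mu' nu' D b k) @ \oo --> msg_lim k.
Proof.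
elim: k => [|k IH] /=; first exact: cvg_cst.
apply: (trunc_pgf_cvg mu'_law (x := fun D => row_prob nu' D (msg_prob mu' nu' D b k))).
- by move=> D; apply: row_prob_01; exact: msg_prob_01.
- by apply/one_minus_01/(pgf_01 nu'_law)/one_minus_01/msg_lim_01.
- by apply: row_prob_cvg => //; [move=> D; exact: msg_prob_01 | exact: msg_lim_01].
Qed.

Definition cover_bound D k :=
  1 - \sum_(n < D.+1) trunc_law D mu n *
        row_prob nu' D (msg_prob mu' nu' D b (if b then k.+1 else k)) ^+ n
  + mbar * ((\sum_(n < D.+1) nu n * (1 - (1 - msg_prob mu' nu' D b k.+1) ^+ n)) / nbar
     - msg_prob mu' nu' D b k.+1 *
       \sum_(n < D.+1) trunc_law D nu' n * (1 - msg_prob mu' nu' D b k.+1) ^+ n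
     + tail nu' D).

(** [s] belongs to the level that decides which columns are kept, [t] to the level of the charged
    messages; they merge as the level grows. The summand 0 is the limit of the tail in
    [cover_bound]. *)
Definition cover_lim (s t : R) :=
  1 - pgf mu (1 - pgf nu' (1 - s))
  + mbar * ((1 - pgf nu (1 - t)) / nbar - t * pgf nu' (1 - t) + 0).

Lemma cover_bound_cvg k : (fun D => cover_bound D k) @ \oo -->
  cover_lim (msg_lim (if b then k.+1 else k)) (msg_lim k.+1).
Proof.
rewrite /cover_bound /cover_lim; under eq_fun do rewrite sum_one_minus.
apply: cvgD.
  apply: cvgB; first exact: cvg_cst.
  apply: (trunc_pgf_cvg mu_law (x := fun D => row_prob nu' D (msg_prob mu' nu' D b _))).
  - by move=> D; apply: row_prob_01; exact: msg_prob_01.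
  - by apply/one_minus_01/(pgf_01 nu'_law)/one_minus_01/msg_lim_01.
  - apply: row_prob_cvg; last exact: msg_prob_cvg.
      by move=> D; exact: msg_prob_01.
    exact: msg_lim_01.
have m01 D := one_minus_01 (msg_prob_01 D k.+1).
have l01 := one_minus_01 (msg_lim_01 k.+1).
have mc : (fun D => 1 - msg_prob mu' nu' D b k.+1) @ \oo --> 1 - msg_lim k.+1.
  by apply: cvgB; [exact: cvg_cst | exact: msg_prob_cvg].
apply: cvgM; first exact: cvg_cst.
apply: cvgD; last exact: tail_cvg0.
apply: cvgB.
  apply: cvgM; last exact: cvg_cst.
  apply: cvgB; first exact: cvg_cst.
  exact: (trunc_pgf_cvg nu_law m01 l01 mc).
exact: (cvgM (@msg_prob_cvg k.+1) (trunc_pgf_cvg nu'_law m01 l01 mc)).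
Qed.

Lemma cover_lim_diag t : cover_lim t t = 1 - Lambda mu nu t.
Proof. by rewrite /cover_lim /Lambda; field; rewrite lt0r_neq0. Qed.

Lemma fixed_map_cvg (x : nat -> R) (y : R) : (forall k, 0 <= x k <= 1) -> 0 <= y <= 1 ->
  x @ \oo --> y -> (fun k => fixed_map (x k)) @ \oo --> fixed_map y.
Proof.
move=> x01 y01 xy; apply/cvgrPdist_le => e e0.
have : (fun k => mean mu' * mean nu' * `|y - x k|) @ \oo --> mean mu' * mean nu' * `|y - y|.
  by apply: cvgM; [exact: cvg_cst | apply: cvg_norm; apply: cvgB => //; exact: cvg_cst].
rewrite subrr normr0 mulr0 => /cvgrPdist_le/(_ _ e0).
apply: filterS => k; rewrite sub0r normrN => h.
apply: le_trans (fixed_map_lip y01 (x01 k)) _.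
by apply: le_trans h; exact: ler_norm.
Qed.

Lemma msg_lim_fixed (y : R) : 0 <= y <= 1 -> msg_lim @ \oo --> y -> fixed_points mu nu y.
Proof.
move=> y01 my; split=> //; rewrite -/(fixed_map y).
have h1 := fixed_map_cvg msg_lim_01 y01 my.
have h2 : (fun k => msg_lim k.+1) @ \oo --> y by rewrite cvg_shiftS.
exact: (cvg_unique _ h2 h1).
Qed.

(** The iterates of an increasing map started at 1, resp. 0, are monotone and never cross a fixed
    point. Their limit is fixed by continuity, hence the largest, resp. smallest, solution. *)
Lemma msg_lim_cvg (y : R) : (if b then @is_max R else @is_min R) (fixed_points mu nu) y ->
  msg_lim @ \oo --> y.
Proof.
have m01 := msg_lim_01.
case E : b => -[[y01 yE] yM].
  have mon k : y <= msg_lim k.+1 <= msg_lim k.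
    elim: k => [|k /andP[h1 h2]] /=.
      have /andP[a c] := y01.
      have /andP[_ d] := fixed_map_01 (msg_lim_01 0).
      rewrite /= E mulr1n in d *; rewrite d andbT [leLHS]yE.
      by apply: fixed_map_le => //; lra.
    have /andP[a c] := y01; have /andP[a1 c1] := m01 k; have /andP[a2 c2] := m01 k.+1.
    rewrite [X in X <= _]yE; apply/andP; split; apply: fixed_map_le => //; lra.
  have cv : cvgn msg_lim.
    apply: nonincreasing_is_cvgn.
      by apply/nonincreasing_seqP => k; case/andP: (mon k).
    by exists 0 => _ [k _ <-]; case/andP: (m01 k).
  have l01 : 0 <= limn msg_lim <= 1.
    apply/andP; split; [apply: limr_ge|apply: limr_le] => //; apply: nearW => k; by case/andP: (m01 k).
  have h1 := yM _ (msg_lim_fixed l01 cv).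
  have h2 : y <= limn msg_lim.
    rewrite -(cvg_lim _ (_ : (fun k => msg_lim k.+1) @ \oo --> limn msg_lim)) ?cvg_shiftS //.
    apply: limr_ge; first by apply/cvg_ex; exists (limn msg_lim); rewrite cvg_shiftS.
    by apply: nearW => k; case/andP: (mon k).
  have -> : y = limn msg_lim by apply/eqP; rewrite eq_le h1 h2.
  exact: cv.
have mon k : msg_lim k <= msg_lim k.+1 <= y.
  elim: k => [|k /andP[h1 h2]] /=.
    have /andP[a c] := y01.
    have /andP[d _] := fixed_map_01 (msg_lim_01 0).
    rewrite /= E mulr0n in d *; rewrite d /= [leRHS]yE.
    by apply: fixed_map_le => //; lra.
  have /andP[a c] := y01; have /andP[a1 c1] := m01 k; have /andP[a2 c2] := m01 k.+1.
  rewrite [X in _ && (_ <= X)]yE; apply/andP; split; apply: fixed_map_le => //; lra.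
have cv : cvgn msg_lim.
  apply: nondecreasing_is_cvgn.
    by apply/nondecreasing_seqP => k; case/andP: (mon k).
  by exists 1 => _ [k _ <-]; case/andP: (m01 k).
have l01 : 0 <= limn msg_lim <= 1.
  apply/andP; split; [apply: limr_ge|apply: limr_le] => //; apply: nearW => k; by case/andP: (m01 k).
have h1 := yM _ (msg_lim_fixed l01 cv).
have h2 : limn msg_lim <= y.
  apply: limr_le => //; apply: nearW => k.
  by case/andP: (mon k) => h; apply: le_trans.
have -> : y = limn msg_lim by apply/eqP; rewrite eq_le h1 h2.
exact: cv.
Qed.

Lemma cover_lim_cvg (y : R) : 0 <= y <= 1 -> msg_lim @ \oo --> y ->
  (fun k => cover_lim (msg_lim (if b then k.+1 else k)) (msg_lim k.+1)) @ \oo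
  --> 1 - Lambda mu nu y.
Proof.
move=> y01 my; rewrite -cover_lim_diag /cover_lim.
have my1 : (fun k => msg_lim k.+1) @ \oo --> y by rewrite cvg_shiftS.
have myb : (fun k => msg_lim (if b then k.+1 else k)) @ \oo --> y by case: (b).
have pc (l : nat -> R) (x : nat -> R) (z : R) : finite_mean_law l -> (forall k, 0 <= x k <= 1) ->
    0 <= z <= 1 -> x @ \oo --> z -> (fun k => pgf l (x k)) @ \oo --> pgf l z.
  move=> l_law x01 z01 xz; apply/cvgrPdist_le => e e0.
  have : (fun k => mean l * `|z - x k|) @ \oo --> mean l * `|z - z|.
    by apply: cvgM; [exact: cvg_cst | apply: cvg_norm; apply: cvgB => //; exact: cvg_cst].
  rewrite subrr normr0 mulr0 => /cvgrPdist_le/(_ _ e0).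
  apply: filterS => k; rewrite sub0r normrN => h.
  apply: le_trans (pgf_lip l_law z01 (x01 k)) _.
  by apply: le_trans h; exact: ler_norm.
have oc (x : nat -> R) (z : R) : x @ \oo --> z -> (fun k => 1 - x k) @ \oo --> 1 - z.
  by move=> xz; apply: cvgB => //; exact: cvg_cst.
apply: cvgD.
  apply: (oc _ _); apply: (pc _ _ _) => //.
  - by move=> k; apply/one_minus_01/(pgf_01 nu'_law)/one_minus_01/msg_lim_01.
  - by apply/one_minus_01/(pgf_01 nu'_law)/one_minus_01.
  - apply: (oc _ _); apply: (pc _ _ _) => //; last exact: (oc _ _).
      by move=> k; exact/one_minus_01/msg_lim_01.
    exact: one_minus_01.
have m01 k := one_minus_01 (msg_lim_01 k.+1).
have y01' := one_minus_01 y01.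
apply: cvgM; first exact: cvg_cst.
apply: cvgD; last exact: cvg_cst.
apply: cvgB.
  apply: cvgM; last exact: cvg_cst.
  by apply: (oc _ _); apply: (pc _ _ _) => //; exact: (oc _ _).
by apply: cvgM => //; apply: (pc _ _ _) => //; exact: (oc _ _).
Qed.

End Model.

(** * The mass lost by bounding the degrees *)

Section MassDefect.
Variable R : realType.

Lemma le_wt (law law' : nat -> nat -> R) K (t : ptree K) :
  (forall l n, 0 <= law l n) -> (forall l n, law l n <= law' l n) ->
  wt law t <= wt law' t.
Proof.
elim: K law law' t => [//|K IH] law law' t law0 le /=.
rewrite /levelw ler_pM //; first by apply: wprod_ge0 => s; apply: wt_ge0.
rewrite /wprod; apply: ler_prod => s _; rewrite wt_ge0 //=.
by apply: IH.
Qed.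

Lemma le_tree_expect (law law' : nat -> nat -> R) D K (F : ptree K -> R) :
  (forall l n, 0 <= law l n) -> (forall l n, law l n <= law' l n) ->
  (forall t, 0 <= F t) -> tree_expect D law F <= tree_expect D law' F.
Proof.
by move=> law0 le F0; apply: ler_sum => t _; rewrite ler_wpM2r // le_wt.
Qed.

(** For probability laws, the probability that some vertex at distance less than [K] from the root
    has more than [D] children. *)
Definition mass_defect (law : nat -> nat -> R) D K :=
  1 - tree_expect D law (K := K) (fun=> 1).

Lemma mass_defectS law D K : mass_defect law D K.+1 =
  1 - \sum_(n < D.+1) law 0%N n * (1 - mass_defect (fun l => law l.+1) D K) ^+ n.
Proof.
rewrite /mass_defect /tree_expect /= expect_level; congr (_ - _).
by apply: eq_bigr => n _; rewrite expectn_cst mulr1 opprB addrCA subrr addr0.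
Qed.

Lemma mass_defect_01 law D K : (forall l, sublaw (law l)) ->
  0 <= mass_defect law D K <= 1.
Proof.
elim: K law => [|K IH] law h.
  by rewrite /mass_defect /tree_expect /expect big_seq1 /= mulr1 subrr lexx ler01.
have /andP[s0 s1] := IH (fun l => law l.+1) (fun l => h l.+1).
have [l0 t0] := h 0%N.
rewrite mass_defectS; set s := 1 - _.
have s01 : 0 <= s <= 1 by rewrite /s; apply/andP; split; lra.
case/andP: s01 => a c.
rewrite subr_ge0 gerBl sumr_ge0 ?andbT => [|n _]; last by rewrite mulr_ge0 ?exprn_ge0.
have := t0 D.+1; rewrite subr_ge0; apply: le_trans.
by apply: ler_sum => n _; rewrite ler_piMr // exprn_ile1.
Qed.

(** A union bound: the root has too many children, or one of them heads a defective subtree. *)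
Lemma mass_defect_le law D K : (forall l, finite_mean_law (law l)) ->
  mass_defect law D K.+1 <=
  tail (law 0%N) D.+1 + mean (law 0%N) * mass_defect (fun l => law l.+1) D K.
Proof.
move=> h; rewrite mass_defectS; set s := mass_defect _ _ _.
have /andP[s0 s1] : 0 <= s <= 1.
  by apply: mass_defect_01 => l; exact: finite_mean_sublaw.
have hm := partial_mean_le (h 0%N) D.+1.
have l0 n : 0 <= law 0%N n by have [[]] := h 0%N.
have : \sum_(n < D.+1) law 0%N n - \sum_(n < D.+1) law 0%N n * (1 - s) ^+ n <=
    s * \sum_(n < D.+1) law 0%N n * n%:R.
  rewrite -sumrB mulr_sumr; apply: ler_sum => n _.
  have := @exprB_le R 1 (1 - s) n ltac:(apply/andP; split; lra) (lexx _).
  rewrite expr1n opprB addrCA subrr addr0 => hn.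
  rewrite -[X in X - _]mulr1 -mulrBr mulrCA ler_wpM2l //.
  by rewrite [s * _]mulrC.
rewrite /tail; have : s * \sum_(n < D.+1) law 0%N n * n%:R <= s * mean (law 0%N).
  by rewrite ler_wpM2l.
lra.
Qed.

(* The factor [D.+2] bounds the local costs; it is affordable because all the
   laws have finite means. *)
Lemma mass_defect_cvg law K : (forall l, finite_mean_law (law l)) ->
  (fun D => D.+2%:R * mass_defect law D K) @ \oo --> (0 : R).
Proof.
elim: K law => [|K IH] law h.
  rewrite (_ : (fun _ => _) = fun=> 0); first exact: cvg_cst.
  apply/funext => D; rewrite /mass_defect /tree_expect /expect big_seq1 /= mulr1.
  by rewrite subrr mulr0.
pose m := mean (law 0%N).
have tc : (fun D => D.+1%:R * tail (law 0%N) D.+1 + tail (law 0%N) D.+1) @ \oo --> (0 : R) + 0.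
  apply: cvgD.
    have := tail_mul_cvg0 (h 0%N).
    by rewrite -(@cvg_shiftS _ (fun N => N%:R * tail (law 0%N) N)).
  by have := tail_cvg0 (h 0%N); rewrite -cvg_shiftS.
have mc : (fun D => m * (D.+2%:R * mass_defect (fun l => law l.+1) D K)) @ \oo --> m * 0.
  by apply: cvgM; [exact: cvg_cst | exact: (IH (fun l => law l.+1))].
have up : (fun D => D.+1%:R * tail (law 0%N) D.+1 + tail (law 0%N) D.+1 +
    m * (D.+2%:R * mass_defect (fun l => law l.+1) D K)) @ \oo --> (0 : R).
  rewrite (_ : 0 = 0 + 0 + m * 0 :> R); last by rewrite mulr0 !addr0.
  exact: cvgD.
apply: (squeeze_cvgr _ (cvg_cst 0) up); apply: nearW => D.
have /andP[d0 _] := @mass_defect_01 law D K.+1 (fun l => finite_mean_sublaw (h l)).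
rewrite mulr_ge0 //=.
have := mass_defect_le D K h; rewrite -/m => hd.
have : D.+2%:R * mass_defect law D K.+1 <= D.+2%:R * (tail (law 0%N) D.+1 + m * mass_defect (fun l => law l.+1) D K).
  by rewrite ler_wpM2l.
move=> /le_trans; apply.
by rewrite -!natr1 le_eqVlt; apply/orP; left; apply/eqP; ring.
Qed.

End MassDefect.

(** * The law of balls of the Galton-Watson tree *)

Section RootedIso.

Lemma rooted_iso_refl G : rooted_iso G G.
Proof. by exists idfun; split => //; exists idfun. Qed.

Lemma rooted_iso_sym G H : rooted_iso G H -> rooted_iso H G.
Proof.
move=> [f [[g fK gK] fadj froot]]; exists g; split; first by exists f.
- by move=> x y; have := fadj (g x) (g y); rewrite !gK; case=> h1 h2; split.
- by rewrite -froot fK.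
Qed.

Lemma rooted_iso_trans G H K : rooted_iso G H -> rooted_iso H K -> rooted_iso G K.
Proof.
move=> [f [bf fadj froot]] [g [bg gadj groot]]; exists (g \o f); split.
- exact: bij_comp.
- by move=> x y; split=> [/fadj/gadj|/gadj/fadj].
- by rewrite /= froot.
Qed.

End RootedIso.

Section BallOfTree.
Variables (K : nat) (x : seq nat -> nat).

Lemma offspring_tree_of u : in_tree x u -> (size u < K)%N ->
  offspring (tree_of K x) u = x u.
Proof.
elim: K x u => [//|k IH] y [|i u] hu su /=; first by rewrite size_map size_iota.
have iy : (i < y [::])%N by exact: (hu 0%N).
rewrite (nth_map 0%N) ?size_iota // nth_iota // add0n.
rewrite (IH (fun s => y (i :: s))) // => j ju.
exact: (hu j.+1).
Qed.

Lemma valid_agree (y z : seq nat -> nat) :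
  (forall u, in_tree y u -> (size u < K)%N -> z u = y u) ->
  forall u, valid y K u -> valid z K u.
Proof.
move=> yz u [hu su]; split=> // k ku.
have h : in_tree y (take k u).
  by move=> j; rewrite size_take ku => jk; rewrite nth_take // take_takel ?(ltnW jk) //; apply/hu/(ltn_trans jk).
rewrite yz //; first exact: hu.
by rewrite size_take ku; exact: leq_trans ku su.
Qed.

Lemma tree_ball_iso (y z : seq nat -> nat) :
  (forall u, valid y K u <-> valid z K u) ->
  rooted_iso (tree_ball y K) (tree_ball z K).
Proof.
move=> yz.
have ex1 (v : pvertex (tree_ball y K)) : exists w : pvertex (tree_ball z K),
    sval (sval w) = sval (sval v) by apply/validP/yz/vertex_valid.
have ex2 (v : pvertex (tree_ball z K)) : exists w : pvertex (tree_ball y K),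
    sval (sval w) = sval (sval v) by apply/validP/yz/vertex_valid.
have [f hf] := choice ex1; have [g hg] := choice ex2.
exists f; split.
- by exists g => v; do 2 apply: sig_inj; rewrite ?hg ?hf ?hg.
- by move=> a c; rewrite /= /induced_adj /= /induced_adj /= !hf.
- by do 2 apply: sig_inj; rewrite hf.
Qed.

Lemma tree_ball_tree_of : rooted_iso (tree_ball x K) (tree_graph (tree_of K x)).
Proof.
apply: tree_ball_iso => u; split.
  by apply: valid_agree => s; exact: offspring_tree_of.
have h : forall k s, (size s <= k)%N -> in_tree (offspring (tree_of K x)) s ->
    (size s <= K)%N -> in_tree x s.
  elim=> [|k IH] s; first by rewrite leqn0 => /nilP ->.
  case/lastP: s => [//|s i]; rewrite size_rcons ltnS => sk.
  move=> /in_tree_rcons[h1 h2] sK.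
  have hs := IH _ sk h1 (ltnW sK).
  by apply/in_tree_rcons; split => //; rewrite -offspring_tree_of.
by move=> [h1 h2]; split => //; exact: (h (size u)).
Qed.

End BallOfTree.

(** The vertices at distance less than [K], which are those whose offspring numbers the encoding
    records. *)
Fixpoint internal K : ptree K -> seq (seq nat) :=
  match K return ptree K -> seq (seq nat) with
  | 0 => fun=> [::]
  | K'.+1 => fun ts =>
     [::] :: flatten [seq map (cons i) (internal (nth (default_tree K') (ts : seq (ptree K')) i))
                     | i <- iota 0 (size (ts : seq (ptree K')))]
  end.

Lemma internal_uniq K (t : ptree K) : uniq (internal t).
Proof.
elim: K t => [//|K IH] t /=; apply/andP; split.
  by apply/negP => /flatten_mapP[i _ /mapP[]].
elim: (size _) 0%N => [//|n IHn] m /=; rewrite cat_uniq IHn andbT.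
rewrite map_inj_uniq ?IH //=; last by move=> a c [].
apply/hasPn => v /flatten_mapP[j]; rewrite mem_iota => /andP[mj _] /mapP[u _ ->].
by apply/negP => /mapP[u' _ [e _]]; rewrite e ltnn in mj.
Qed.

(** Prescribing the first [K] generations is a condition on a fixed finite set of words, whose
    probability follows from independence. *)
Lemma tree_ofP K (t : ptree K) x :
  tree_of K x = t <-> (forall u, u \in internal t -> x u = offspring t u).
Proof.
elim: K t x => [|K IH] t x; first by split=> // _; case: t.
split=> [<- u /=|h].
  rewrite inE => /predU1P[->|]; first by rewrite size_map size_iota.
  move=> /flatten_mapP[i]; rewrite mem_iota /= add0n size_map size_iota => ix /mapP[s hs ->].
  by move: hs; rewrite (nth_map 0%N) ?size_iota // nth_iota // add0n => /(IH _ (fun s => x (i :: s))).1 ->.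
have h0 : x [::] = size (t : seq (ptree K)) by rewrite h // inE.
apply: (@eq_from_nth _ (default_tree K)); first by rewrite size_map size_iota.
move=> i; rewrite size_map size_iota => ix.
rewrite (nth_map 0%N) ?size_iota // nth_iota // add0n.
apply/IH => u hu; rewrite h // inE; apply/orP; right.
apply/flatten_mapP; exists i; first by rewrite mem_iota add0n -h0.
exact: map_f.
Qed.

Section GWLaw.
Variables (R : realType) (mu nu : nat -> R) (d0 : measure_display).
Variables (Omega0 : measurableType d0) (Q : probability Omega0 R).
Variable X : seq nat -> {RV Q >-> nat}.
Hypothesis X_gw : gw_star_offspring mu nu X.

Lemma prod_internal (law : nat -> nat -> R) K (t : ptree K) :
  \prod_(u <- internal t) law (size u) (offspring t u) = wt law t.
Proof.
elim: K law t => [|K IH] law t /=; first by rewrite big_nil.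
rewrite big_cons /levelw; congr (_ * _).
rewrite big_flatten big_map /wprod (big_nth (default_tree K)) /index_iota subn0.
by apply: eq_bigr => i _; rewrite big_map -IH.
Qed.

Let x w u := X u w.
Definition tree_event K (t : ptree K) := [set w | tree_of K (x w) = t].

Lemma measurable_offspring u k : measurable [set w | X u w = k].
Proof. exact: (measurable_funPTI (X u) (Y := [set k])). Qed.

Lemma tree_eventE K (t : ptree K) :
  tree_event t = [set w | forall u, u \in internal t -> [set offspring t u] (X u w)].
Proof. by apply/seteqP; split => w /= /tree_ofP. Qed.

Lemma measurable_tree_event K (t : ptree K) : measurable (tree_event t).
Proof.
rewrite tree_eventE; elim: (internal t) => [|u s IH].
  by rewrite (_ : [set w | _] = setT) //; apply/seteqP; split.
have -> : [set w | forall v, v \in u :: s -> [set offspring t v] (X v w)] =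
    [set w | X u w = offspring t u] `&`
    [set w | forall v, v \in s -> [set offspring t v] (X v w)].
  apply/seteqP; split => w /= => [h|[h1 h2] v].
    by split; [apply: h; rewrite inE eqxx | move=> v vs; apply: h; rewrite inE vs orbT].
  by rewrite inE => /predU1P[->//|]; exact: h2.
by apply: measurableI => //; exact: measurable_offspring.
Qed.

Lemma tree_event_prob K (t : ptree K) :
  Q (tree_event t) = (wt (fun l => gw_star_law mu nu l) t)%:E.
Proof.
have [indep Xlaw] := X_gw.
rewrite tree_eventE (indep (internal t) (fun u => [set offspring t u]) (internal_uniq t)).
rewrite -prod_internal; elim: (internal t) => [|u s IH]; first by rewrite !big_nil.
by rewrite !big_cons EFinM -IH; congr (_ * _)%E; exact: Xlaw.
Qed.

Lemma tree_event_seq K (s : seq (ptree K)) : uniq s ->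
  measurable [set w | tree_of K (x w) \in s] /\
  Q [set w | tree_of K (x w) \in s] =
  (\sum_(t <- s) wt (fun l => gw_star_law mu nu l) t)%:E.
Proof.
elim: s => [_|t s IH /= /andP[ts /IH[m E]]].
  rewrite big_nil (_ : [set w | _] = set0); first by rewrite measure0.
  by apply/seteqP; split.
have e : [set w | tree_of K (x w) \in t :: s] =
    tree_event t `|` [set w | tree_of K (x w) \in s].
  apply/seteqP; split => w /=; first by rewrite inE => /predU1P[]; [left|right].
  by case=> [->|h]; rewrite inE ?eqxx // h orbT.
rewrite e; split; first by apply: measurableU => //; exact: measurable_tree_event.
rewrite measureU //; last 2 first.
- exact: measurable_tree_event.
- apply/seteqP; split => // w /= [h1 h2]; move: ts; rewrite -h1.
  by rewrite (h2 : is_true _).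
by rewrite big_cons EFinD -tree_event_prob -E.
Qed.

Lemma countable_union_measurable (C : countType) (E : C -> set Omega0) :
  (forall c, measurable (E c)) -> measurable (\bigcup_c E c).
Proof. by move=> h; apply: countable_bigcupT_measurable => //; exact: countableP. Qed.

Definition ball_event K (t : ptree K) :=
  [set w | rooted_iso (nbhd (pgraph (gw_tree X w)) (proot (gw_tree X w)) K) (tree_graph t)].

(** The ball event is a countable union of cylinder events, as there are only countably many encoded
    trees. *)
Lemma measurable_ball_event K (t : ptree K) : measurable (ball_event t).
Proof.
have -> : ball_event t = \bigcup_(s : ptree K)
    (if `[< rooted_iso (tree_graph s) (tree_graph t) >] then tree_event s else set0).
  apply/seteqP; split => w.
    move=> h; exists (tree_of K (x w)) => //; rewrite ifT //.
    apply/asboolP; apply: rooted_iso_trans h; apply: rooted_iso_sym.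
    exact: (tree_ball_tree_of K (x w)).
  move=> [s _]; case: asboolP => // h e; apply: rooted_iso_trans h.
  rewrite -e; exact: (tree_ball_tree_of K (x w)).
by apply: countable_union_measurable => s; case: ifP => _ //; exact: measurable_tree_event.
Qed.

(** Distinct plane trees give disjoint events even when they are isomorphic, so the weights within a
    class add up. Equality is not claimed, as [L] may miss members of the class. *)
Lemma class_weight_le K (t : ptree K) (L : seq (ptree K)) : uniq L ->
  \sum_(s <- L | `[< rooted_iso (tree_graph s) (tree_graph t) >])
     wt (fun l => gw_star_law mu nu l) s <= fine (Q (ball_event t)).
Proof.
move=> uL; rewrite -big_filter; set s := seq.filter _ L.
have [m E] := tree_event_seq (filter_uniq _ uL : uniq s).
rewrite -lee_fin fineK ?fin_num_measure //; last exact: measurable_ball_event.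
rewrite -E; apply: le_measure; rewrite ?inE //; first exact: measurable_ball_event.
move=> w /=; rewrite mem_filter => /andP[/asboolP h _].
by apply: rooted_iso_trans h; exact: (tree_ball_tree_of K (x w)).
Qed.

End GWLaw.

(** * Transfer from the tree to the matrices *)

Lemma lists_uniq (T : eqType) (L : seq T) k : uniq L -> uniq (lists L k).
Proof.
move=> uL; elim: k => [//|k IH] /=.
by apply: (allpairs_uniq_dep uL) => [t _ //|[t s] [t' s'] _ _ /= [-> ->]].
Qed.

Lemma trees_uniq D K : uniq (trees D K).
Proof.
elim: K => [//|K]; rewrite [trees D K.+1]/(level D (trees D K)) /level.
move: (trees D K) => L uL.
elim: D.+1 0%N => [//|n IHn] m /=; rewrite cat_uniq lists_uniq // IHn andbT /=.
apply/hasPn => ts /flatten_mapP[j]; rewrite mem_iota => /andP[mj _].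
rewrite mem_lists => /andP[/eqP sj _]; rewrite mem_lists sj negb_and.
by rewrite gtn_eqF.
Qed.

Section Whp.
Variables (R : realType) (d : nat -> measure_display).
Variable Omega : forall n, measurableType (d n).
Variable P : forall n, probability (Omega n) R.
Variable M : forall n, Omega n -> fmatrix R.
Arguments M : clear implicits.
Hypothesis M_random : forall n, random_sign_matrix (M n).

(* An entry is coded by whether it is 0 and whether it is 1. *)
Definition sign_code := {p : nat * nat & 'M[bool * bool]_(p.1, p.2)}.

(** Codes without columns do not give an [fmatrix] and are sent to [default]; matching on [idP]
    supplies the proof that there is a column. *)
Definition decode (default : fmatrix R) (q : sign_code) : fmatrix R :=
  let: existT p A := q in
  match @idP (0 < p.2)%N with
  | ReflectT h => FMatrix h (\matrix_(i, j) if (A i j).1 then 0 else if (A i j).2 then 1 else -1)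
  | ReflectF _ => default
  end.

Lemma decode_surj default (A : fmatrix R) : sign_entries A -> exists q, decode default q = A.
Proof.
case: A => nr nc h A sA.
exists (existT _ (nr, nc) (\matrix_(i, j) (A i j == 0, A i j == 1))) => /=.
case: {-}_ / idP => // h'.
have -> : h' = h by exact: bool_irrelevance.
congr FMatrix; apply/matrixP => i j; rewrite !mxE /=.
have := sA i j; rewrite /= !inE => /or3P[] /eqP ->; rewrite ?eqxx ?oner_eq0 //.
rewrite oppr_eq0 oner_eq0; case: eqP => // e.
Qed.

(** The random matrix takes countably many values, so every property of it is an event. *)
Lemma measurable_event n (S : fmatrix R -> Prop) : measurable [set w | S (M n w)].
Proof.
have [sM mM] := M_random n.
have [[w0 _]|ne] := pselect ([set: Omega n] !=set0); last first.
  rewrite (_ : [set w | _] = set0) //; apply/seteqP; split => // w _.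
  by apply: ne; exists w.
have -> : [set w | S (M n w)] = \bigcup_(q : sign_code)
   (if `[< S (decode (M n w0) q) >] then [set w | M n w = decode (M n w0) q] else set0).
  apply/seteqP; split => w /=.
    move=> Sw; have [q e] := decode_surj (M n w0) (sM w).
    by exists q => //; rewrite e ifT //; exact/asboolP.
  by move=> [q _]; case: asboolP => // Sq /= ->.
apply: countable_bigcupT_measurable; first exact: countableP.
by move=> q; case: ifP.
Qed.

Definition whp (S : fmatrix R -> Prop) :=
  (fun n => P n [set w | ~ S (M n w)]) @ \oo --> 0%E.

Lemma whp_mono (S S' : fmatrix R -> Prop) :
  (forall A, sign_entries A -> S A -> S' A) -> whp S -> whp S'.
Proof.
move=> SS' hS; apply: (squeeze_cvge _ (cvg_cst 0%E) hS); apply: nearW => n.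
rewrite measure_ge0 /=; apply: le_measure; rewrite ?inE.
- exact: (measurable_event n (fun A => ~ S' A)).
- exact: (measurable_event n (fun A => ~ S A)).
- by move=> w /= nS' Sw; apply: nS'; apply: SS' => //; have [+ _] := M_random n; apply.
Qed.

Lemma whp_and (S S' : fmatrix R -> Prop) : whp S -> whp S' -> whp (fun A => S A /\ S' A).
Proof.
move=> hS hS'.
have h : (fun n => P n [set w | ~ S (M n w)] + P n [set w | ~ S' (M n w)])%E @ \oo --> 0%E.
  by rewrite -[X in _ --> X](adde0 0%E); apply: cvgeD.
apply: (squeeze_cvge _ (cvg_cst 0%E) h); apply: nearW => n.
have m1 := measurable_event n (fun A => ~ S A).
have m2 := measurable_event n (fun A => ~ S' A).
rewrite measure_ge0 /=; apply: le_trans (measureU2 _ m1 m2).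
apply: le_measure; rewrite ?inE.
- exact: (measurable_event n (fun A => ~ (S A /\ S' A))).
- exact: measurableU.
- move=> w /= nSS; have [Sw|nS] := pselect (S (M n w)); [right|left] => //.
  by move=> S'w; exact: nSS.
Qed.

Lemma whp_seq (T : eqType) (s : seq T) (S : T -> fmatrix R -> Prop) :
  (forall t, t \in s -> whp (S t)) -> whp (fun A => forall t, t \in s -> S t A).
Proof.
elim: s => [|t s IH] h.
  rewrite /whp (_ : (fun n => _) = fun=> 0%E); first exact: cvg_cst.
  apply/funext => n; rewrite (_ : [set w | _] = set0) ?measure0 //.
  by apply/seteqP; split => // w /=; apply.
have h1 : whp (S t) by apply: h; rewrite inE eqxx.
have h2 : whp (fun A => forall t, t \in s -> S t A).
  by apply: IH => u us; apply: h; rewrite inE us orbT.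
apply: whp_mono (whp_and h1 h2) => A _ [a c] u.
by rewrite inE => /predU1P[->//|]; exact: c.
Qed.

Lemma cvg_in_prob_whp (f : fmatrix R -> R) l (e : R) : 0 < e ->
  cvg_in_prob P (fun n w => f (M n w)) l -> whp (fun A => `|f A - l| <= e).
Proof.
move=> e0 /(_ e e0); rewrite /whp.
suff -> : (fun n => P n [set w | e < `|f (M n w) - l|]) =
   (fun n => P n [set w | ~ (`|f (M n w) - l| <= e)]) by [].
apply/funext => n; congr (P n _); apply/seteqP; split => w /=; rewrite ltNge.
  by move/negP.
by move=> /negP.
Qed.

Lemma whp_cvg_in_prob (f : fmatrix R -> R) l :
  (forall e, 0 < e -> whp (fun A => f A <= l + e)) ->
  (forall e, 0 < e -> whp (fun A => l - e <= f A)) ->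
  cvg_in_prob P (fun n w => f (M n w)) l.
Proof.
move=> up lo e e0.
have h : whp (fun A => `|f A - l| <= e).
  apply: whp_mono (whp_and (up e e0) (lo e e0)) => A _ [a c].
  by rewrite ler_norml; apply/andP; split; lra.
move: h; rewrite /whp.
suff -> : (fun n => P n [set w | e < `|f (M n w) - l|]) =
   (fun n => P n [set w | ~ (`|f (M n w) - l| <= e)]) by [].
apply/funext => n; congr (P n _); apply/seteqP; split => w /=; rewrite ltNge.
  by move/negP.
by move=> /negP.
Qed.

Lemma nbhd_freqE K (A : fmatrix R) H :
  nbhd_freq R K (tanner_set_rooted A) H =
  (\sum_c (`[< rooted_iso (nbhd (tanner_graph A) (inr c) K) H >])%:R) / (ncols A)%:R.
Proof.
rewrite /nbhd_freq /=; congr (_ / _%:R); last first.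
  by rewrite card_imset ?card_ord //; exact: inr_inj.
pose S := [set c | `[< rooted_iso (nbhd (tanner_graph A) (inr c) K) H >]]%SET.
transitivity (#|inr @: S : {set tanner_vertex A}|%:R : R).
  congr _%:R; apply: eq_card => o; apply/andP/imsetP => [[/imsetP[c _ ->] h]|[c]].
    by exists c => //; rewrite inE.
  by rewrite inE => h ->; split => //; exact: imset_f.
rewrite card_imset; last exact: inr_inj.
rewrite -sum1_card natr_sum big_mkcond; apply: eq_bigr => c _; rewrite inE /=.
by case: asbool.
Qed.

Section Transfer.
Variables (mu nu : nat -> R) (d0 : measure_display).
Variables (Omega0 : measurableType d0) (Q : probability Omega0 R).
Variable X : seq nat -> {RV Q >-> nat}.
Hypothesis X_gw : gw_star_offspring mu nu X.
Hypothesis M_cvg : local_cvg_in_prob P (fun n w => tanner_set_rooted (M n w)) Q (gw_tree X).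
Hypothesis law_ge0 : forall l n, 0 <= gw_star_law mu nu l n.

Let law l := gw_star_law mu nu l.

Variables (D K : nat) (a : ptree K -> R) (b : R).
Variable psi : forall A : fmatrix R, 'I_(ncols A) -> R.
Arguments psi : clear implicits.
Hypothesis psi_le : forall A c, psi A c <= b.
Hypothesis a_le : forall t, t \in trees D K -> a t <= b.
Hypothesis psi_local : forall A c t, sign_entries A -> t \in trees D K ->
  rooted_iso (nbhd (tanner_graph A) (inr c) K) (tree_graph t) -> psi A c <= a t.

Let L := trees D K.
Let iso (s t : ptree K) := `[< rooted_iso (tree_graph s) (tree_graph t) >].
Let W t := \sum_(s <- L | iso s t) wt law s.
Let coef t := wt law t / W t * (a t - b).

Let wt0 (t : ptree K) : 0 <= wt law t. Proof. exact: wt_ge0. Qed.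

Let W0 t : 0 <= W t. Proof. by apply: sumr_ge0. Qed.

Let wt_le_W t : t \in L -> wt law t <= W t.
Proof.
move=> tL; rewrite /W (big_rem t) //= ifT ?lerDl ?sumr_ge0 //.
by apply/asboolP; exact: rooted_iso_refl.
Qed.

(* Within its isomorphism class, a tree counts with its share of the total
   weight, so that no choice of representatives is needed. *)
Lemma psi_le_coef A c : sign_entries A ->
  psi A c <= b + \sum_(t <- L)
    (`[< rooted_iso (nbhd (tanner_graph A) (inr c) K) (tree_graph t) >])%:R * coef t.
Proof.
move=> sA; set B := nbhd _ _ _.
have [[t0 t0L iso0]|no] := pselect (exists2 t, t \in L & rooted_iso B (tree_graph t)); last first.
  rewrite big_seq big1 ?addr0 // => t tL; case: asboolP => [h|_]; last by rewrite mul0r.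
  by case: no; exists t.
have WE t : rooted_iso B (tree_graph t) -> W t = W t0.
  move=> h; apply: eq_bigl => s; apply: asbool_equiv_eq; split => hs; apply: rooted_iso_trans hs _.
    exact: rooted_iso_trans (rooted_iso_sym h) iso0.
  exact: rooted_iso_trans (rooted_iso_sym iso0) h.
have -> : \sum_(t <- L) (`[< rooted_iso B (tree_graph t) >])%:R * coef t =
    \sum_(t <- L | iso t t0) wt law t / W t0 * (a t - b).
  rewrite [RHS]big_mkcond /=; apply: eq_bigr => t _.
  rewrite /iso; case: asboolP => h; case: asboolP => h2; rewrite ?mul1r ?mul0r //.
  - by rewrite /coef WE.
  - by case: h2; apply: rooted_iso_trans (rooted_iso_sym h) iso0.
  - by case: h; apply: rooted_iso_trans iso0 (rooted_iso_sym h2).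
have lower : \sum_(t <- L | iso t t0) wt law t / W t0 * (psi A c - b) <=
    \sum_(t <- L | iso t t0) wt law t / W t0 * (a t - b).
  rewrite big_seq_cond [leRHS]big_seq_cond; apply: ler_sum => t /andP[tL /asboolP h].
  rewrite ler_wpM2l ?divr_ge0 // lerD2r; apply: psi_local => //.
  exact: rooted_iso_trans iso0 (rooted_iso_sym h).
have e : \sum_(t <- L | iso t t0) wt law t / W t0 * (psi A c - b) =
    W t0 / W t0 * (psi A c - b) by rewrite -!mulr_suml.
have := psi_le c; move: lower; rewrite e.
(* A class of weight 0 gets the coefficient 0, division by 0 being 0; then the crude bound by [b] is
   enough. *)
have [->|n0] := eqVneq (W t0) 0; first by rewrite mul0r mul0r; lra.
by rewrite divff // mul1r; lra.
Qed.

(** Every column counts [b], and a column with a listed ball is corrected by the nonpositive amount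
    a - b. Hence only lower bounds on the frequencies of the listed balls are needed, and finitely
    many test graphs suffice; the mass of the unlisted trees keeps the weight [b]. *)
Lemma transfer (eps : R) : 0 < eps ->
  whp (fun A => (\sum_c psi A c) / (ncols A)%:R <=
     tree_expect D law a + b * mass_defect law D K + eps).
Proof.
move=> eps0.
pose C := \sum_(t <- L) `|coef t|.
have C0 : 0 <= C by apply: sumr_ge0.
(* [C] is the total size of the coefficients, so errors [e] in all frequencies cost at most [eps]
   together. *)
pose e := eps / (1 + C).
have e0 : 0 < e by rewrite divr_gt0 //; lra.
have coef_le0 t : t \in L -> coef t <= 0.
  move=> tL; rewrite mulr_ge0_le0 ?divr_ge0 // subr_le0; exact: a_le.
pose p (t : ptree K) := fine (Q (ball_event X t)).
have freq t : t \in L -> whp (fun A => `|nbhd_freq R K (tanner_set_rooted A) (tree_graph t) - p t| <= e).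
  move=> tL; apply: cvg_in_prob_whp => //.
  have h := M_cvg (tree_ball_rooted (offspring t) K) (@tree_ball_depth (offspring t) K).
  exact: h.
apply: whp_mono (whp_seq freq) => A sA hf.
have nc0 : 0 < (ncols A)%:R :> R by rewrite ltr0n ncols_gt0.
rewrite ler_pdivrMr //.
apply: (@le_trans _ _ (\sum_c (b + \sum_(t <- L)
  (`[< rooted_iso (nbhd (tanner_graph A) (inr c) K) (tree_graph t) >])%:R * coef t))).
  by apply: ler_sum => c _; exact: psi_le_coef.
rewrite big_split /= exchange_big /=.
have -> : \sum_(c < ncols A) b = b * (ncols A)%:R by rewrite sumr_const card_ord mulr_natr.
have -> : \sum_(t <- L) \sum_c (`[< rooted_iso (nbhd (tanner_graph A) (inr c) K)
    (tree_graph t) >])%:R * coef t =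
   (\sum_(t <- L) nbhd_freq R K (tanner_set_rooted A) (tree_graph t) * coef t) * (ncols A)%:R.
  rewrite mulr_suml; apply: eq_bigr => t _.
  by rewrite -mulr_suml nbhd_freqE mulrAC divfK ?lt0r_neq0.
rewrite -mulrDl ler_pM2r //.
have h t : t \in L -> nbhd_freq R K (tanner_set_rooted A) (tree_graph t) * coef t <=
    wt law t * (a t - b) + e * `|coef t|.
  move=> tL; have := hf t tL; rewrite ler_norml => /andP[h1 _].
  have c0 := coef_le0 t tL.
  have h2 : p t * coef t <= wt law t * (a t - b).
    apply: (@le_trans _ _ (W t * coef t)).
      rewrite ler_wnM2r //; exact: (class_weight_le X_gw t (trees_uniq D K)).
    rewrite /coef; have [w0|n0] := eqVneq (W t) 0; last by rewrite mulrA [W t * _]mulrC divfK.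
    have := wt_le_W tL; rewrite w0 => wle.
    by have -> : wt law t = 0 by [apply/eqP; rewrite eq_le wle wt0]; rewrite !mul0r.
  rewrite ler0_norm //.
  have : nbhd_freq R K (tanner_set_rooted A) (tree_graph t) * coef t <= (p t - e) * coef t.
    by rewrite ler_wnM2r //; lra.
  by lra.
have h3 : \sum_(t <- L) nbhd_freq R K (tanner_set_rooted A) (tree_graph t) * coef t <=
    \sum_(t <- L) (wt law t * (a t - b) + e * `|coef t|).
  by rewrite big_seq [leRHS]big_seq; apply: ler_sum => t; exact: h.
have h4 : e * C <= eps.
  by rewrite /e mulrAC ler_pdivrMr; nra.
rewrite big_split /= -mulr_sumr -/C in h3.
have -> : tree_expect D law a + b * mass_defect law D K =
   b + \sum_(t <- L) wt law t * (a t - b).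
  rewrite /mass_defect /tree_expect /expect mulrBr mulr1 mulr_sumr.
  rewrite addrCA -sumrB; congr (_ + _); apply: eq_bigr => t _; ring.
by lra.
Qed.

End Transfer.
End Whp.

(** * The limit of the rank *)

Section Rank.
Variables (R : realType) (mu nu : nat -> R).
Hypotheses (mu_distr : is_distribution mu) (nu_distr : is_distribution nu).
Hypotheses (mu_moment : finite_second_moment mu) (nu_moment : finite_second_moment nu).
Hypotheses (mu_mean : 0 < mean mu) (nu_mean : 0 < mean nu).
Variables (d : nat -> measure_display) (Omega : forall n, measurableType (d n)).
Variable P : forall n, probability (Omega n) R.
Variable M : forall n, Omega n -> fmatrix R.
Arguments M : clear implicits.
Hypothesis M_random : forall n, random_sign_matrix (M n).
Variables (d0 : measure_display) (Omega0 : measurableType d0).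
Variables (Q : probability Omega0 R) (X : seq nat -> {RV Q >-> nat}).
Hypothesis X_gw : gw_star_offspring mu nu X.
Hypothesis M_cvg : local_cvg_in_prob P (fun n w => tanner_set_rooted (M n w)) Q (gw_tree X).

Let mu_law := second_moment_finite_mean mu_distr mu_moment.
Let nu_law := second_moment_finite_mean nu_distr nu_moment.
Let mu'_law := size_biased_law mu_distr mu_moment mu_mean.
Let nu'_law := size_biased_law nu_distr nu_moment nu_mean.
Let law l := gw_star_law mu nu l.
Let tlaw D l := trunc_law D (root_law mu (size_biased mu) (size_biased nu) l).

Lemma gw_law l : finite_mean_law (law l).
Proof. by rewrite /law /gw_star_law; case: ifP => // _; case: ifP. Qed.

Lemma gw_law_ge0 l n : 0 <= law l n.
Proof. by have [[]] := gw_law l. Qed.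

(** The passage from the original to the truncated weight: moving mass to 0 makes every value of the
    law at most larger on the listed sizes. *)
Lemma tree_expect_gw_le D K (F : ptree K -> R) : (forall t, 0 <= F t) ->
  tree_expect D law F <= tree_expect D (tlaw D) F.
Proof.
move=> F0; apply: le_tree_expect => //; first exact: gw_law_ge0.
move=> l n; have -> : law l = root_law mu (size_biased mu) (size_biased nu) l by case: l.
apply: le_trunc_law; case: l => [|l] /=; first exact: finite_mean_sublaw.
by case: ifP => _; exact: finite_mean_sublaw.
Qed.

Lemma eventually_le (u : nat -> R) l e : u @ \oo --> l -> 0 < e ->
  \forall D \near \oo, u D <= l + e.
Proof.
move=> /cvgrPdist_le h /h; apply: filterS => D; rewrite ler_norml => /andP[]; lra.
Qed.

Lemma eventually_ltn (S : nat -> nat -> Prop) N : (forall k, \forall D \near \oo, S k D) ->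
  \forall D \near \oo, forall k, (k < N)%N -> S k D.
Proof.
move=> h; elim: N => [|N IH]; first exact: nearW.
apply: filterS (filterI IH (h N)) => D [h1 h2] k.
by rewrite ltnS leq_eqVlt => /predU1P[->//|]; exact: h1.
Qed.

Lemma mass_defect_eventually K e : 0 < e ->
  \forall D \near \oo, D.+2%:R * mass_defect law D K <= e.
Proof.
move=> e0; have := eventually_le (mass_defect_cvg K gw_law) e0.
by apply: filterS => D; rewrite add0r.
Qed.

Lemma mass_defect_ge0 D K : 0 <= mass_defect law D K.
Proof.
by have /andP[] := @mass_defect_01 R law D K (fun l => finite_mean_sublaw (gw_law l)).
Qed.

(** Four errors of e/4: the level [k]; the truncation at [D], chosen for this [k]; the unlisted
    balls, where the cost is at most D + 2; and the frequencies. *)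
Lemma rank_upper b y : (if b then @is_max R else @is_min R) (fixed_points mu nu) y ->
  forall e, 0 < e -> whp P M (fun A =>
     (\rank (mx A))%:R / (ncols A)%:R <= 1 - Lambda mu nu y + e).
Proof.
move=> yP e e0.
have y01 : 0 <= y <= 1 by case: (b) yP => -[[]].
have e4 : 0 < e / 4 by lra.
have my := msg_lim_cvg mu_distr nu_distr mu_moment nu_moment mu_mean nu_mean yP.
have [k _ hk] := eventually_le (cover_lim_cvg mu_distr nu_distr mu_moment nu_moment mu_mean nu_mean y01 my) e4.
have {}hk := hk k (leqnn k).
have c1 := eventually_le (@cover_bound_cvg R mu nu mu_distr nu_distr mu_moment nu_moment mu_mean nu_mean b k) e4.
have c2 := mass_defect_eventually (dbl k.+2) e4.
have [D _ hD] : \forall D \near \oo, _ /\ _ := filterI c1 c2.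
have {hD} [h1 h2] := hD D (leqnn D).
have tr := @transfer R d Omega P M M_random mu nu d0 Omega0 Q X X_gw M_cvg gw_law_ge0
   D (dbl k.+2) (@cover_cost R b k) D.+2%:R
   (fun A => local_cost (mx A) b k D).
apply: (whp_mono M_random _ (tr _ _ _ _ e4)) => [A sA hA||t tD|A c t _].
- apply: (@le_trans _ _ ((\sum_c local_cost (mx A) b k D c) / (ncols A)%:R)).
    by rewrite ler_pM2r ?invr_gt0 ?ltr0n ?ncols_gt0 //; exact: rank_le_local_cost.
  apply: le_trans hA _.
  have e1 := tree_expect_gw_le D (@cover_cost_ge0 R b k).
  have e2 := cover_cost_expect D (finite_mean_sublaw mu'_law)
    (finite_mean_sublaw nu'_law) mu_mean nu_mean (size_biasedE mu_mean)
    (size_biasedE nu_mean) b k.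
  have {}e2 : tree_expect D (tlaw D) (@cover_cost R b k) <= cover_bound mu nu b D k := e2.
  move: e1 e2 h1 h2 hk; set x1 := tree_expect _ _ _; set x2 := tree_expect _ _ _.
  set x4 := _ * mass_defect _ _ _; set x5 := cover_lim _ _ _ _.
  set x6 := cover_bound _ _ _ _ _; lra.
- move=> A c; exact: local_cost_le.
- apply: le_trans (cover_cost_le R b t) _; rewrite ler_nat ltnS.
  by move: tD; rewrite (mem_trees D (t : ptree (dbl k.+1).+2)) => /andP[h _]; exact: leqW.
- exact: ball_local_cost.
Qed.

(** Six errors of e/6: [kappa], [N], two truncation errors, the unlisted balls and the frequencies.
    As the depth is found only after [D], the mass defect must be small for all depths below [N] at
    once. *)
Lemma rank_lower m : (forall t, 0 <= t <= 1 -> Lambda mu nu t <= m) ->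
  forall e, 0 < e -> whp P M (fun A =>
     1 - m - e <= (\rank (mx A))%:R / (ncols A)%:R).
Proof.
move=> Lm e e0.
set mb := mean mu; set nb' := mean (size_biased nu); set mb' := mean (size_biased mu).
have nb'0 : 0 <= nb' by exact: mean_ge0.
have mb'0 : 0 <= mb' by exact: mean_ge0.
(* The total coefficient of [kappa] in the bound on the value at the root. *)
pose C := mb * nb' + mb * (mb' * nb' + 1).
have C0 : 0 < C.
  by rewrite ltr_wpDl ?mulr_ge0 ?(ltW mu_mean) // mulr_gt0 // ltr_wpDl ?mulr_ge0.
have e6 : 0 < e / 6 by lra.
pose kappa := Num.min 1 (e / 6 / C).
have k01 : 0 < kappa <= 1 by rewrite lt_min ltr01 divr_gt0 //= ge_min lexx.
have kC : C * kappa <= e / 6.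
  by rewrite mulrC -ler_pdivlMr // ge_min lexx orbT.
have k0 : 0 < kappa by case/andP: k01.
have [J hJ] : exists J, 2 <= J%:R * kappa.
  exists (Num.bound (2 / kappa)); rewrite -ler_pdivrMr //; apply/ltW.
  by apply: archi_boundP; rewrite divr_ge0 // ltW.
have q0 : 0 < (kappa / 2) ^+ J by rewrite exprn_gt0 // divr_gt0.
(* [N] must outweigh the smallest scale, so it comes after [J]. *)
have [N N0 hN] : exists2 N, (0 < N)%N & mb * (N%:R * (kappa / 2) ^+ J)^-1 <= e / 6.
  pose z := mb / (kappa / 2) ^+ J / (e / 6).
  have z0 : 0 < z by rewrite !divr_gt0.
  have hz : z < (Num.bound z)%:R by apply: archi_boundP; exact: ltW.
  exists (Num.bound z); first by rewrite -(@ltr0n R); apply: lt_trans hz.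
  have B0 : 0 < (Num.bound z)%:R :> R by apply: lt_trans hz.
  move: hz; rewrite /z ltr_pdivrMr // ltr_pdivrMr // => hz.
  rewrite ler_pdivrMr ?mulr_gt0 //; apply/ltW; apply: (lt_le_trans hz).
  by rewrite le_eqVlt; apply/orP; left; apply/eqP; ring.
have c1 := eventually_le (Lambda_err_cvg mu_distr nu_distr mu_moment nu_moment nu_mean) e6.
have c2 : \forall D \near \oo, mb * tail (size_biased mu) D <= e / 6.
  have h : (fun D => mb * tail (size_biased mu) D) @ \oo --> mb * 0.
    by apply: cvgM; [exact: cvg_cst | exact: tail_cvg0].
  have := eventually_le h e6; apply: filterS => D; rewrite mulr0 add0r.
  by [].
have c3 := eventually_ltn N (fun k => mass_defect_eventually (dbl k.+1) e6).
have [D _ hD] : \forall D \near \oo, _ /\ (_ /\ _) := filterI c1 (filterI c2 c3).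
have {hD} [h1 [h2 h3]] := hD D (leqnn D); rewrite add0r in h1.
have [k [p [kN p01 hp]]] := root_value_bound (finite_mean_sublaw mu_law)
  (finite_mean_sublaw mu'_law) (finite_mean_sublaw nu'_law) mu_mean nu_mean
  (size_biasedE mu_mean) (size_biasedE nu_mean) (partial_mean_le mu_law D.+1)
  (partial_mean_le mu'_law D.+1) (partial_mean_le nu'_law D.+1) k01 hJ N0.
(* The diagonal of the projection on the kernel; on unlisted balls it is bounded by 1, as a
   coordinate never exceeds the norm. *)
pose psi (A : fmatrix R) := sval (cid (corank_trace (mx A))).
have psiE A : (ncols A - \rank (mx A))%:R = \sum_c psi A c.
  by have [h _] := svalP (cid (corank_trace (mx A))).
have psiP A j c : 0 <= c -> (forall v : 'rV[R]_(ncols A), v *m (mx A)^T = 0 ->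
    v 0 j ^+ 2 <= c * \sum_i v 0 i ^+ 2) -> psi A j <= c.
  by have [_ h] := svalP (cid (corank_trace (mx A))); exact: h.
have tr := @transfer R d Omega P M M_random mu nu d0 Omega0 Q X X_gw M_cvg gw_law_ge0
   D (dbl k.+1) (@colval R k.+1) 1 psi.
apply: (whp_mono M_random _ (tr _ _ _ _ e6)) => [A sA hA|A c|t tD|A c t sA tD iso].
- have nc0 : 0 < (ncols A)%:R :> R by rewrite ltr0n ncols_gt0.
  move: hA; rewrite -psiE natrB ?rank_leq_col // mulrBl divff ?lt0r_neq0 // mul1r => hA.
  have e1 := tree_expect_gw_le D (fun t => proj1 (andP (@colval_01 R k.+1 t))).
  have e2 := trunc_Lambda_le mu_distr nu_distr mu_moment nu_moment mu_mean nu_mean D p01.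
  have e3 := Lm p p01.
  have e4 : mass_defect law D (dbl k.+1) <= e / 6.
    apply: le_trans (h3 k kN); have := mass_defect_ge0 D (dbl k.+1) => md0.
    by rewrite ler_peMl // ler1n.
  move: kC; rewrite /C => kC.
  move: hp hA e1; rewrite -/(tlaw D) -/mb -/nb' -/mb'.
  move: hN e2 h1 h2; rewrite -/mb.
  set x1 := tree_expect _ _ _; set x2 := tree_expect _ _ _; set x3 := trunc_Lambda _ _ _ _ _ _ _.
  set x4 := (_ * _)^-1; set x5 := Lambda_err _ _ _; set x6 := mb * tail _ _.
  move=> a1 a2 a3 a4 a5 a6 a7.
  have : mb * ((mb' * nb' + 1) * kappa + x4) = mb * (mb' * nb' + 1) * kappa + mb * x4 by ring.
  have : C * kappa = mb * nb' * kappa + mb * (mb' * nb' + 1) * kappa by rewrite /C; ring.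
  lra.
- apply: psiP => // v _; rewrite mul1r (bigD1 c) //= lerDl sumr_ge0 // => i _.
  exact: sqr_ge0.
- by case/andP: (colval_01 R t).
- apply: psiP => [|v vker]; first by case/andP: (colval_01 R t).
  exact: ball_kernel_bound.
Qed.

End Rank.

Theorem theorem3p1 (R : realType) (mu nu : nat -> R)
  (mu_distr : is_distribution mu) (nu_distr : is_distribution nu)
  (mu_moment : finite_second_moment mu) (nu_moment : finite_second_moment nu)
  (mu_mean : 0 < mean mu) (nu_mean : 0 < mean nu)
  (d : nat -> measure_display) (Omega : forall n, measurableType (d n))
  (P : forall n, probability (Omega n) R)
  (M : forall n, Omega n -> fmatrix R)
  (M_random : forall n, random_sign_matrix (M n))
  (d0 : measure_display) (Omega0 : measurableType d0)
  (Q : probability Omega0 R) (X : seq nat -> {RV Q >-> nat})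
  (X_gw : gw_star_offspring mu nu X)
  (M_cvg : local_cvg_in_prob P (fun n w => tanner_set_rooted (M n w))
             Q (gw_tree X))
  (alpha alpha' : R)
  (alpha_min : is_min (fixed_points mu nu) alpha)
  (alpha'_max : is_max (fixed_points mu nu) alpha')
  (m : R)
  (m_max : is_max [set Lambda mu nu t | t in [set t : R | 0 <= t <= 1]] m)
  (Lambda_max : m = Num.max (Lambda mu nu alpha) (Lambda mu nu alpha')) :
  cvg_in_prob P
    (fun n w => (\rank (mx (M n w)))%:R / (ncols (M n w))%:R) (1 - m).
Proof.
apply: (whp_cvg_in_prob M_random (f := fun A => (\rank (mx A))%:R / (ncols A)%:R)).
  (* The larger of the two values decides from which constant messages to start: 1 for [alpha'], 0
     for [alpha]. *)
  rewrite Lambda_max => e e0; case: (leP (Lambda mu nu alpha) (Lambda mu nu alpha')) => _.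
    exact: (rank_upper mu_distr nu_distr mu_moment nu_moment mu_mean nu_mean M_random X_gw M_cvg (b := true)).
  exact: (rank_upper mu_distr nu_distr mu_moment nu_moment mu_mean nu_mean M_random X_gw M_cvg (b := false)).
apply: (rank_lower mu_distr nu_distr mu_moment nu_moment mu_mean nu_mean M_random X_gw M_cvg).
by move=> t t01; apply: m_max.2; exists t.
Qed.
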